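(* Let $\Omega, f, u_a, u_b, b, \varphi$ and $\theta_\varepsilon$ satisfy the standing assumptions listed in the context, and let $\lambda>0$, $\varepsilon>0$. Let $S$ be the control-to-state map of the Kirchhoff equation described in the context. Consider the problem (P$_\varepsilon$) of minimizing $$J_\varepsilon(y,u)=\int_\Omega\varphi(x,y(x))\,dx+\frac{\lambda}{2}\|u\|_{H^1(\Omega)}^2+\frac{1}{2\varepsilon}\int_\Omega (u_a-u)_+^2+(u-u_b)_+^2\,dx$$ subject to $y=S\big(u_a+\theta_\varepsilon(u-u_a)\big)$ and $u\in H^1(\Omega)$. Suppose that $(y,u)$, with $u\in H^1(\Omega)$ and $y\in H^1_0(\Omega)\cap W^{2,q}(\Omega)$ for any $q\in[1,\infty)$, is a locally optimal solution of (P$_\varepsilon$). Then there exists a unique adjoint state $p$, belonging to $H^1_0(\Omega)\cap W^{2,q}(\Omega)$ for all $q\in[1,\infty)$, such that the following system holds: (a) $\displaystyle -\Delta p-\Delta y\int_\Omega\frac{2\,b\,f\,p}{\big(u_a+\theta_\varepsilon(u-u_a)+b\,\|\nabla y\|^2\big)^2}\,dx=-\varphi_y(x,y)$ in $\Omega$, $\ p=0$ on $\partial\Omega$; (b) for all $v\in H^1(\Omega)$, $$\lambda\int_\Omega\nabla u\cdot\nabla v\,dx+\int_\Omega\Big(\frac{f\,p\,\theta_\varepsilon'(u-u_a)}{\big(u_a+\theta_\varepsilon(u-u_a)+b\,\|\nabla y\|^2\big)^2}+\lambda u\Big)v\,dx-\frac1\varepsilon\int_\Omega\big((u_a-u)_+-(u-u_b)_+\big)v\,dx=0;$$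 (c) $\displaystyle -\Delta y=\frac{f}{u_a+\theta_\varepsilon(u-u_a)+b\,\|\nabla y\|^2}$ in $\Omega$, $\ y=0$ on $\partial\Omega$.
   Context: Standing assumptions: $1\le N\le 3$ and $\Omega\subset\mathbb{R}^N$ is a bounded domain of class $C^{1,1}$. The right-hand side $f\in L^\infty(\Omega)$ satisfies $f\ge f_0$ a.e. for some real $f_0>0$. The bounds $u_a,u_b\in C(\overline\Omega)$ satisfy $u_b\ge u_a\ge u_0$ for some real $u_0>0$. The coefficient $b\in W^{1,\infty}(\Omega)$ satisfies $b\ge b_0$ a.e. for some real $b_0>0$. Assumptions on $\varphi:\Omega\times\mathbb{R}\to\mathbb{R}$: $\varphi(\cdot,y)$ is measurable for all $y\in\mathbb{R}$; $\varphi(x,\cdot)$ is twice continuously differentiable for a.e. $x\in\Omega$; there is $K>0$ with $|D_y^\ell\varphi(x,0)|\le K$ for $\ell=0,1,2$ and a.e. $x\in\Omega$; and for every $M>0$ there is $L(M)>0$ such that $|D_y^2\varphi(x,y_1)-D_y^2\varphi(x,y_2)|\le L(M)|y_1-y_2|$ for a.e. $x\in\Omega$ and all $|y_1|,|y_2|\le M$. The derivative of $\varphi$ with respect to its second argument is denoted $\varphi_y$. Cut-off function: $\theta_\varepsilon:\mathbb{R}\to\mathbb{R}$ is a monotone (nondecreasing), convex $C^3$ function with $\theta_\varepsilon(t)=t$ for $t>\varepsilon$, $\theta_\varepsilon(t)=0$ for $t<-\varepsilon$, and $\theta_\varepsilon'(t)\in[0,1]$ for all $t$. It acts pointwise on functions.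 Control-to-state map: for $w\in L^2(\Omega)$ with $w\ge u_a$ a.e., $S(w)$ is the unique $y\in H^1_0(\Omega)$ with $\int_\Omega\nabla y\cdot\nabla v\,dx=\int_\Omega \frac{f\,v}{w+b\,\|\nabla y\|^2}\,dx$ for all $v\in H^1_0(\Omega)$; it exists, is unique and belongs to $W^{2,q}(\Omega)$ for all $q\in[1,\infty)$. Notation: $\|\cdot\|$ without subscript is the $L^2(\Omega)$-norm; $\|u\|_{H^1(\Omega)}^2=\|u\|^2+\|\nabla u\|^2$; $v_+=\max\{0,v\}$. Local optimality: $(y,u)$ is locally optimal for (P$_\varepsilon$) if $u\in H^1(\Omega)$, $y=S(u_a+\theta_\varepsilon(u-u_a))$, and there is $r>0$ such that $J_\varepsilon(y,u)\le J_\varepsilon\big(S(u_a+\theta_\varepsilon(v-u_a)),v\big)$ for all $v\in H^1(\Omega)$ with $\|v-u\|_{H^1(\Omega)}\le r$. *)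

(* Defs.v *)
From HB Require Import structures.
From mathcomp Require Import all_boot all_order all_algebra.
From mathcomp Require Import all_classical all_reals all_analysis.

Set Implicit Arguments.
Unset Strict Implicit.
Unset Printing Implicit Defensive.
Import Order.TTheory GRing.Theory Num.Theory.
Import numFieldNormedType.Exports.

Local Open Scope classical_set_scope.
Local Open Scope ring_scope.

Section measurable_rV.
Context {R : realType} {n : nat}.

(* The sigma-algebra generated by the coordinates, that is, the Borel sets. *)
Let coords : 'I_n -> 'rV[R]_n -> R := fun i x => x ord0 i.

Let rV_set0 : g_sigma_preimage coords set0.
Proof. exact: sigma_algebra0. Qed.

Let rV_setC A : g_sigma_preimage coords A -> g_sigma_preimage coords (~` A).
Proof. exact: sigma_algebraC. Qed.

Let rV_bigcup (F : _^nat) : (forall i, g_sigma_preimage coords (F i)) ->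
  g_sigma_preimage coords (\bigcup_i (F i)).
Proof. exact: sigma_algebra_bigcup. Qed.

HB.instance Definition _ := @isMeasurable.Build default_measure_display
  'rV[R]_n (g_sigma_preimage coords) rV_set0 rV_setC rV_bigcup.

End measurable_rV.

Lemma measurable_rV_coord (R : realType) n (i : 'I_n) :
  measurable_fun [set: 'rV[R]_n] (fun x => x ord0 i).
Proof.
move=> _ Y mY; rewrite setTI; apply: sub_sigma_algebra => /=.
rewrite -bigcup_seq/=; exists i => /=; first by rewrite mem_index_enum.
by exists Y => //; rewrite setTI.
Qed.

Lemma measurable_fun_rV d (T : measurableType d) (R : realType) n
    (f : T -> 'rV[R]_n) :
  (forall i, measurable_fun [set: T] (fun t => f t ord0 i)) ->
  measurable_fun [set: T] f.
Proof.
move=> mf _ Y; rewrite setTI; rewrite /measurable/=.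
suff : g_sigma_preimage (fun (i : 'I_n) (x : 'rV[R]_n) => x ord0 i) `<=`
    [set A | measurable (f @^-1` A)] by apply.
apply: smallest_sub.
  split => /=.
  - by rewrite preimage_set0; exact: measurable0.
  - by move=> A mA; rewrite setTD preimage_setC; exact: measurableC.
  - by move=> F mF; rewrite preimage_bigcup; exact: bigcupT_measurable.
rewrite -bigcup_seq => A /= -[i _] [B mB <-].
rewrite setTI -[X in measurable X]setTI.
exact: (mf i measurableT _ mB).
Qed.

Definition rVcons (R : realType) n (z : R * 'rV[R]_n) : 'rV[R]_n.+1 :=
  row_mx z.1%:M z.2 : 'rV_(1 + n).

Lemma measurable_rVcons (R : realType) n :
  measurable_fun [set: R * 'rV[R]_n] (@rVcons R n).
Proof.
apply: measurable_fun_rV => i; rewrite /rVcons.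
case: (@split_ordP 1 n i) => j ->.
- rewrite (_ : (fun _ => _) = fst); first exact: measurable_fst.
  by apply/funext => z; rewrite (@row_mxEl _ 1 1 n) (ord1 j) !mxE/= ?mulr1n.
- rewrite (_ : (fun _ => _) = (fun x : 'rV[R]_n => x ord0 j) \o snd).
    by apply: measurableT_comp; [exact: measurable_rV_coord|
                                exact: measurable_snd].
  by apply/funext => z /=; rewrite (@row_mxEr _ 1 1 n).
Qed.

Section lebesgue_rV_step.
Context (R : realType) (n : nat).
Variable m : {sigma_finite_measure set 'rV[R]_n -> \bar R}.
Local Open Scope ereal_scope.

Definition lebesgue_rV_step : set 'rV[R]_n.+1 -> \bar R :=
  pushforward (@lebesgue_measure R \x m) (@rVcons R n).

Let step_measurable (A : set 'rV[R]_n.+1) :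
  measurable A -> measurable (@rVcons R n @^-1` A).
Proof.
move=> mA; rewrite -[X in measurable X]setTI.
exact: (@measurable_rVcons R n).
Qed.

Let step0 : lebesgue_rV_step set0 = 0.
Proof. by rewrite /lebesgue_rV_step /pushforward preimage_set0 measure0. Qed.

Let step_ge0 A : 0 <= lebesgue_rV_step A.
Proof. by rewrite /lebesgue_rV_step /pushforward; exact: measure_ge0. Qed.

Let step_sigma_additive : semi_sigma_additive lebesgue_rV_step.
Proof.
move=> F mF tF mUF; rewrite /lebesgue_rV_step /pushforward preimage_bigcup.
apply: measure_semi_sigma_additive.
- by move=> k; exact: step_measurable.
- apply/trivIsetP => /= i j _ _ ij; rewrite -preimage_setI.
  by move/trivIsetP : tF => /(_ _ _ _ _ ij) ->//; rewrite preimage_set0.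
- by rewrite -preimage_bigcup; exact: step_measurable.
Qed.

HB.instance Definition _ := isMeasure.Build _ _ _ lebesgue_rV_step
  step0 step_ge0 step_sigma_additive.

Let step_sigma_finite : sigma_finite setT lebesgue_rV_step.
Proof.
pose hd (x : 'rV[R]_n.+1) : R := x ord0 ord0.
pose tl (x : 'rV[R]_n.+1) : 'rV[R]_n := \row_j x ord0 (lift ord0 j).
have mh : measurable_fun setT (fun x => (hd x, tl x)).
  apply/measurable_fun_pairP; split; first exact: measurable_rV_coord.
  apply: measurable_fun_rV => i.
  rewrite (_ : (fun _ => _) = fun x : 'rV[R]_n.+1 => x ord0 (lift ord0 i)).
    exact: measurable_rV_coord.
  by apply/funext => x; rewrite mxE.
have hK z : (hd (rVcons z), tl (rVcons z)) = z.
  case: z => a v; congr pair.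
    apply: etrans (_ : row_mx a%:M v ord0 (lshift n ord0) = a).
      exact: (congr1 (fun j => row_mx a%:M v ord0 j) (val_inj _)).
    by rewrite row_mxEl !mxE/= ?mulr1n.
  apply/rowP => j; rewrite mxE.
  apply: etrans (row_mxEr a%:M v ord0 j).
  exact: (congr1 (fun j => row_mx a%:M v ord0 j) (val_inj _)).
have /sigma_finiteP[F [FT ndF Foo]] := sigma_finiteT (@lebesgue_measure R).
have /sigma_finiteP[G [GT ndG Goo]] := sigma_finiteT m.
exists (fun k => (fun x => (hd x, tl x)) @^-1` (F k `*` G k)).
  rewrite -preimage_bigcup (_ : \bigcup_k _ = setT) ?preimage_setT//.
  rewrite -setXTT FT GT predeqE => -[x y]; split.
    by move=> [k _ []/= ? ?]; split; exists k.
  move=> [/= [k _ Fkx] [l _ Gly]]; exists (maxn k l) => //; split.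
  - by move: x Fkx; exact/subsetPset/ndF/leq_maxl.
  - by move: y Gly; exact/subsetPset/ndG/leq_maxr.
move=> k; have [mF Fk] := Foo k; have [mG Gk] := Goo k; split.
  by rewrite -[X in measurable X]setTI; apply: mh => //; exact: measurableX.
rewrite /lebesgue_rV_step /pushforward -comp_preimage.
rewrite (_ : _ \o _ = id) ?preimage_id; last by apply/funext => z; exact: hK.
by rewrite product_measure1E// lte_mul_pinfty// ge0_fin_numE.
Qed.

HB.instance Definition _ := Measure_isSigmaFinite.Build _ _ _ lebesgue_rV_step
  step_sigma_finite.

End lebesgue_rV_step.

(* Lebesgue measure on R^n, as an n-fold product. *)
Fixpoint lebesgue_rV (R : realType) n :
    {sigma_finite_measure set 'rV[R]_n -> \bar R} :=
  if n is n'.+1 then lebesgue_rV_step (lebesgue_rV R n') else \d_ (0 : 'rV[R]_0).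


(* Every notion below takes functions defined on the whole space and only
   looks at them on [Omega]. *)
Section sobolev.
Context {R : realType} {n : nat}.
Local Notation V := 'rV[R]_n.
Local Notation mu := (lebesgue_rV R n).
Implicit Types (Omega : set V) (u v g psi : V -> R) (i : 'I_n).

Definition ae_in Omega (P : V -> Prop) := {ae mu, forall x, Omega x -> P x}.

(* Measurability for the completed sigma-algebra; [measurable_fun] is Borel
   measurability. *)
Definition lebesgue_measurable_fun Omega u :=
  exists2 g, measurable_fun Omega g & ae_in Omega (fun x => u x = g x).

Definition partial i u : V -> R := fun x => 'D_(delta_mx ord0 i) u x.

Fixpoint Ck_rV (k : nat) u : Prop :=
  continuous u /\
  if k is k'.+1 then
    forall i, (forall x, derivable u x (delta_mx ord0 i)) /\
              Ck_rV k' (partial i u)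
  else True.

Definition test_function Omega psi :=
  (forall k, Ck_rV k psi) /\
  exists K : set V, [/\ compact K, K `<=` Omega &
                        forall x, ~ K x -> psi x = 0].

Definition Lp Omega (q : \bar R) u : Prop := u \_ Omega \in Lfun mu q.

Definition L1loc Omega u :=
  measurable_fun Omega u /\
  forall K, compact K -> K `<=` Omega -> mu.-integrable K (EFin \o u).

Definition is_weak_partial Omega i u g :=
  [/\ L1loc Omega u, L1loc Omega g &
      forall psi, test_function Omega psi ->
        \int[mu]_(x in Omega) (u x * partial i psi x) =
        - \int[mu]_(x in Omega) (g x * psi x)].

(* W^{k,q}(Omega) *)
Fixpoint Wkq Omega (k : nat) (q : \bar R) u : Prop :=
  Lp Omega q u /\
  if k is k'.+1 then
    forall i, exists2 g, is_weak_partial Omega i u g & Wkq Omega k' q g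
  else True.

(* A representative of the weak derivative, which is unique up to a null set;
   it is meaningful only when a weak derivative exists. *)
Definition wpartial Omega i u : V -> R :=
  xget (fun=> 0) [set g | is_weak_partial Omega i u g].

Definition wlaplacian Omega u : V -> R :=
  fun x => \sum_(i < n) wpartial Omega i (wpartial Omega i u) x.

Definition grad_dot Omega u v : V -> R :=
  fun x => \sum_(i < n) wpartial Omega i u x * wpartial Omega i v x.

Definition L2normsq Omega u : R := \int[mu]_(x in Omega) (u x ^+ 2).

Definition gradnormsq Omega u : R := \int[mu]_(x in Omega) grad_dot Omega u u x.

Definition H1norm Omega u : R :=
  Num.sqrt (L2normsq Omega u + gradnormsq Omega u).

Definition H1 Omega u := Wkq Omega 1 2%:E u.

(* The closure of the test functions in H^1(Omega). *)
Definition H10 Omega u :=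
  H1 Omega u /\
  forall e : R, 0 < e ->
    exists2 psi, test_function Omega psi & H1norm Omega (u \- psi) < e.

End sobolev.

Section domain.
Context {R : realType}.

Definition C11_fun m (gamma : 'rV[R]_m -> R) :=
  Ck_rV 1 gamma /\
  exists L : R, forall i z z',
    `|partial i gamma z - partial i gamma z'| <= L * `|z - z'|.

(* Near each boundary point x0, after the rigid motion x |-> (x - x0) Q, the
   set is the strict epigraph, in some coordinate direction i, of a C^{1,1}
   function of the other coordinates. *)
Definition C11_boundary n (Omega : set 'rV[R]_n) :=
  forall x0, (closure Omega `\` interior Omega) x0 ->
    exists (Q : 'M[R]_n) (i : 'I_n) (gamma : 'rV[R]_n.-1 -> R) (r : R),
      [/\ Q *m Q^T = 1%:M, C11_fun gamma, 0 < r &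
          forall x, ball x0 r x ->
            (Omega x <->
             gamma (col' i ((x - x0) *m Q)) < ((x - x0) *m Q) ord0 i)].

Definition bounded_C11_domain n (Omega : set 'rV[R]_n) :=
  [/\ open Omega, connected Omega, Omega !=set0, bounded_set Omega &
      C11_boundary Omega].

End domain.

Section nonlinearities.
Context {R : realType}.

Definition Ck_real (k : nat) (g : R -> R) :=
  (forall j, (j < k)%N -> forall t, derivable (derive1n j g) t 1) /\
  continuous (derive1n k g).

Definition nonlinearity_assumptions n (Omega : set 'rV[R]_n)
    (phi : 'rV[R]_n -> R -> R) :=
  [/\ forall y, lebesgue_measurable_fun Omega (phi ^~ y),
      ae_in Omega (fun x => Ck_real 2 (phi x)),
      exists2 K : R, 0 < K & forall l, (l <= 2)%N ->
        ae_in Omega (fun x => `|derive1n l (phi x) 0| <= K) &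
      forall M : R, 0 < M -> exists2 L : R, 0 < L &
        ae_in Omega (fun x => forall y1 y2, `|y1| <= M -> `|y2| <= M ->
          `|derive1n 2 (phi x) y1 - derive1n 2 (phi x) y2| <= L * `|y1 - y2|)].

Definition cutoff_function (eps : R) (theta : R -> R) :=
  [/\ Ck_real 3 theta, {homo theta : s t / s <= t},
      convex_function [set: R^o] theta,
      (forall t, eps < t -> theta t = t) /\
      (forall t, t < - eps -> theta t = 0) &
      forall t, 0 <= derive1 theta t <= 1].

End nonlinearities.

Section control_problem.
Context {R : realType} {n : nat}.
Local Notation V := 'rV[R]_n.
Local Notation mu := (lebesgue_rV R n).
Variables (Omega : set V) (f b ua ub : V -> R).

Definition kirchhoff_state (w y : V -> R) :=
  H10 Omega y /\
  forall v, H10 Omega v ->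
    \int[mu]_(x in Omega) grad_dot Omega y v x =
    \int[mu]_(x in Omega)
      (f x * v x / (w x + b x * gradnormsq Omega y)).

Definition control_to_state_map (S : (V -> R) -> (V -> R)) :=
  forall w, Lp Omega 2%:E w -> ae_in Omega (fun x => ua x <= w x) ->
    [/\ kirchhoff_state w (S w),
        forall y, kirchhoff_state w y -> ae_in Omega (fun x => y x = S w x) &
        forall q : R, 1 <= q -> Wkq Omega 2 q%:E (S w)].

Definition pos (t : R) : R := Num.max 0 t.

Definition cutoff_control (theta : R -> R) (u : V -> R) : V -> R :=
  fun x => ua x + theta (u x - ua x).

Definition Jeps (phi : V -> R -> R) (lambda eps : R) (y u : V -> R) : R :=
  \int[mu]_(x in Omega) phi x (y x) + lambda / 2 * H1norm Omega u ^+ 2 +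
  1 / (2 * eps) * \int[mu]_(x in Omega)
    (pos (ua x - u x) ^+ 2 + pos (u x - ub x) ^+ 2).

Definition locally_optimal (S : (V -> R) -> (V -> R)) (phi : V -> R -> R)
    (theta : R -> R) (lambda eps : R) (y u : V -> R) :=
  [/\ H1 Omega u,
      ae_in Omega (fun x => y x = S (cutoff_control theta u) x) &
      exists2 r : R, 0 < r & forall v, H1 Omega v ->
        H1norm Omega (v \- u) <= r ->
        Jeps phi lambda eps y u <=
        Jeps phi lambda eps (S (cutoff_control theta v)) v].

Definition state_denom (theta : R -> R) (y u : V -> R) : V -> R :=
  fun x => cutoff_control theta u x + b x * gradnormsq Omega y.

(* The differential equations hold a.e. in Omega, for the weak Laplacian of
   functions in W^{2,q}; the boundary conditions are membership in H^1_0. *)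
Definition adjoint_equation (phi : V -> R -> R) (theta : R -> R)
    (y u p : V -> R) :=
  H10 Omega p /\
  ae_in Omega (fun x =>
    - wlaplacian Omega p x
    - wlaplacian Omega y x *
      \int[mu]_(z in Omega)
        (2 * b z * f z * p z / state_denom theta y u z ^+ 2) =
    - derive1 (phi x) (y x)).

Definition gradient_equation (theta : R -> R) (lambda eps : R)
    (y u p : V -> R) :=
  forall v, H1 Omega v ->
    lambda * \int[mu]_(x in Omega) grad_dot Omega u v x +
    \int[mu]_(x in Omega)
      ((f x * p x * derive1 theta (u x - ua x) / state_denom theta y u x ^+ 2
        + lambda * u x) * v x) -
    1 / eps * \int[mu]_(x in Omega)
      ((pos (ua x - u x) - pos (u x - ub x)) * v x) = 0.

Definition state_equation (theta : R -> R) (y u : V -> R) :=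
  H10 Omega y /\
  ae_in Omega (fun x => - wlaplacian Omega y x = f x / state_denom theta y u x).

End control_problem.

(* Main.v *)
Require Import Defs.
From HB Require Import structures.
From mathcomp Require Import all_boot all_order all_algebra.
From mathcomp Require Import all_classical all_reals all_analysis.
From mathcomp Require Import measurable_realfun ess_sup_inf.
From mathcomp Require Import ring lra.

(* Elliptic regularity enters only through the hypothesis on [S].  Testing the
   equations of two states with their sum shows that, for [h] close to a small
   positive constant, the energy [m t = ||grad S (w t)||^2] of the states of
   [w t = f / h - b t] is a nonexpansive function of [t]; the intermediate value
   theorem yields [m t = t], that is [w t + b m t = f / h] and
   [- Delta (S (w t)) = h].  By linearity, [- Delta q = h] is solvable in
   [H^1_0] and in every [W^{2,q}] for all bounded [h].

   The adjoint state is [p = - c y - q] with [- Delta q = phi_y(x, y)], where [c]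
   solves a scalar linear equation whose coefficient is at least [1] because
   [y >= 0] by the maximum principle; this also gives uniqueness.  When [u]
   is replaced by [u + t v], control, energy and state change by [O(t)], and the
   adjoint equation expresses the first variation of the state term of the cost
   through [p].  Hence [J (u + t v) <= J u + t l(v) + C t^2], where [l(v)] is the
   left-hand side of (b), and optimality for both signs of [t] gives
   [l(v) = 0]. *)

Set Implicit Arguments.
Unset Strict Implicit.
Unset Printing Implicit Defensive.
Import Order.TTheory GRing.Theory Num.Theory.
Import numFieldNormedType.Exports.

Local Open Scope classical_set_scope.
Local Open Scope ring_scope.

(** * Functions of class C^k *)

(** The obstacle is regularity. The adjoint state must lie in every W^{2,q}, and the only source of
    such functions is the nonlinear map [S], which accepts only controls above [ua]. This is why [h]
    is first taken small: [f / h - b t] then stays above [ua] for every possible energy [t]. It is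
    also why [h] ranges over a neighbourhood of a constant: differences of two such solutions reach
    every bounded right-hand side. [S] is never differentiated. The gradient formula rests on exact
    identities between two states, whose remainders are quadratic by Cauchy-Schwarz and Poincare.
    Truncations of functions in H^1_0, and the chain rule they call for, are avoided: the maximum
    principle composes a smooth bump with test functions and passes to the limit. The compositions
    of [phi] and of its derivative with [y] agree only almost everywhere with Borel functions, so
    integrals are compared by lemmas free of measurability. The square of [pos] is not twice
    differentiable, but its quadratic upper bound suffices, since an inequality for both signs of
    [t] already determines the linear term. *)

Lemma derivable1_comp (R : realType) (f g : R -> R) (x : R) :
  derivable f x 1 -> derivable g (f x) 1 -> derivable (g \o f) x 1.
Proof.
move=> /derivable1_diffP df /derivable1_diffP dg.
by apply/derivable1_diffP; exact: differentiable_comp.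
Qed.

Section directional.
Context {R : realType} {V : normedModType R}.
Implicit Types (u v : V -> R) (x e : V).

Lemma dir_line_fun u x e :
  (fun h : R => h^-1 *: (u (h *: e + x) - u x)) =
  (fun h : R => h^-1 *: (u ((h *: (1 : R) + 0) *: e + x) - u ((0 : R) *: e + x))).
Proof.
by apply/funext => h; rewrite addr0 scale0r add0r [_ *: 1]mulr1.
Qed.

Lemma derivable_line u x e :
  derivable u x e = derivable (fun h : R => u (h *: e + x)) 0 1.
Proof. by rewrite /derivable dir_line_fun. Qed.

Lemma derive_line u x e : 'D_e u x = 'D_1 (fun h : R => u (h *: e + x)) 0.
Proof. by rewrite /derive dir_line_fun. Qed.

Lemma is_derive_comp (g : R -> R) u x e :
  derivable u x e -> derivable g (u x) 1 ->
  is_derive x e (g \o u) (derive1 g (u x) * 'D_e u x).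
Proof.
rewrite derivable_line; set l := fun h : R => u (h *: e + x) => dl dg.
have l0 : l 0 = u x by rewrite /l scale0r add0r.
have dg' : derivable g (l 0) 1 by rewrite l0.
have glE : (fun h : R => (g \o u) (h *: e + x)) = g \o l by [].
have E := derive1_comp dl dg'.
apply: DeriveDef; first by rewrite derivable_line glE; exact: derivable1_comp.
rewrite derive_line glE -[LHS](derive1E (g \o l) 0) E l0; congr (_ * _).
by rewrite (derive1E l 0) [RHS]derive_line.
Qed.

End directional.

Section Ck.
Context {R : realType} {n : nat}.
Implicit Types (u v : 'rV[R]_n -> R) (k : nat).

Lemma Ck_rV_continuous k u : Ck_rV k u -> continuous u.
Proof. by case: k => [|k] []. Qed.

Lemma Ck_rVW k u : Ck_rV k.+1 u -> Ck_rV k u.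
Proof.
elim: k u => [|k IH] u [cu H]; first by split.
split=> // i; have [du Hu] := H i; split=> //; exact: IH.
Qed.

Lemma Ck_rV_cst k (c : R) : Ck_rV k (fun _ : 'rV[R]_n => c).
Proof.
elim: k c => [|k IH] c; (split; first exact: cst_continuous) => //.
move=> i; split=> [x|]; first exact: derivable_cst.
rewrite (_ : partial i _ = fun=> 0); first exact: IH.
by apply/funext => x; rewrite /partial derive_cst.
Qed.

Lemma is_derive_coord (i j : 'I_n) (x : 'rV[R]_n) :
  is_derive x (delta_mx ord0 j) (fun x : 'rV[R]_n => x ord0 i) (i == j)%:R.
Proof.
have E : (fun h : R => (h *: delta_mx ord0 j + x) ord0 i) =
    (fun h : R => h * (i == j)%:R + x ord0 i).
  by apply/funext => h; rewrite !mxE eqxx.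
apply: DeriveDef; first by rewrite derivable_line E.
by rewrite derive_line E deriveD// derive_cst addr0 deriveMr// derive_id mulr1.
Qed.

Lemma partial_coord (i j : 'I_n) :
  partial j (fun x : 'rV[R]_n => x ord0 i) = fun=> (i == j)%:R.
Proof. by apply/funext => x; rewrite /partial; have [_ ->] := is_derive_coord i j x. Qed.

Lemma Ck_rV_coord k (i : 'I_n) : Ck_rV k (fun x : 'rV[R]_n => x ord0 i).
Proof.
case: k => [|k]; (split; first exact: coord_continuous) => //.
move=> j; split=> [x|]; first by have [] := is_derive_coord i j x.
by rewrite partial_coord; exact: Ck_rV_cst.
Qed.

Lemma partial_cst i (c : R) : partial i (fun _ : 'rV[R]_n => c) = fun=> 0.
Proof. by apply/funext => x; rewrite /partial derive_cst. Qed.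

Lemma partialD i u v : (forall x, derivable u x (delta_mx ord0 i)) ->
  (forall x, derivable v x (delta_mx ord0 i)) ->
  partial i (fun x => u x + v x) = (fun x => partial i u x + partial i v x).
Proof. by move=> du dv; apply/funext => x; rewrite /partial deriveD. Qed.

Lemma partialM i u v : (forall x, derivable u x (delta_mx ord0 i)) ->
  (forall x, derivable v x (delta_mx ord0 i)) ->
  partial i (fun x => u x * v x) =
  (fun x => u x * partial i v x + v x * partial i u x).
Proof. by move=> du dv; apply/funext => x; rewrite /partial deriveM. Qed.

Lemma Ck_rVD k u v : Ck_rV k u -> Ck_rV k v -> Ck_rV k (fun x => u x + v x).
Proof.
elim: k u v => [|k IH] u v [cu Hu] [cv Hv];
  (split; first by move=> x; apply: continuousD; [exact: cu|exact: cv]) => //.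
move=> i; have [du ku] := Hu i; have [dv kv] := Hv i.
by split=> [x|]; [exact: derivableD|rewrite partialD//; exact: IH].
Qed.

Lemma Ck_rVM k u v : Ck_rV k u -> Ck_rV k v -> Ck_rV k (fun x => u x * v x).
Proof.
elim: k u v => [|k IH] u v Hu0 Hv0; have [cu Hu] := Hu0; have [cv Hv] := Hv0;
  (split; first by move=> x; apply: continuousM; [exact: cu|exact: cv]) => //.
move=> i; have [du ku] := Hu i; have [dv kv] := Hv i.
split=> [x|]; first exact: derivableM.
by rewrite partialM//; apply: Ck_rVD; apply: IH => //; exact: Ck_rVW.
Qed.

Lemma Ck_rVZ k (c : R) u : Ck_rV k u -> Ck_rV k (fun x => c * u x).
Proof. by move=> ku; apply: Ck_rVM => //; exact: Ck_rV_cst. Qed.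

Lemma Ck_rVB k u v : Ck_rV k u -> Ck_rV k v -> Ck_rV k (fun x => u x - v x).
Proof.
move=> ku kv; rewrite (_ : (fun _ => _) = (fun x => u x + (-1) * v x)).
  by apply: Ck_rVD => //; exact: Ck_rVZ.
by apply/funext => x; rewrite mulN1r.
Qed.

Lemma Ck_rV_sum k I (r : seq I) (F : I -> 'rV[R]_n -> R) :
  (forall i, Ck_rV k (F i)) -> Ck_rV k (fun x => \sum_(i <- r) F i x).
Proof.
move=> kF; elim: r => [|i r IH].
  by under eq_fun do rewrite big_nil; exact: Ck_rV_cst.
by under eq_fun do rewrite big_cons; exact: Ck_rVD.
Qed.

(** Continuity of each derivative is implied by the existence of the next one. *)
Definition smooth_fun (g : R -> R) := forall k t, derivable (derive1n k g) t 1.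

Lemma smooth_fun_derive1 g : smooth_fun g -> smooth_fun (derive1 g).
Proof. by move=> sg k t; rewrite -derive1Sn; exact: sg. Qed.

Lemma smooth_fun_horner (p : {poly R}) : smooth_fun (horner p).
Proof.
move=> k; suff [q ->] : exists q : {poly R}, derive1n k (horner p) = horner q.
  by move=> t; exact: derivable_horner.
elim: k => [|k [q IH]]; first by exists p.
by exists (q^`())%R; rewrite derive1nS IH derivE.
Qed.

Lemma smooth_fun_derivable g t : smooth_fun g -> derivable g t 1.
Proof. by move=> sg; exact: (sg 0). Qed.

Lemma smooth_fun_continuous g : smooth_fun g -> continuous g.
Proof.
move=> sg t; apply: differentiable_continuous; apply/derivable1_diffP.
exact: smooth_fun_derivable.
Qed.

Lemma partial_comp (g : R -> R) i u : smooth_fun g ->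
  (forall x, derivable u x (delta_mx ord0 i)) ->
  partial i (g \o u) = (fun x => derive1 g (u x) * partial i u x).
Proof.
move=> sg du; apply/funext => x; rewrite /partial.
by have [] := is_derive_comp (du x) (smooth_fun_derivable sg).
Qed.

Lemma Ck_rV_comp k (g : R -> R) u : smooth_fun g -> Ck_rV k u ->
  Ck_rV k (g \o u).
Proof.
elim: k g u => [|k IH] g u sg Hu0; have [cu Hu] := Hu0;
  (split; first by move=> x; apply: continuous_comp;
     [exact: cu|exact: smooth_fun_continuous]) => //.
move=> i; have [du ku] := Hu i; split=> [x|].
  by have [] := is_derive_comp (du x) (smooth_fun_derivable sg).
rewrite partial_comp//; apply: Ck_rVM => //.
by apply: (IH _ _ (smooth_fun_derive1 sg)); exact: Ck_rVW.
Qed.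

End Ck.

(** * A smooth bump *)

Lemma derivable1_continuous (R : realType) (g : R -> R) :
  (forall t, derivable g t 1) -> continuous g.
Proof. by move=> dg t; apply: differentiable_continuous; exact/derivable1_diffP. Qed.

(** The order of [x] and [y] is left free, for increments of either sign; the location of [c] is
    what [taylor2_le] builds on. *)
Lemma mean_value (R : realType) (f : R -> R) (x y : R) : (forall t, derivable f t 1) ->
  exists2 c, `|c - x| <= `|y - x| & f y - f x = derive1 f c * (y - x).
Proof.
move=> df; have cf := derivable1_continuous df.
have isd (t : R) : is_derive t 1 f (derive1 f t) by rewrite derive1E; exact: derivableP.
have [xy|/ltW yx] := leP x y.
- have [|c + ->] := @MVT_segment _ f (derive1 f) _ _ xy (fun t _ => isd t).
  + exact: continuous_subspaceT.
  rewrite in_itv/= => /andP[xc cy]; exists c => //.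
  by rewrite !ger0_norm ?subr_ge0// lerD2r.
- have [|c + E] := @MVT_segment _ f (derive1 f) _ _ yx (fun t _ => isd t).
  + exact: continuous_subspaceT.
  rewrite in_itv/= => /andP[xc cy]; exists c => //.
    by rewrite !ler0_norm ?subr_le0// lerN2 lerD2r.
  by rewrite -opprB E -mulrN opprB.
Qed.

Section expbump.
Context {R : realType}.
Implicit Types (p : {poly R}) (t s : R).

(** From exp(s) = exp(s/k)^k >= (1 + s/k)^k >= (s/k)^k. *)
Lemma exprn_expRN_le k s : 0 <= s -> s ^+ k * expR (- s) <= k%:R ^+ k.
Proof.
move=> s0; case: k => [|k]; first by rewrite !expr0 mul1r -expR0 ler_expR oppr_le0.
have k0 : 0 < k.+1%:R :> R by rewrite ltr0n.
have -> : expR (- s) = (expR (s / k.+1%:R) ^+ k.+1)^-1.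
  by rewrite -expRM_natl mulrC divfK ?expRN// gt_eqF.
rewrite ler_pdivrMr ?exprn_gt0 ?expR_gt0// -exprMn lerXn2r ?nnegrE//.
rewrite mulrC -ler_pdivrMr//; apply: le_trans (expR_ge1Dx _).
by rewrite lerDr.
Qed.

Lemma horner_expRN_bounded p :
  exists C : R, forall s, 0 <= s -> `|p.[s]| * expR (- s) <= C.
Proof.
(* The extra weight [s ^+ k] absorbs the factor ['X] split off at each step of the Horner
   induction. *)
suff H k : exists C : R, forall s, 0 <= s -> `|p.[s]| * s ^+ k * expR (- s) <= C.
  by have [C HC] := H 0%N; exists C => s s0; have := HC s s0; rewrite expr0 mulr1.
elim/poly_ind: p k => [|p c IH] k.
  by exists 0 => s s0; rewrite horner0 normr0 !mul0r.
have [C HC] := IH k.+1; exists (C + `|c| * k%:R ^+ k) => s s0.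
rewrite hornerMXaddC.
have H1 := HC s s0.
have H2 : `|c| * (s ^+ k * expR (- s)) <= `|c| * k%:R ^+ k.
  by rewrite ler_wpM2l// exprn_expRN_le.
apply: le_trans (lerD H1 H2).
rewrite exprS (_ : `|p.[s]| * (s * s ^+ k) * expR (- s) + _ =
   (`|p.[s]| * s + `|c|) * (s ^+ k * expR (- s))); last by ring.
rewrite -mulrA ler_wpM2r//; first by rewrite mulr_ge0 ?exprn_ge0 ?expR_ge0.
by rewrite (le_trans (ler_normD _ _))// normrM (ger0_norm s0).
Qed.

(** Differentiation maps the family of all p(1/t) exp(-1/t), extended by 0, into itself; smoothness
    of exp(-1/t) is therefore proved for the whole family at once. *)
Definition poly_bump p t : R := if 0 < t then p.[t^-1] * expR (- t^-1) else 0.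

Lemma poly_bump_bounded p : exists C : R, forall t, `|poly_bump p t| <= C.
Proof.
have [C HC] := horner_expRN_bounded p; exists (Num.max C 0) => t.
rewrite /poly_bump; case: ifPn => t0; last by rewrite normr0 le_max lexx orbT.
rewrite normrM (ger0_norm (expR_ge0 _)) le_max HC//.
by rewrite invr_ge0 ltW.
Qed.

Lemma is_derive_poly_bump p t :
  is_derive t 1 (poly_bump p) (poly_bump ('X^2 * (p - p^`())) t).
Proof.
have [t0|t0|t0] := ltgtP 0 t.
- have E : {near t, (fun t => p.[t^-1] * expR (- t^-1)) =1 poly_bump p}.
    near=> s; rewrite /poly_bump ifT//.
    by near: s; exact: lt_nbhsr.
  have tn0 : t != 0 by rewrite gt_eqF.
  apply: (near_eq_is_derive E).
  have dV : is_derive t 1 (fun s : R => s^-1) (- t ^- 2).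
    have := @is_deriveV R id t 1 1 tn0 (is_derive_id t 1).
    by rewrite [_ *: _]mulr1.
  have d1 : is_derive t 1 (fun s : R => p.[s^-1]) (p^`().[t^-1] * - t ^- 2).
    exact: (@is_derive1_comp _ (horner p) (fun s => s^-1)).
  have d2 : is_derive t 1 (fun s : R => expR (- s^-1)) (expR (- t^-1) * t ^- 2).
    apply: (@is_derive1_comp _ expR (fun s => - s^-1)).
    by rewrite -[X in is_derive _ _ _ X]opprK; exact: is_deriveN.
  suff -> : poly_bump ('X^2 * (p - p^`())) t =
      p.[t^-1] *: (expR (- t^-1) * t ^- 2) +
      expR (- t^-1) *: (p^`().[t^-1] * - t ^- 2) by exact: is_deriveM.
  by rewrite /poly_bump t0 !hornerE !/(_ *: _)/= -exprVn; ring.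
- have E : {near t, (fun=> 0) =1 poly_bump p}.
    near=> s; rewrite /poly_bump ifF//; apply/negbTE; rewrite -leNgt ltW//.
    by near: s; exact: lt_nbhsl.
  apply: (near_eq_is_derive E).
  rewrite /poly_bump ltNge ltW//=; exact: is_derive_cst.
- rewrite -t0 /(poly_bump (_ * _)) ltxx.
  (* At 0 the difference quotient p(1/h) exp(-1/h) / h equals h times h^-2 p(1/h) exp(-1/h), and the
     second factor is bounded by the estimate for ['X^2 * p]. *)
  have [C HC] := horner_expRN_bounded ('X^2 * p).
  have C0 : 0 <= C by apply: le_trans (HC 0 _); rewrite ?mulr_ge0 ?expR_ge0.
  have cv : (fun h => h^-1 *: (poly_bump p (h *: 1 + 0) - poly_bump p 0))
      @ 0^' --> (0 : R).
    apply/cvgr0Pnorm_le => e e0.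
    near=> h.
    rewrite [_ *: 1]mulr1 addr0 {2}/poly_bump ltxx subr0 [_ *: _]/(_ * _) normrM.
    have hn0 : h != 0 by near: h; exact: nbhs_dnbhs_neq.
    rewrite /poly_bump; case: ifPn => h0; last by rewrite normr0 mulr0 ltW.
    have hi : 0 <= h^-1 by rewrite invr_ge0 ltW.
    have := HC h^-1 hi.
    rewrite !hornerE normrM normrX (ger0_norm hi) => H.
    have : h * (h^-1 ^+ 2 * `|p.[h^-1]| * expR (- h^-1)) <= h * C.
      by rewrite ler_wpM2l// ltW.
    rewrite normrM (ger0_norm (expR_ge0 _)).
    rewrite (_ : h * _ = h^-1 * (`|p.[h^-1]| * expR (- h^-1))); last by field.
    move=> /le_trans; apply.
    have : `|h| < e / (C + 1).
      near: h; apply: dnbhs0_lt; rewrite divr_gt0//; lra.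
    rewrite gtr0_norm// ltr_pdivlMr; last lra.
    nra.
  apply: DeriveDef; first by apply/cvg_ex; exists 0.
  exact: cvg_lim.
Unshelve. all: by end_near.
Qed.

Lemma smooth_poly_bump p : smooth_fun (poly_bump p).
Proof.
move=> k; suff [q ->] : exists q, derive1n k (poly_bump p) = poly_bump q.
  by move=> t; have [] := is_derive_poly_bump q t.
elim: k => [|k [q IH]]; first by exists p.
exists ('X^2 * (q - q^`())); rewrite derive1nS IH; apply/funext => t.
by rewrite derive1E; have [_ ->] := is_derive_poly_bump q t.
Qed.

Definition expbump : R -> R := poly_bump 1.

Lemma expbumpE t : expbump t = if 0 < t then expR (- t^-1) else 0.
Proof. by rewrite /expbump /poly_bump hornerC mul1r. Qed.

Lemma smooth_expbump : smooth_fun expbump.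
Proof. exact: smooth_poly_bump. Qed.

Lemma expbump_ge0 t : 0 <= expbump t.
Proof. by rewrite expbumpE; case: ifP => // _; exact: expR_ge0. Qed.

Lemma expbump_gt0 t : (0 < expbump t) = (0 < t).
Proof. by rewrite expbumpE; case: ifP => _; [exact: expR_gt0|rewrite ltxx]. Qed.

Lemma expbump_le0 t : t <= 0 -> expbump t = 0.
Proof. by move=> t0; rewrite expbumpE ltNge t0. Qed.

Lemma expbump_le1 t : expbump t <= 1.
Proof.
rewrite expbumpE; case: ifPn => // t0.
by rewrite -expR0 ler_expR oppr_le0 invr_ge0 ltW.
Qed.

(** The derivative is t^-2 exp(-1/t) for t > 0. Its sign and its bound compare the energy of
    [expbump (psi - Y)] with a mixed energy in the maximum principle. *)
Lemma derive1_expbump_bounded : exists2 C : R, 0 < C &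
  forall t, 0 <= derive1 expbump t <= C.
Proof.
have [C HC] := poly_bump_bounded ('X^2 * (1 - 1^`())).
have E t : derive1 expbump t = poly_bump ('X^2 * (1 - 1^`())) t.
  by rewrite derive1E; have [_ ->] := is_derive_poly_bump 1 t.
exists (`|C| + 1) => [|t]; first by rewrite ltr_pwDr.
rewrite E; apply/andP; split; last first.
  apply: le_trans (ler_norm _) (le_trans (HC t) _).
  by rewrite (le_trans (ler_norm C))// lerDl.
rewrite /poly_bump; case: ifP => // t0; apply: mulr_ge0; last exact: expR_ge0.
by rewrite derivC !hornerE subr0 ?mulr1 ?exprn_ge0 ?mulr_ge0// invr_ge0 ltW.
Qed.

Lemma expbump_lipschitz : exists2 C : R, 0 < C &
  forall s t, `|expbump s - expbump t| <= C * `|s - t|.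
Proof.
have [C C0 HC] := derive1_expbump_bounded; exists C => // s t.
have [c _ ->] := mean_value t s (fun r => smooth_fun_derivable smooth_expbump).
by rewrite normrM ler_wpM2r//; have /andP[a b] := HC c; rewrite ger0_norm.
Qed.

(** Smooth functions with values in [0, 1] thus tend pointwise to the indicator of an open
    half-line; composed with a coordinate they give half-spaces. *)
Lemma cvg_expbump_natmul t :
  (fun k : nat => expbump (k.+1%:R * t)) @ \oo --> (if 0 < t then 1 else 0 : R).
Proof.
case: ifPn => t0; last first.
  apply: cvg_near_cst; near=> k; rewrite expbump_le0//.
  by rewrite mulr_ge0_le0// leNgt.
have cexp : continuous_at (0 : R) expR by exact: continuous_expR.
have c0 : (fun k : nat => - (k.+1%:R^-1 / t)) @ \oo --> (0 : R).
  have -> : nbhs (0 : R) = nbhs (- (0 * t^-1) : R) by rewrite mul0r oppr0.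
  by apply: cvgN; apply: cvgMl; exact: cvg_harmonic.
have := cvg_comp _ _ c0 cexp; rewrite expR0; apply: cvg_trans.
by apply: near_eq_cvg; near=> k; rewrite expbumpE pmulr_rgt0 ?ltr0n// t0 invfM.
Unshelve. all: by end_near.
Qed.

End expbump.
Arguments expbump {R} t.
Arguments smooth_expbump {R}.

(** Two applications of the mean value theorem; the factor 1/2 of Taylor's formula is given up. *)
Lemma taylor2_le (R : realType) (g : R -> R) (a h C : R) :
  (forall t, derivable g t 1) -> (forall t, derivable (derive1 g) t 1) ->
  (forall t, `|t - a| <= `|h| -> `|derive1n 2 g t| <= C) ->
  `|g (a + h) - g a - derive1 g a * h| <= C * h ^+ 2.
Proof.
move=> dg dg' HC.
have aK : a + h - a = h by rewrite addrC addKr.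
have [c] := mean_value a (a + h) dg; rewrite aK => ca E.
have [c' c'a E'] := mean_value a c dg'.
rewrite E -mulrBl E' !normrM -mulrA -[h ^+ 2]real_normK ?num_real// expr2.
by apply: ler_pM; rewrite ?mulr_ge0// ?ler_wpM2r//; apply: HC; exact: le_trans ca.
Qed.

(** * Lebesgue measure on R^n *)

Definition rV_box (R : realType) n (M : R) :=
  [set x : 'rV[R]_n | forall i, `|x ord0 i| <= M].
Arguments rV_box {R} n M.

Section rV_measure.
Context {R : realType}.

Lemma rVcons_ord0 n (z : R * 'rV[R]_n) : rVcons z ord0 ord0 = z.1.
Proof.
rewrite /rVcons (_ : ord0 = lshift n ord0 :> 'I_(1 + n)); last exact: val_inj.
by rewrite (@row_mxEl _ 1 1 n) !mxE/= mulr1n.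
Qed.

Lemma rVcons_lift n (z : R * 'rV[R]_n) j : rVcons z ord0 (lift ord0 j) = z.2 ord0 j.
Proof.
rewrite /rVcons (_ : lift ord0 j = rshift 1 j :> 'I_(1 + n)); last exact: val_inj.
by rewrite (@row_mxEr _ 1 1 n).
Qed.

Lemma rVconsP n (x : 'rV[R]_n.+1) (z : R * 'rV[R]_n) :
  x ord0 ord0 = z.1 -> (forall j, x ord0 (lift ord0 j) = z.2 ord0 j) -> x = rVcons z.
Proof.
move=> x0 xj; apply/rowP => i; case: (unliftP ord0 i) => [j ->|->].
  by rewrite xj rVcons_lift.
by rewrite x0 rVcons_ord0.
Qed.

Lemma rV_ballE n (c x : 'rV[R]_n) (r : R) : 0 < r ->
  ball c r x <-> forall i, `|c ord0 i - x ord0 i| < r.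
Proof.
move=> r0; split=> [[_ H] i|H]; first exact: H.
by split=> // i j; rewrite (ord1 i); exact: H.
Qed.

Lemma measurable_rV_ball n (c : 'rV[R]_n) (r : R) : measurable (ball c r).
Proof.
have [r0|r0] := ltP 0 r; last first.
  rewrite (_ : ball c r = set0)//; apply/seteqP; split=> // x [].
  by rewrite ltNge r0.
rewrite (_ : ball c r = \bigcap_(i in [set: 'I_n])
    ((fun x : 'rV[R]_n => x ord0 i) @^-1` [set t | `|c ord0 i - t| < r])).
  apply: fin_bigcap_measurable => // i _.
  rewrite -[X in measurable X]setTI; apply: measurable_rV_coord => //.
  apply: open_measurable; exact: (@ball_open R R^o (c ord0 i) r).
apply/seteqP; split=> x /= H; first by move=> i _; apply/(rV_ballE _ _ r0): i.
by apply/(rV_ballE _ _ r0) => i; exact: H.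
Qed.

(** Balls of the sup norm are finite intersections of coordinate strips, hence lie in the
    sigma-algebra generated by the coordinates, and an open set is the union of the countably many
    rational balls it contains. *)
Lemma open_measurable_rV n (U : set 'rV[R]_n) : open U -> measurable U.
Proof.
move=> oU.
pose B (q : 'rV[rat]_n * nat) := ball (map_mx ratr q.1 : 'rV[R]_n) q.2.+1%:R^-1.
rewrite (_ : U = \bigcup_q (if `[< B q `<=` U >] then B q else set0)).
  apply: countable_bigcupT_measurable; first exact: countableP.
  move=> q.
  by case: ifP => // _; exact: measurable_rV_ball.
apply/seteqP; split=> [x Ux|x [q _]]; last first.
  by case: ifPn => [/asboolP qU /qU|].
have /nbhs_ballP[e /= e0 xeU] : nbhs x U by exact: open_nbhs_nbhs.
have [k ke] : exists k : nat, k.+1%:R^-1 < e / 2.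
  near \oo => k; exists k; near: k.
  have e20 : 0 < e / 2 by rewrite divr_gt0.
  have /cvgr0Pnorm_lt/(_ _ e20) := @cvg_harmonic R.
  by apply: filterS => k; rewrite ger0_norm ?harmonic_ge0.
have k0 : 0 < k.+1%:R^-1 :> R by rewrite invr_gt0.
have /choice[q qx] : forall i, exists q : rat, `|ratr q - x ord0 i| < k.+1%:R^-1.
  move=> i; move: (k.+1%:R^-1) k0 (x ord0 i) => d d0 t.
  have [|q] := @rat_in_itvoo R (t - d) (t + d); first lra.
  by rewrite in_itv/= => /andP[a b]; exists q; rewrite ltr_norml; apply/andP; split; lra.
exists (\row_i q i, k) => //.
have Bx : B (\row_i q i, k) x.
  by apply/(rV_ballE _ _ k0) => i; rewrite !mxE; exact: qx.
rewrite ifT//; apply/asboolP => y By; apply: xeU.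
apply/(rV_ballE _ _ e0) => i; rewrite (splitr e).
move: Bx By => /(rV_ballE _ _ k0)/(_ i) Bx /(rV_ballE _ _ k0)/(_ i) By.
rewrite distrC in Bx; have := ler_distD (map_mx ratr (\row_i q i) ord0 i) (x ord0 i) (y ord0 i).
by move=> /le_lt_trans; apply; rewrite ltrD// (lt_trans _ ke).
Unshelve. all: by end_near.
Qed.

Lemma closed_measurable_rV n (A : set 'rV[R]_n) : closed A -> measurable A.
Proof.
by move=> cA; rewrite -[A]setCK; apply: measurableC; apply: open_measurable_rV; exact: closed_openC.
Qed.

Lemma within_continuous_measurable_rV n (D : set 'rV[R]_n) (f : 'rV[R]_n -> R) :
  {within D, continuous f} -> measurable_fun D f.
Proof.
move=> /continuousP cf mD; apply: (measurability _ (RGenOpens.measurableE R)) => //.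
move=> _ [_ [a [b ->]] <-].
have oab : open `]a, b[%classic by exact: interval_open.
have [V oV VE] := (open_subspaceP _ _).1 (cf _ oab).
rewrite setIC -VE; apply: measurableI => //; exact: open_measurable_rV.
Qed.

Lemma continuous_measurable_rV n (f : 'rV[R]_n -> R) :
  continuous f -> measurable_fun [set: 'rV[R]_n] f.
Proof.
by move=> cf; apply: within_continuous_measurable_rV; exact: continuous_subspaceT.
Qed.

Lemma compact_rV_box n M : compact (@rV_box R n M).
Proof.
rewrite (_ : rV_box n M = [set v : 'rV[R]_n | forall i, `[- M, M]%classic (v ord0 i)]).
  by apply: (@rV_compact R n (fun=> `[- M, M]%classic)) => _; exact: segment_compact.
by apply/seteqP; split=> x /= H i; have := H i; rewrite /= in_itv/= ler_norml.
Qed.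

Lemma rV_box_measurable n M : measurable (@rV_box R n M).
Proof.
apply: closed_measurable_rV; apply: compact_closed; last exact: compact_rV_box.
exact: norm_hausdorff.
Qed.

Lemma rV_box_lty n M : (lebesgue_rV R n (rV_box n M) < +oo)%E.
Proof.
elim: n => [|n IH].
  by rewrite /= diracE; case: (_ \in _); rewrite ltry.
have -> : lebesgue_rV R n.+1 (rV_box n.+1 M) =
  (@lebesgue_measure R \x lebesgue_rV R n)%E (@rVcons R n @^-1` rV_box n.+1 M) by [].
rewrite (_ : _ @^-1` _ = `[- M, M] `*` rV_box n M).
  rewrite product_measure1E//; last exact: rV_box_measurable.
  have lM : (lebesgue_measure (`[(- M)%R, M]%classic : set R) < +oo)%E.
    by rewrite lebesgue_measure_itv/=; case: ifP => // _; rewrite -EFinB ltry.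
  by apply: lte_mul_pinfty => //; rewrite ge0_fin_numE.
apply/seteqP; split=> -[a z] /=.
  move=> H; split=> /=.
    by have := H ord0; rewrite rVcons_ord0/= in_itv/= ler_norml.
  by move=> j; have := H (lift ord0 j); rewrite rVcons_lift.
move=> [/= + H] i; rewrite in_itv/= -ler_norml => aM.
by case: (unliftP ord0 i) => [j ->|->]; rewrite ?rVcons_lift ?rVcons_ord0.
Qed.

Lemma bounded_set_rV_box n (D : set 'rV[R]_n) : bounded_set D ->
  exists2 M : R, 0 < M & D `<=` rV_box n M.
Proof.
move=> [M [_ HM]]; exists (`|M| + 1) => [|x Dx i]; first by rewrite ltr_pwDr.
have H : `|x| <= `|M| + 1 by apply: HM => //; rewrite ltr_pwDr// ler_norm.
apply: le_trans H; rewrite [leRHS]mx_normrE.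
exact: (le_bigmax _ (fun ij => `|x ij.1 ij.2|) (ord0, i)).
Qed.

Lemma sub_rV_box_bounded n (D : set 'rV[R]_n) M : D `<=` rV_box n M -> bounded_set D.
Proof.
move=> DM; have [C [Cr HC]] := compact_bounded (@compact_rV_box n M).
by exists C; split=> // C' CC' x /DM; exact: HC.
Qed.

Section compact_support.
Variables (n : nat) (f : 'rV[R]_n -> R) (M : R).
Hypothesis (cf : continuous f) (f0 : forall x, ~ rV_box n M x -> f x = 0).

Lemma box_support_bounded : exists2 C : R, 0 < C & forall x, `|f x| <= C.
Proof.
have : compact (f @` rV_box n M).
  apply: continuous_compact; last exact: compact_rV_box.
  exact: continuous_subspaceT.
move=> /compact_bounded[C [_ HC]]; exists (`|C| + 1) => [|x]; first by rewrite ltr_pwDr.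
have [xM|xM] := pselect (rV_box n M x).
  by apply: HC; [rewrite ltr_pwDr// ler_norm|exists x].
by rewrite f0// normr0 addr_ge0.
Qed.

Lemma box_support_integrable :
  (lebesgue_rV R n).-integrable [set: 'rV[R]_n] (EFin \o f).
Proof.
have [C C0 HC] := box_support_bounded.
have -> : EFin \o f = (EFin \o f) \_ (rV_box n M).
  apply/funext => x; rewrite patchE; case: ifPn => // /negP xM.
  by rewrite /= f0// => H; apply: xM; rewrite inE.
rewrite -(integrable_mkcond _ (rV_box_measurable M)).
apply: measurable_bounded_integrable.
- exact: rV_box_measurable.
- exact: rV_box_lty.
- by apply: measurable_funTS; exact: continuous_measurable_rV.
- exists C; split; first exact: num_real.
  by move=> D CD x _ /=; exact: le_trans (HC x) (ltW CD).
Qed.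

End compact_support.

Lemma rVcons_shift n (a : R) (z : 'rV[R]_n) (h : R) (j : 'I_n) :
  rVcons (a, h *: delta_mx ord0 j + z) =
  h *: delta_mx ord0 (lift ord0 j) + rVcons (a, z).
Proof.
symmetry; apply: rVconsP => [|k] /=.
  by rewrite mxE [X in X + _]mxE [X in _ * X]mxE rVcons_ord0 mulr0 add0r.
by rewrite mxE [X in X + _]mxE [X in _ * X]mxE rVcons_lift (inj_eq (@lift_inj _ _)) [RHS]mxE [X
  in _ = X + _]mxE [X in _ = _ * X + _]mxE.
Qed.

Lemma rVcons_shift0 n (a : R) (z : 'rV[R]_n) (h : R) :
  rVcons (h + a, z) = h *: delta_mx ord0 ord0 + rVcons (a, z).
Proof.
symmetry; apply: rVconsP => [|k] /=.
  by rewrite mxE [X in X + _]mxE [X in _ * X]mxE rVcons_ord0 !eqxx mulr1.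
by rewrite mxE [X in X + _]mxE [X in _ * X]mxE rVcons_lift eqxx mulr0 add0r.
Qed.

Lemma continuous_rVcons2 n (a : R) : continuous (fun z : 'rV[R]_n => rVcons (a, z)).
Proof.
move=> z A /nbhs_ballP[e /= e0 eA]; apply/nbhs_ballP; exists e => //= y.
move=> /(rV_ballE _ _ e0) H; apply: eA; apply/(rV_ballE _ _ e0) => i.
case: (unliftP ord0 i) => [j ->|->]; rewrite ?rVcons_lift ?rVcons_ord0//.
by rewrite /= subrr normr0.
Qed.

Lemma continuous_rVcons1 n (z : 'rV[R]_n) : continuous (fun a : R => rVcons (a, z)).
Proof.
move=> a A /nbhs_ballP[e /= e0 eA]; apply/nbhs_ballP; exists e => //= b H; apply: eA.
apply/(rV_ballE _ _ e0) => i.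
case: (unliftP ord0 i) => [j ->|->]; rewrite ?rVcons_lift ?rVcons_ord0//.
by rewrite /= subrr normr0.
Qed.

Lemma Ck_rV1_rVcons n (psi : 'rV[R]_n.+1 -> R) (a : R) : Ck_rV 1 psi ->
  Ck_rV 1 (fun z => psi (rVcons (a, z))) /\
  forall j, partial j (fun z => psi (rVcons (a, z))) =
    (fun z => partial (lift ord0 j) psi (rVcons (a, z))).
Proof.
move=> [cpsi dpsi].
have E j z : (fun h : R => psi (rVcons (a, h *: delta_mx ord0 j + z))) =
    (fun h => psi (h *: delta_mx ord0 (lift ord0 j) + rVcons (a, z))).
  by apply/funext => h; rewrite rVcons_shift.
have pE j : partial j (fun z => psi (rVcons (a, z))) =
    (fun z => partial (lift ord0 j) psi (rVcons (a, z))).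
  by apply/funext => z; rewrite /partial derive_line E -derive_line.
split=> //; split.
  move=> z; apply: (@continuous_comp _ _ _ (fun z => rVcons (a, z)) psi).
    exact: continuous_rVcons2.
  exact: cpsi.
move=> j; have [d [c _]] := dpsi (lift ord0 j); split.
  by move=> z; rewrite derivable_line E -derivable_line.
rewrite pE; split=> // z.
apply: (@continuous_comp _ _ _ (fun z => rVcons (a, z)) _); last exact: c.
exact: continuous_rVcons2.
Qed.

Lemma integral_derive1_eq0 (g dg : R -> R) (M : R) : 0 < M ->
  (forall t : R, is_derive t 1 g (dg t)) -> continuous dg ->
  (forall t, M < `|t| -> g t = 0) ->
  (\int[lebesgue_measure]_t (dg t)%:E = 0)%E.
Proof.
move=> M0 gd cdg gM.
have cg : continuous g.
  move=> t; apply: differentiable_continuous; apply/derivable1_diffP.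
  by have [] := gd t.
(* The margin 1 leaves every point outside the interval a neighbourhood on which [g] vanishes, so
   [dg] vanishes there as well. *)
have M1 : - (M + 1) < M + 1 by lra.
have gz t : M + 1 <= `|t| -> g t = 0 by move=> h; apply: gM; lra.
have dgz t : M + 1 <= `|t| -> dg t = 0.
  move=> h; have [_ <-] := gd t; rewrite (@near_eq_derive _ _ _ _ (cst 0)) ?derive_cst//.
  near=> s; apply: gM.
  have : `|t - s| < 1 by near: s; exact: nbhsx_ballx.
  have := ler_distD s t 0; rewrite !subr0 => h1 h2; lra.
transitivity (\int[lebesgue_measure]_(t in `[(- (M + 1))%R, (M + 1)%R]) (dg t)%:E)%E.
  rewrite [RHS]integral_mkcond; apply: eq_integral => t _.
  rewrite patchE; case: ifPn => // /negP tM; congr EFin; apply: dgz.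
  rewrite leNgt; apply/negP => h; apply: tM; rewrite inE/= in_itv/=.
  by rewrite -ler_norml ltW.
rewrite (@continuous_FTC2 _ dg g)//.
- rewrite !gz ?subee//; first by rewrite normrN ger0_norm//; lra.
  by rewrite ger0_norm//; lra.
- exact: continuous_subspaceT.
- split; first by move=> t _; have [] := gd t.
  + exact/cvg_at_right_filter/cg.
  + exact/cvg_at_left_filter/cg.
- by move=> t _; rewrite derive1E; have [_ ->] := gd t.
Unshelve. all: by end_near.
Qed.

(** Fubini, with the order of integration chosen by [i]: for a tail coordinate the inner integral is
    the statement in one dimension less, for the head coordinate it is the fundamental theorem of
    calculus. *)
Lemma integral_partial_eq0 n (psi : 'rV[R]_n -> R) (M : R) (i : 'I_n) :
  0 < M -> Ck_rV 1 psi -> (forall x, ~ rV_box n M x -> psi x = 0) ->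
  (\int[lebesgue_rV R n]_x (partial i psi x)%:E = 0)%E.
Proof.
move=> M0.
have part0 m (phi : 'rV[R]_m -> R) k : (forall x, ~ rV_box m M x -> phi x = 0) ->
    forall x, ~ rV_box m M x -> partial k phi x = 0.
  move=> phi0 x xM; rewrite /partial (@near_eq_derive _ _ _ _ (cst 0)) ?derive_cst//.
  have : open (~` rV_box m M).
    apply: closed_openC; apply: compact_closed; last exact: compact_rV_box.
    exact: norm_hausdorff.
  by move=> oM; near=> y; apply: phi0; near: y; exact: open_nbhs_nbhs.
elim: n psi i => [|n IH] psi i; first by case: i.
move=> kpsi psi0; have [cpsi dpsi] := kpsi.
have [di [ci _]] := dpsi i.
have mp : measurable_fun [set: 'rV[R]_n.+1] (EFin \o partial i psi).
  by apply/measurable_EFinP; exact: continuous_measurable_rV.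
have ip := box_support_integrable ci (part0 _ _ i psi0).
have ip2 : (@lebesgue_measure R \x lebesgue_rV R n)%E.-integrable setT
    ((EFin \o partial i psi) \o @rVcons R n).
  move/integrableP : ip => [_ ip]; apply/integrableP; split.
    by apply: measurableT_comp => //; exact: measurable_rVcons.
  apply: le_lt_trans ip; rewrite [leRHS]ge0_integral_pushforward//.
  - exact: measurable_rVcons.
  - exact: measurableT_comp.
transitivity (\int[(@lebesgue_measure R \x lebesgue_rV R n)]_z
    ((EFin \o partial i psi) \o @rVcons R n) z)%E.
  have E : (\int[pushforward (@lebesgue_measure R \x lebesgue_rV R n) (@rVcons R n)]_y
      (EFin \o partial i psi) y = \int[(@lebesgue_measure R \x lebesgue_rV R n)]_(z in
      @rVcons R n @^-1` setT) ((EFin \o partial i psi) \o @rVcons R n) z)%E.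
    by apply: integral_pushforward => //; exact: measurable_rVcons.
  by rewrite preimage_setT in E.
case: (unliftP ord0 i) => [j ij|i0].
- rewrite -integral12_prod_meas1// integral0_eq// => a _; rewrite /fubini_F.
  have [k1 k2] := Ck_rV1_rVcons a kpsi.
  have <- := IH (fun z => psi (rVcons (a, z))) j k1.
    by rewrite k2 -ij.
  move=> x xM; apply: psi0 => H; apply: xM => k.
  by have := H (lift ord0 k); rewrite rVcons_lift.
- rewrite -integral21_prod_meas1// integral0_eq// => z _; rewrite /fubini_G.
    apply: (@integral_derive1_eq0 (fun a => psi (rVcons (a, z)))
        (fun a => partial i psi (rVcons (a, z))) M) => //.
    + move=> t; have E : (fun h : R => psi (rVcons (h *: 1 + t, z))) =
         (fun h : R => psi (h *: delta_mx ord0 i + rVcons (t, z))).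
        by apply/funext => h; rewrite [h *: 1]mulr1 i0 rVcons_shift0.
      apply: DeriveDef.
        by rewrite derivable_line E -derivable_line.
      by rewrite derive_line E -derive_line.
    + move=> a; apply: (@continuous_comp _ _ _ (fun a => rVcons (a, z)) _); last exact: ci.
      exact: continuous_rVcons1.
    + move=> t Mt; apply: psi0 => /(_ ord0); rewrite rVcons_ord0/=.
      by rewrite leNgt Mt.
Unshelve. all: by end_near.
Qed.

End rV_measure.

(** * Integrals up to null sets *)

Lemma discriminant_le (R : realFieldType) (A B C : R) : 0 <= A -> 0 <= C ->
  (forall t, 0 <= A + 2 * t * B + t ^+ 2 * C) -> B ^+ 2 <= A * C.
Proof.
move=> A0; rewrite le_eqVlt => /predU1P[C0|C0] H.
  rewrite -C0 mulr0; suff -> : B = 0 by rewrite expr0n.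
  (* If [C = 0] and [B] is not 0, the affine function takes the value -1 at this point. *)
  apply/eqP/contraT => B0; have := H (- (A + 1) / (2 * B)).
  rewrite -C0 mulr0 addr0 (_ : 2 * _ * B = - (A + 1)); last by field.
  lra.
have := H (- B / C).
rewrite (_ : A + _ + _ = A - B ^+ 2 / C); last by field; rewrite gt_eqF.
by rewrite subr_ge0 ler_pdivrMr.
Qed.

Section ae_nomeas.
Context d (T : measurableType d) (R : realType) (mu : {measure set T -> \bar R}).
Import HBNNSimple.
Local Open Scope ereal_scope.

(* No measurability is assumed: the integral of a nonnegative function is a
   supremum over the simple functions below it, and these can be cut off on a
   null set. *)
Lemma ae_ge0_le_integral_nomeas (f g : T -> \bar R) :
  (forall x, 0 <= f x) -> (forall x, 0 <= g x) ->
  {ae mu, forall x, f x <= g x} -> \int[mu]_x f x <= \int[mu]_x g x.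
Proof.
move=> f0 g0 [N [mN N0 fgN]]; rewrite !ge0_integralTE//.
apply: ge_ereal_sup => _ [h /= hf <-].
have mNC : measurable (~` N) by exact: measurableC.
have -> : sintegral mu h = sintegral mu (proj_nnsfun h mNC).
  rewrite -!integralT_nnsfun; apply: ge0_ae_eq_integral => //.
  - by apply/measurable_EFinP; exact: measurable_funP.
  - by apply/measurable_EFinP; exact: measurable_funP.
  - by move=> x _; rewrite lee_fin.
  - by move=> x _; rewrite lee_fin.
  exists N; split => // x /= hx; apply: contrapT => xN; apply: hx => _.
  by rewrite mindicE mem_set// mulr1.
apply: ereal_sup_ubound; exists (proj_nnsfun h mNC) => //= x.
rewrite mindicE; have [xN|xN] := pselect (N x).
  by rewrite memNset ?mulr0//= => /(_ xN).
rewrite mem_set// mulr1; apply: le_trans (hf x) _.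
by apply: contrapT => H; apply: xN; apply: fgN.
Qed.

Lemma ae_eq_integral_nomeas (D : set T) (f g : T -> \bar R) :
  {ae mu, forall x, D x -> f x = g x} ->
  \int[mu]_(x in D) f x = \int[mu]_(x in D) g x.
Proof.
move=> fg; rewrite integral_mkcond [RHS]integral_mkcond.
have {}fg : {ae mu, forall x, (f \_ D) x = (g \_ D) x}.
  apply: filterS fg => x fg; rewrite !patchE; case: ifPn => //.
  by rewrite inE.
rewrite integralE [RHS]integralE; congr (_ - _); apply/eqP; rewrite eq_le;
  apply/andP; split; apply: ae_ge0_le_integral_nomeas => //; apply: filterS fg => x;
  by rewrite ?funeposE ?funenegE => ->.
Qed.

End ae_nomeas.

Section toolbox.
Context d (T : measurableType d) (R : realType) (mu : {measure set T -> \bar R}).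
Variable D : set T.
Implicit Types (f g h : T -> R) (P Q : T -> Prop).

Definition aeD P := {ae mu, forall x, D x -> P x}.
(** [I1], [Bd] and [L2f] play the roles of L^1, L^oo and L^2 over [D], with Borel measurable
    members; their algebra is stated so that integrability of products can be found by proof
    search. *)
Definition I1 f := mu.-integrable D (EFin \o f).
Definition Bd f := measurable_fun D f /\ exists M : R, aeD (fun x => `|f x| <= M).
Definition L2f f := measurable_fun D f /\ I1 (fun x => f x ^+ 2).

Lemma aeD_W P : (forall x, D x -> P x) -> aeD P.
Proof. by move=> H; apply: aeW => x /H. Qed.

Lemma aeD_imp P Q : (forall x, D x -> P x -> Q x) -> aeD P -> aeD Q.
Proof. by rewrite /aeD => H; apply: filterS => x Px Dx; exact: (H x Dx (Px Dx)). Qed.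

Lemma aeD_imp2 P Q S : (forall x, D x -> P x -> Q x -> S x) ->
  aeD P -> aeD Q -> aeD S.
Proof.
by rewrite /aeD => H; apply: filterS2 => x Px Qx Dx; exact: (H x Dx (Px Dx) (Qx Dx)).
Qed.

Lemma aeD_imp3 P Q S U : (forall x, D x -> P x -> Q x -> S x -> U x) ->
  aeD P -> aeD Q -> aeD S -> aeD U.
Proof.
rewrite /aeD => H; apply: filterS3 => x Px Qx Sx Dx.
exact: (H x Dx (Px Dx) (Qx Dx) (Sx Dx)).
Qed.

Hypothesis mD : measurable D.

Lemma I1_measurable f : I1 f -> measurable_fun D f.
Proof. by move=> /measurable_int/measurable_EFinP. Qed.

Lemma Rint_ae_eq f g : aeD (fun x => f x = g x) ->
  \int[mu]_(x in D) f x = \int[mu]_(x in D) g x.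
Proof.
by move=> fg; congr fine; apply: ae_eq_integral_nomeas; apply: aeD_imp fg => x _ ->.
Qed.

Lemma I1_eq f g : (forall x, D x -> f x = g x) -> I1 f -> I1 g.
Proof. by move=> fg; apply: eq_integrable => // x /[!inE] Dx /=; rewrite fg. Qed.

Lemma I1_le f g : measurable_fun D f -> aeD (fun x => `|f x| <= g x) -> I1 g -> I1 f.
Proof.
move=> mf fg /integrableP[mg ig]; apply/integrableP; split; first exact/measurable_EFinP.
apply: le_lt_trans ig; rewrite integral_mkcond [leRHS]integral_mkcond.
apply: ae_ge0_le_integral_nomeas.
- by move=> x; rewrite patchE; case: ifP.
- by move=> x; rewrite patchE; case: ifP.
move: fg; rewrite /aeD; apply: filterS => x fg; rewrite !patchE; case: ifPn => //= /[!inE] /fg.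
by rewrite lee_fin => /le_trans; apply; exact: ler_norm.
Qed.

Lemma I1D f g : I1 f -> I1 g -> I1 (fun x => f x + g x).
Proof. by move=> If Ig; have := integrableD mD If Ig. Qed.

Lemma I1N f : I1 f -> I1 (fun x => - f x).
Proof. by move=> If; have := integrableN If. Qed.

Lemma I1B f g : I1 f -> I1 g -> I1 (fun x => f x - g x).
Proof. by move=> If Ig; apply: I1D => //; exact: I1N. Qed.

Lemma I1Z (c : R) f : I1 f -> I1 (fun x => c * f x).
Proof. by move=> If; have := integrableZl mD c If. Qed.

Lemma I1Zr (c : R) f : I1 f -> I1 (fun x => f x * c).
Proof. by move=> /(I1Z c); apply: I1_eq => x _; rewrite mulrC. Qed.

Lemma I1_norm f : I1 f -> I1 (fun x => `|f x|).
Proof.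
move=> If; apply: (@I1_le _ (fun x => `|f x|)).
- apply: measurableT_comp => //; exact: I1_measurable.
- by apply: aeD_W => x _; rewrite normr_id.
- have := integrable_abse If; apply: eq_integrable => //.
Qed.

Lemma I1_sum (J : Type) (r : seq J) (F : J -> T -> R) :
  (forall j, I1 (F j)) -> I1 (fun x => \sum_(j <- r) F j x).
Proof.
move=> IF; elim: r => [|j r IH].
  by apply: (@I1_eq (fun=> 0)) => [x _|]; [rewrite big_nil|exact: integrable0].
by apply: (@I1_eq (fun x => F j x + \sum_(k <- r) F k x)) => [x _|];
  [rewrite big_cons|exact: I1D].
Qed.

Lemma le_Rint_ae f g : I1 f -> I1 g -> aeD (fun x => f x <= g x) ->
  \int[mu]_(x in D) f x <= \int[mu]_(x in D) g x.
Proof.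
(* Replacing [g] by [max f g], equal to it almost everywhere, makes the inequality hold at every
   point. *)
move=> If Ig fg; rewrite (@Rint_ae_eq g (fun x => Num.max (f x) (g x))); last first.
  by apply: aeD_imp fg => x _ fg; rewrite max_r.
apply: le_Rintegral => //; last by move=> x _; rewrite le_max lexx.
apply: (@I1_le _ (fun x => `|f x| + `|g x|)).
- by apply: measurable_maxr; exact: I1_measurable.
- apply: aeD_W => x _; rewrite /Num.max; case: ifP => _; rewrite ?lerDl ?lerDr//.
- by apply: I1D; exact: I1_norm.
Qed.

Lemma Rint_eq0 f : (forall x, D x -> f x = 0) -> \int[mu]_(x in D) f x = 0.
Proof. by move=> f0; rewrite /Rintegral integral0_eq// => x Dx; rewrite f0. Qed.

Lemma Rint_ge0_ae f : aeD (fun x => 0 <= f x) -> 0 <= \int[mu]_(x in D) f x.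
Proof.
move=> f0; rewrite (@Rint_ae_eq f (fun x => `|f x|)); first by apply: Rintegral_ge0.
by apply: aeD_imp f0 => x _ f0; rewrite ger0_norm.
Qed.

Lemma Rint_lin2 (a b : R) f g h : I1 g -> I1 h ->
  aeD (fun x => f x = a * g x + b * h x) ->
  \int[mu]_(x in D) f x = a * \int[mu]_(x in D) g x + b * \int[mu]_(x in D) h x.
Proof.
move=> Ig Ih /Rint_ae_eq ->; rewrite RintegralD ?RintegralZl//; exact: I1Z.
Qed.

Lemma Rint_lin3 (a b c : R) f g h k : I1 g -> I1 h -> I1 k ->
  aeD (fun x => f x = a * g x + b * h x + c * k x) ->
  \int[mu]_(x in D) f x = a * \int[mu]_(x in D) g x +
    b * \int[mu]_(x in D) h x + c * \int[mu]_(x in D) k x.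
Proof.
move=> Ig Ih Ik /Rint_ae_eq ->.
by rewrite RintegralD ?RintegralZl//; [rewrite RintegralD ?RintegralZl//|..];
  do ?[exact: I1Z|apply: I1D].
Qed.

Lemma Rint_sum (J : Type) (r : seq J) (F : J -> T -> R) :
  (forall j, I1 (F j)) ->
  \int[mu]_(x in D) (\sum_(j <- r) F j x) = \sum_(j <- r) \int[mu]_(x in D) F j x.
Proof.
move=> IF; elim: r => [|j r IH].
  rewrite big_nil (@eq_Rintegral _ _ _ _ _ (fun=> 0)) => [|x _]; last by rewrite big_nil.
  by rewrite /Rintegral integral0.
rewrite big_cons -IH -RintegralD//; [|exact: IF|exact: I1_sum].
by apply: eq_Rintegral => x _; rewrite big_cons.
Qed.

Lemma Rint_ge0_eq0 f : I1 f -> aeD (fun x => 0 <= f x) ->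
  \int[mu]_(x in D) f x <= 0 -> aeD (fun x => f x = 0).
Proof.
move=> If f0 If0.
have : (\int[mu]_(x in D) `|(EFin \o f) x| = 0)%E.
  have /fineK <- := integrable_fin_num mD (I1_norm If); congr EFin.
  apply/eqP; rewrite eq_le; apply/andP; split; last first.
    by apply: fine_ge0; apply: integral_ge0 => x _; rewrite lee_fin.
  rewrite (_ : fine _ = \int[mu]_(x in D) `|f x|)// (@Rint_ae_eq _ f)//.
  by apply: aeD_imp f0 => x _ f0; rewrite ger0_norm.
move/ae_eq_integral_abs => /(_ mD); have /measurable_int mf := If.
by move=> /(_ mf); apply: aeD_imp => x Dx [].
Qed.

Lemma L2f_I1M f g : L2f f -> L2f g -> I1 (fun x => f x * g x).
Proof.
move=> [mf If] [mg Ig]; apply: (@I1_le _ (fun x => f x ^+ 2 + g x ^+ 2)).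
- exact: measurable_funM.
- apply: aeD_W => x _; rewrite ler_norml; apply/andP; split; nra.
- exact: I1D.
Qed.

Lemma L2f_ext f g : (forall x, D x -> f x = g x) -> L2f f -> L2f g.
Proof.
move=> fg [mf If]; split.
  by apply: eq_measurable_fun mf => x /[!inE]; exact: fg.
by apply: I1_eq If => x Dx; rewrite fg.
Qed.

Lemma L2fD f g : L2f f -> L2f g -> L2f (fun x => f x + g x).
Proof.
move=> Lf Lg; have [mf If] := Lf; have [mg Ig] := Lg.
split; first exact: measurable_funD.
apply: (@I1_eq (fun x => f x ^+ 2 + g x ^+ 2 + 2 * (f x * g x))) => [x _|].
  by ring.
by apply: I1D; [exact: I1D|apply: I1Z; exact: L2f_I1M].
Qed.

Lemma L2fZ (c : R) f : L2f f -> L2f (fun x => c * f x).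
Proof.
move=> [mf If]; split; first exact: measurable_funM.
by apply: (@I1_eq (fun x => c ^+ 2 * f x ^+ 2)) => [x _|]; [ring|exact: I1Z].
Qed.

Lemma L2fN f : L2f f -> L2f (fun x => - f x).
Proof. by move=> /(L2fZ (-1)); apply: L2f_ext => x _; rewrite mulN1r. Qed.

Lemma L2fB f g : L2f f -> L2f g -> L2f (fun x => f x - g x).
Proof. by move=> Lf Lg; apply: L2fD => //; exact: L2fN. Qed.

Lemma Bd_I1M f g : Bd f -> I1 g -> I1 (fun x => f x * g x).
Proof.
move=> [mf [M HM]] Ig; apply: (@I1_le _ (fun x => `|M| * `|g x|)).
- by apply: measurable_funM => //; exact: I1_measurable.
- apply: aeD_imp HM => x _ HM; rewrite normrM ler_wpM2r//.
  exact: le_trans HM (ler_norm _).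
- by apply: I1Z; exact: I1_norm.
Qed.

Lemma Bd_I1Mr f g : I1 f -> Bd g -> I1 (fun x => f x * g x).
Proof. by move=> If Bg; apply: I1_eq (Bd_I1M Bg If) => x _; rewrite mulrC. Qed.

Lemma Bd_cst (c : R) : Bd (fun=> c).
Proof. by split; [exact: measurable_cst|exists `|c|; exact: aeD_W]. Qed.

Lemma BdM f g : Bd f -> Bd g -> Bd (fun x => f x * g x).
Proof.
move=> [mf [M HM]] [mg [L HL]]; split; first exact: measurable_funM.
exists (M * L); apply: aeD_imp2 HM HL => x _ HM HL.
by rewrite normrM ler_pM.
Qed.

Lemma BdD f g : Bd f -> Bd g -> Bd (fun x => f x + g x).
Proof.
move=> [mf [M HM]] [mg [L HL]]; split; first exact: measurable_funD.
exists (M + L); apply: aeD_imp2 HM HL => x _ HM HL.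
by apply: le_trans (ler_normD _ _) _; rewrite lerD.
Qed.

Lemma BdN f : Bd f -> Bd (fun x => - f x).
Proof.
move=> [mf [M HM]]; split; first exact: measurable_funN.
by exists M; apply: aeD_imp HM => x _; rewrite normrN.
Qed.

Lemma BdB f g : Bd f -> Bd g -> Bd (fun x => f x - g x).
Proof. by move=> Bf Bg; apply: BdD => //; exact: BdN. Qed.

Lemma BdX f k : Bd f -> Bd (fun x => f x ^+ k).
Proof.
move=> Bf; elim: k => [|k IH].
  by rewrite (_ : (fun _ => _) = (fun=> 1)); [exact: Bd_cst|apply/funext => x; rewrite expr0].
rewrite (_ : (fun _ => _) = (fun x => f x * f x ^+ k)); first exact: BdM.
by apply/funext => x; rewrite exprS.
Qed.

(** Inversion is rewritten through the power -1 of a nonnegative function, whose measurability is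
    known; the identity holds at zeros of [f] too, where the inverse is 0. *)
Lemma measurable_fun_inv f : measurable_fun D f -> measurable_fun D (fun x => (f x)^-1).
Proof.
move=> mf; rewrite (_ : (fun _ => _) = (fun x => f x * (f x ^+ 2) `^ (-1))).
  apply: measurable_funM => //; apply: (measurableT_comp (measurable_powR _)).
  exact: measurable_funX.
apply/funext => x; rewrite powR_inv1 ?sqr_ge0//.
by have [->|fx0] := eqVneq (f x) 0; [rewrite invr0 mul0r|rewrite expr2 invfM mulVKf].
Qed.

Lemma BdV f (c : R) : 0 < c -> measurable_fun D f -> aeD (fun x => c <= f x) ->
  Bd (fun x => (f x)^-1).
Proof.
move=> c0 mf cf; split; first exact: measurable_fun_inv.
exists c^-1; apply: aeD_imp cf => x _ cf.
have f0 : 0 < f x by exact: lt_le_trans cf.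
by rewrite ger0_norm ?invr_ge0 ?(ltW f0)// lef_pV2.
Qed.

Lemma Bd_ext f g : (forall x, D x -> f x = g x) -> Bd f -> Bd g.
Proof.
move=> fg [mf [M HM]]; split.
  by apply: eq_measurable_fun mf => x /[!inE]; exact: fg.
by exists M; apply: aeD_imp HM => x Dx; rewrite fg.
Qed.

Lemma BdL2f f g : Bd f -> L2f g -> L2f (fun x => f x * g x).
Proof.
move=> Bf [mg Ig]; split; first by apply: measurable_funM => //; case: Bf.
apply: (@I1_eq (fun x => f x ^+ 2 * g x ^+ 2)) => [x _|]; first by ring.
by apply: Bd_I1M => //; exact: BdX.
Qed.

Lemma BdL2fr f g : L2f f -> Bd g -> L2f (fun x => f x * g x).
Proof. by move=> Lf Bg; apply: L2f_ext (BdL2f Bg Lf) => x _; rewrite mulrC. Qed.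

(** The integral of (f + t g)^2 is a nonnegative quadratic polynomial in t; the claim is its
    discriminant inequality. *)
Lemma cauchy_schwarz_Rint f g : L2f f -> L2f g ->
  (\int[mu]_(x in D) (f x * g x)) ^+ 2 <=
  \int[mu]_(x in D) (f x ^+ 2) * \int[mu]_(x in D) (g x ^+ 2).
Proof.
move=> Lf Lg; have If := Lf.2; have Ig := Lg.2; have Ifg := L2f_I1M Lf Lg.
set A := \int[mu]_(x in D) (f x ^+ 2); set C := \int[mu]_(x in D) (g x ^+ 2).
set B := \int[mu]_(x in D) (f x * g x).
have A0 : 0 <= A by apply: Rintegral_ge0 => x _; exact: sqr_ge0.
have H t : 0 <= A + 2 * t * B + t ^+ 2 * C.
  rewrite -[A]mul1r -(@Rint_lin3 1 (2 * t) (t ^+ 2) (fun x => (f x + t * g x) ^+ 2)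
    (fun x => f x ^+ 2) (fun x => f x * g x) (fun x => g x ^+ 2))//.
    by apply: Rintegral_ge0 => x _; exact: sqr_ge0.
  by apply: aeD_W => x _; ring.
apply: discriminant_le H => //.
by apply: Rintegral_ge0 => x _; exact: sqr_ge0.
Qed.

Lemma norm_Rint_le f : I1 f ->
  `|\int[mu]_(x in D) f x| <= \int[mu]_(x in D) `|f x|.
Proof. by move=> If; exact: le_normr_Rintegral. Qed.

Hypothesis Doo : (mu D < +oo)%E.

Lemma Bd_I1 f : Bd f -> I1 f.
Proof.
move=> [mf [M HM]]; apply: (I1_le mf HM).
apply: measurable_bounded_integrable => //.
by exists `|M|; split; [exact: num_real|move=> C /ltW MC x _ /=].
Qed.

Lemma Bd_L2f f : Bd f -> L2f f.
Proof. by move=> Bf; split; [case: Bf|apply: Bd_I1; exact: BdX]. Qed.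

Lemma L2f_I1 f : L2f f -> I1 f.
Proof.
move=> Lf; apply: I1_eq (L2f_I1M Lf (Bd_L2f (Bd_cst 1))) => x _.
by rewrite mulr1.
Qed.

End toolbox.

(** * The fundamental lemma *)

Lemma Rint_dct_eq0 d (T : measurableType d) (R : realType)
    (mu : {measure set T -> \bar R}) (D : set T) (F : nat -> T -> R) (f g : T -> R) :
  measurable D -> (forall k, measurable_fun D (F k)) -> I1 mu D g ->
  (forall x, D x -> F ^~ x @ \oo --> f x) ->
  (forall k x, D x -> `|F k x| <= g x) ->
  (forall k, \int[mu]_(x in D) F k x = 0) -> \int[mu]_(x in D) f x = 0.
Proof.
move=> mD mF Ig Ff Fg F0.
have mf : measurable_fun D f by exact: measurable_fun_cvg Ff.
have [| | | | |_ _] := @dominated_convergence _ _ _ mu D mD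
    (fun k => EFin \o F k) (EFin \o f) (EFin \o g).
- by move=> k; exact/measurable_EFinP.
- exact/measurable_EFinP.
- by apply: aeW => x Dx; apply/cvg_EFin; [exact: nearW|exact: Ff].
- exact: Ig.
- by apply: aeW => x k Dx; rewrite lee_fin; exact: Fg.
have IF k : I1 mu D (F k).
  by apply: I1_le Ig => //; apply: aeD_W => x; exact: Fg.
have E k : (\int[mu]_(x in D) (EFin \o F k) x = 0)%E.
  by rewrite -(fineK (integrable_fin_num mD (IF k))); congr EFin; exact: F0.
rewrite (_ : [sequence _]_n = fun=> 0%E); last by apply/funext => k; exact: E.
move=> H; have H0 := cvg_unique (@ereal_hausdorff R) H (cvg_cst _).
by rewrite /Rintegral -[X in fine X]/(\int[mu]_(x in D) (EFin \o f) x)%E H0.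
Qed.

(** * Test functions, integration by parts and local integrability on a bounded open set *)

Section domain.
Context {R : realType} {n : nat}.
Local Notation V := 'rV[R]_n.
Local Notation mu := (lebesgue_rV R n).
Variable Omega : set V.
Hypotheses (oO : open Omega) (bO : bounded_set Omega).
Implicit Types (u v g psi : V -> R) (i : 'I_n).
Local Notation I1 := (I1 mu Omega).
Local Notation Bd := (Bd mu Omega).
Local Notation L2f := (L2f mu Omega).

Lemma measurable_domain : measurable Omega.
Proof. exact: open_measurable_rV. Qed.

Lemma domain_lty : (mu Omega < +oo)%E.
Proof.
have [M M0 OM] := bounded_set_rV_box bO.
apply: le_lt_trans (rV_box_lty n M); apply: le_measure => //.
- by rewrite inE; exact: measurable_domain.
- by rewrite inE; exact: rV_box_measurable.
Qed.

Let mO := measurable_domain.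
Let Ooo := domain_lty.

Lemma continuous_bounded_on (f : V -> R) (K : set V) : compact K ->
  {within K, continuous f} -> exists2 C : R, 0 < C & forall x, K x -> `|f x| <= C.
Proof.
move=> cK cf; have := continuous_compact cf cK.
move=> /compact_bounded[C [_ HC]]; exists (`|C| + 1) => [|x Kx]; first by rewrite ltr_pwDr.
by apply: HC; [rewrite ltr_pwDr// ler_norm|exists x].
Qed.

Lemma within_continuous_Bd f : {within closure Omega, continuous f} -> Bd f.
Proof.
move=> cf; split.
  apply: within_continuous_measurable_rV; apply: continuous_subspaceW cf.
  exact: subset_closure.
have cO : compact (closure Omega).
  apply: bounded_closed_compact; last exact: closed_closure.
  have [M M0 OM] := bounded_set_rV_box bO.
  have cM : closed (@rV_box R n M).
    by apply: compact_closed; [exact: norm_hausdorff|exact: compact_rV_box].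
  have sub : closure Omega `<=` rV_box n M.
    by rewrite [X in _ `<=` X]((closure_id _).1 cM); exact: closureS.
  exact: sub_rV_box_bounded sub.
have [C C0 HC] := continuous_bounded_on cO cf.
by exists C; apply: aeD_W => x Ox; apply: HC; exact: subset_closure.
Qed.

Lemma continuous_Bd f : continuous f -> Bd f.
Proof. by move=> cf; apply: within_continuous_Bd; exact: continuous_subspaceT. Qed.

Lemma L1loc_I1 u : measurable_fun Omega u -> I1 u -> L1loc Omega u.
Proof.
move=> mu_ Iu; split=> // K cK KO; apply: integrableS KO Iu => //.
by apply: closed_measurable_rV; apply: compact_closed => //; exact: norm_hausdorff.
Qed.

Lemma L1loc_L2f u : L2f u -> L1loc Omega u.
Proof. by move=> Lu; apply: L1loc_I1; [case: Lu|exact: L2f_I1]. Qed.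

Lemma L1loc_lin (a b : R) u v : L1loc Omega u -> L1loc Omega v ->
  L1loc Omega (fun x => a * u x + b * v x).
Proof.
move=> [mu_ Iu] [mv Iv]; split.
  by apply: measurable_funD; apply: measurable_funM.
move=> K cK KO.
have mK : measurable K.
  by apply: closed_measurable_rV; apply: compact_closed => //; exact: norm_hausdorff.
apply: (I1D mK (f := fun x => a * u x) (g := fun x => b * v x)); apply: (I1Z mK).
- exact: Iu.
- exact: Iv.
Qed.

Definition supp_in u :=
  exists K : set V, [/\ compact K, K `<=` Omega & forall x, ~ K x -> u x = 0].

Lemma partial_eq0 (K : set V) u i : closed K ->
  (forall x, ~ K x -> u x = 0) -> forall x, ~ K x -> partial i u x = 0.
Proof.
move=> cK u0 x xK; rewrite /partial (@near_eq_derive _ _ _ _ (cst 0)) ?derive_cst//.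
have oK : open (~` K) by exact: closed_openC.
by near=> y; apply: u0; near: y; exact: open_nbhs_nbhs.
Unshelve. all: by end_near.
Qed.

Lemma test_functionM psi u : test_function Omega psi -> (forall k, Ck_rV k u) ->
  test_function Omega (fun x => psi x * u x).
Proof.
move=> [kpsi [K [cK KO K0]]] ku; split=> [k|]; first exact: Ck_rVM.
by exists K; split=> // x /K0 ->; rewrite mul0r.
Qed.

Lemma test_functionZ (a : R) psi : test_function Omega psi ->
  test_function Omega (fun x => a * psi x).
Proof.
move=> [kpsi [K [cK KO K0]]]; split=> [k|]; first exact: Ck_rVZ.
by exists K; split=> // x /K0 ->; rewrite mulr0.
Qed.

Lemma test_functionD psi phi : test_function Omega psi -> test_function Omega phi ->
  test_function Omega (fun x => psi x + phi x).
Proof.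
move=> [kpsi [K [cK KO K0]]] [kphi [L [cL LO L0]]]; split=> [k|]; first exact: Ck_rVD.
exists (K `|` L); split=> //; first exact: compactU.
- by move=> x [/KO|/LO].
- by move=> x /= /not_orP[/K0 -> /L0 ->]; rewrite addr0.
Qed.

Lemma test_function_partial i psi : test_function Omega psi ->
  test_function Omega (partial i psi).
Proof.
move=> [kpsi [K [cK KO K0]]]; split=> [k|].
  by have [_ /(_ i)[]] := kpsi k.+1.
exists K; split=> //; apply: partial_eq0 => //.
by apply: compact_closed => //; exact: norm_hausdorff.
Qed.

Lemma test_function_continuous psi : test_function Omega psi -> continuous psi.
Proof. by move=> [/(_ 0%N)/Ck_rV_continuous]. Qed.

Lemma test_function_Bd psi : test_function Omega psi -> Bd psi.
Proof. by move=> /test_function_continuous; exact: continuous_Bd. Qed.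

Lemma Rint_partial_eq0 i u : Ck_rV 1 u -> supp_in u ->
  \int[mu]_(x in Omega) partial i u x = 0.
Proof.
move=> ku [K [cK KO u0]].
have clK : closed K by apply: compact_closed => //; exact: norm_hausdorff.
have [M M0 OM] := bounded_set_rV_box bO.
have u0M x : ~ rV_box n M x -> u x = 0.
  by move=> xM; apply: u0 => /KO/OM.
rewrite Rintegral_mkcond (_ : _ \_ _ = partial i u).
  by rewrite /Rintegral (integral_partial_eq0 i M0 ku u0M).
apply/funext => x; rewrite patchE; case: ifPn => // /negP xO.
by rewrite (partial_eq0 i clK u0)// => /KO Ox; apply: xO; rewrite inE.
Qed.

Lemma Rint_by_parts i u v : Ck_rV 1 u -> Ck_rV 1 v -> supp_in u ->
  \int[mu]_(x in Omega) (u x * partial i v x) =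
  - \int[mu]_(x in Omega) (partial i u x * v x).
Proof.
move=> ku kv [K [cK KO u0]]; have [cu /(_ i)[du [cdu _]]] := ku.
have [cv /(_ i)[dv [cdv _]]] := kv.
have : \int[mu]_(x in Omega) partial i (fun x => u x * v x) x = 0.
  apply: Rint_partial_eq0; first exact: Ck_rVM.
  by exists K; split=> // x /u0 ->; rewrite mul0r.
rewrite partialM//.
rewrite (@Rint_lin2 _ _ _ mu Omega mO 1 1 _ (fun x => u x * partial i v x)
  (fun x => partial i u x * v x)).
- by rewrite !mul1r => /eqP; rewrite addr_eq0 => /eqP.
- by apply: Bd_I1 => //; apply: BdM => //; exact: continuous_Bd.
- by apply: Bd_I1 => //; apply: BdM => //; exact: continuous_Bd.
- by apply: aeD_W => x _; ring.
Qed.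

Lemma L1loc_test_I1 g psi : L1loc Omega g -> test_function Omega psi ->
  I1 (fun x => g x * psi x).
Proof.
move=> [mg Ig] tpsi; have [kpsi [K [cK KO psi0]]] := tpsi.
have mK : measurable K.
  by apply: closed_measurable_rV; apply: compact_closed => //; exact: norm_hausdorff.
have cpsi := test_function_continuous tpsi.
have [C C0 HC] := continuous_bounded_on cK (continuous_subspaceT cpsi).
have mpsi : measurable_fun Omega psi by have [] := test_function_Bd tpsi.
have : mu.-integrable Omega (EFin \o ((fun x => C * `|g x|) \_ K)).
  rewrite -restrict_EFin; apply/integrable_restrict => //.
  rewrite (setIidr KO); apply: (I1Z mK); apply: (I1_norm mK); exact: Ig.
apply: I1_le => //; first exact: measurable_funM.
apply: aeD_W => x Ox; rewrite patchE; case: ifPn => [/[!inE] Kx|/negP xK].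
  by rewrite normrM mulrC ler_wpM2r// HC.
by rewrite psi0 ?mulr0 ?normr0// => Kx; apply: xK; rewrite inE.
Qed.

Section fundamental.
Variable g : V -> R.
Hypothesis (Lg : L1loc Omega g)
  (g0 : forall psi, test_function Omega psi -> \int[mu]_(x in Omega) (g x * psi x) = 0).

(** Weights that can be inserted into all the vanishing integrals. The constant 1 is one of them,
    and dominated convergence makes the class closed under pointwise limits. *)
Let good (h : V -> R) := [/\ measurable_fun setT h, forall x, 0 <= h x <= 1 &
  forall psi, test_function Omega psi ->
    \int[mu]_(x in Omega) (g x * psi x * h x) = 0].

Let good_Bd h : good h -> Bd h.
Proof.
move=> [mh h01 _]; split; first exact: measurable_funTS.
by exists 1; apply: aeD_W => x _; have /andP[a b] := h01 x; rewrite ger0_norm.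
Qed.

Let good_lim (H : nat -> V -> R) (h : V -> R) : (forall k, good (H k)) ->
  (forall x, H ^~ x @ \oo --> h x) -> good h.
Proof.
move=> gH Hh; split.
- apply: (@measurable_fun_cvg _ _ _ _ H) => [k|x _]; last exact: Hh.
  by have [] := gH k.
- move=> x; apply/andP; split.
  + apply: (closed_cvg (fun t : R => 0 <= t) (@closed_ge R 0) _ _ (Hh x)).
    by apply: nearW => k; have [_ /(_ x)/andP[]] := gH k.
  + apply: (closed_cvg (fun t : R => t <= 1) (@closed_le R 1) _ _ (Hh x)).
    by apply: nearW => k; have [_ /(_ x)/andP[]] := gH k.
- move=> psi tpsi; have Igp := L1loc_test_I1 Lg tpsi.
  apply: (@Rint_dct_eq0 _ _ _ mu Omega (fun k x => g x * psi x * H k x) _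
    (fun x => `|g x * psi x|)) => //.
  + move=> k; apply: measurable_funM; first exact: I1_measurable Igp.
    by have [+ _ _] := gH k; exact: measurable_funTS.
  + exact: I1_norm.
  + by move=> x _; apply: cvgMr; exact: Hh.
  + move=> k x _; have [_ /(_ x)/andP[a b] _] := gH k.
    by rewrite normrM (ger0_norm a) ler_piMr.
  + by move=> k; have [_ _ ->] := gH k.
Qed.

(** Quantifying over all good [h], instead of taking [h = 1], makes intersections immediate, so
    stable sets form a sigma-algebra without a pi-lambda argument. It contains the half-spaces,
    hence all Borel sets. *)
Let stable (A : set V) := measurable A /\ forall h, good h -> good (fun x => h x * \1_A x).

Let stableC A : stable A -> stable (~` A).
Proof.
move=> [mA sA]; split; first exact: measurableC.
move=> h gh; have [mh h01 H] := gh; have gA := sA _ gh; have [mhA hA01 HA] := gA.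
have E x : h x * \1_(~` A) x = h x - h x * \1_A x.
  by rewrite !indicE in_setC; case: (x \in A) => /=; ring.
split.
- by under eq_fun do rewrite E; exact: measurable_funB.
- move=> x; rewrite E indicE; have /andP[a b] := h01 x.
  by case: (x \in A); rewrite /= ?mulr1 ?mulr0 ?subr0 ?subrr ?lexx ?ler01 ?a.
- move=> psi tpsi; have Igp := L1loc_test_I1 Lg tpsi.
  rewrite (@Rint_lin2 _ _ _ mu Omega mO 1 (-1) _ (fun x => g x * psi x * h x)
     (fun x => g x * psi x * (h x * \1_A x))) ?H ?HA ?mulr0 ?addr0//.
  + by apply: Bd_I1Mr => //; exact: good_Bd.
  + by apply: Bd_I1Mr => //; exact: good_Bd.
  + by apply: aeD_W => x _; rewrite E; ring.
Qed.

Let stableT : stable setT.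
Proof.
split=> // h gh; rewrite (_ : (fun _ => _) = h)//.
by apply/funext => x; rewrite indicT mulr1.
Qed.

Let stableI A B : stable A -> stable B -> stable (A `&` B).
Proof.
move=> [mA sA] [mB sB]; split=> [|h gh]; first exact: measurableI.
rewrite (_ : (fun _ => _) = (fun x => h x * \1_A x * \1_B x)); first exact/sB/sA.
by apply/funext => x; rewrite indicI /= mulrA.
Qed.

Let stable_bigcap (F : nat -> set V) : (forall k, stable (F k)) ->
  stable (\bigcap_k F k).
Proof.
move=> sF.
pose G := fix G k := if k is k'.+1 then G k' `&` F k' else setT.
have sG k : stable (G k) by elim: k => [|k IH] /=; [exact: stableT|exact: stableI].
split=> [|h gh]; first by apply: bigcapT_measurable => k; have [] := sF k.
apply: (@good_lim (fun k x => h x * \1_(G k) x)) => [k|x].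
  by have [_] := sG k; apply.
apply: cvgMr; have [xF|xF] := pselect ((\bigcap_k F k) x).
  apply: cvg_near_cst; apply: nearW => k; rewrite !indicE (mem_set xF) mem_set//.
  by elim: k => //= k IH; split=> //; exact: xF.
have [k xFk] : exists k, ~ F k x.
  by apply: contrapT => /forallNP H; apply: xF => k _; apply: contrapT; exact: H.
have Gk m : (k < m)%N -> ~ G m x.
  elim: m => // m IH; rewrite ltnS leq_eqVlt => /predU1P[<- []//|/IH H [/H]//].
apply: cvg_near_cst; near=> m; rewrite !indicE (memNset xF) memNset//.
apply: Gk; near: m; exact: nbhs_infty_gt.
Unshelve. all: by end_near.
Qed.

Let stable_sigma : sigma_algebra setT stable.
Proof.
split.
- by rewrite -setCT; exact: stableC.
- by move=> A sA; rewrite setTD; exact: stableC.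
- move=> F sF; rewrite -[\bigcup_k _]setCK setC_bigcup; apply: stableC.
  by apply: stable_bigcap => k; exact: stableC.
Qed.

Let stable_halfspace i (a : R) : stable [set x : V | a < x ord0 i].
Proof.
have mA : measurable [set x : V | a < x ord0 i].
  rewrite (_ : [set _ | _] = (fun x : V => x ord0 i) @^-1` `]a, +oo[%classic).
    rewrite -[X in measurable X]setTI; apply: measurable_rV_coord => //.
  by apply/seteqP; split=> x /=; rewrite in_itv/= andbT.
split=> // h gh; have [mh h01 H] := gh.
pose b k (x : V) := expbump (k.+1%:R * (x ord0 i - a)).
have kb k m : Ck_rV m (b k).
  apply: (@Ck_rV_comp _ _ m expbump (fun x => k.+1%:R * (x ord0 i - a)) smooth_expbump).
  by apply: Ck_rVZ; apply: Ck_rVB; [exact: Ck_rV_coord|exact: Ck_rV_cst].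
apply: (@good_lim (fun k x => h x * b k x)).
- move=> k; split.
  + by apply: measurable_funM => //; apply: continuous_measurable_rV; exact: (Ck_rV_continuous
    (kb k 0%N)).
  + move=> x; have /andP[p q] := h01 x.
    by rewrite mulr_ge0 ?expbump_ge0//= mulr_ile1 ?expbump_ge0 ?expbump_le1.
  + move=> psi tpsi; have := H _ (test_functionM tpsi (kb k)).
    move=> <-; apply: eq_Rintegral => x _; ring.
- move=> x; apply: cvgMr; rewrite indicE.
  have := @cvg_expbump_natmul R (x ord0 i - a); rewrite subr_gt0.
  case: ifPn => xa; [rewrite mem_set//|rewrite memNset//].
  exact/negP.
Qed.

Let stable_measurable (A : set V) : measurable A -> stable A.
Proof.
suff : @measurable _ 'rV[R]_n `<=` stable by apply.
apply: smallest_sub; first exact: stable_sigma.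
rewrite -bigcup_seq => B /= -[i _] [Y mY <-]; rewrite setTI.
suff : @measurable _ R `<=` [set Y | stable ((fun x : V => x ord0 i) @^-1` Y)] by apply.
rewrite [X in X `<=` _](_ : _ = <<s (@RGenOInfty.G R) >>); last exact: RGenOInfty.measurableE.
have [s0 sC sU] := stable_sigma.
apply: smallest_sub.
- split.
  + by rewrite /= preimage_set0.
  + by move=> Z /= sZ; rewrite setTD preimage_setC -setTD; exact: sC.
  + by move=> F /= sF; rewrite preimage_bigcup; exact: sU.
- move=> _ [a ->] /=.
  rewrite (_ : _ @^-1` _ = [set x : V | a < x ord0 i]); first exact: stable_halfspace.
  by apply/seteqP; split=> x /=; rewrite in_itv/= andbT.
Qed.

Let test_ae0 psi : test_function Omega psi -> ae_in Omega (fun x => g x * psi x = 0).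
Proof.
move=> tpsi; have Igp := L1loc_test_I1 Lg tpsi.
have good1 : good (fun=> 1).
  split=> //; first by move=> x; rewrite ler01 lexx.
  by move=> phi tphi; under eq_Rintegral do rewrite mulr1; exact: g0.
have : ae_eq mu Omega (EFin \o (fun x => g x * psi x)) (cst 0%E).
  apply: integral_ae_eq => // E EO mE.
  have [_ /(_ _ good1)[_ _ /(_ _ tpsi)]] := stable_measurable mE.
  rewrite integral0 => H.
  have IE : mu.-integrable E (EFin \o (fun x => g x * psi x)) by exact: integrableS EO Igp.
  rewrite -(fineK (integrable_fin_num mE IE)); congr EFin; rewrite -[RHS]H.
  rewrite [RHS]Rintegral_mkcond [LHS](Rintegral_mkcond mu E (fun x => g x * psi x)).
  apply: eq_Rintegral => x _; rewrite !patchE indicE mul1r.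
  case: ifPn => xE; first by rewrite mem_set ?mulr1//; apply: EO; rewrite inE in xE.
  by rewrite mulr0; case: ifP.
by apply: filterS => x H Ox; have [] := H Ox.
Qed.

(** Bumps with rational centres and radii 1/(k+1). There are countably many, so their exceptional
    null sets can be united, and around each point of [Omega] one of them is positive at the point
    and supported in [Omega]. *)
Let bumpat (q : 'rV[rat]_n * nat) (x : V) : R :=
  expbump (q.2.+1%:R^-1 ^+ 2 - \sum_(i < n) (x ord0 i - ratr (q.1 ord0 i)) ^+ 2).

Let bumpat_Ck q k : Ck_rV k (bumpat q).
Proof.
apply: (@Ck_rV_comp _ _ k expbump (fun x => q.2.+1%:R^-1 ^+ 2 -
   \sum_(i < n) (x ord0 i - ratr (q.1 ord0 i)) ^+ 2) smooth_expbump).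
apply: Ck_rVB; first exact: Ck_rV_cst.
apply: Ck_rV_sum => i; rewrite (_ : (fun _ => _) = fun x : V =>
  (x ord0 i - ratr (q.1 ord0 i)) * (x ord0 i - ratr (q.1 ord0 i))); last by [].
by apply: Ck_rVM; apply: Ck_rVB; [exact: Ck_rV_coord|exact: Ck_rV_cst|
   exact: Ck_rV_coord|exact: Ck_rV_cst].
Qed.

Lemma fundamental_lemma : ae_in Omega (fun x => g x = 0).
Proof.
pose P (k : nat) (x : V) := if @unpickle ('rV[rat]_n * nat)%type k is Some q then
  (test_function Omega (bumpat q) -> Omega x -> g x * bumpat q x = 0) else True.
have : \forall x \ae mu, forall k, P k x.
  apply: ae_foralln => k; rewrite /P; case: unpickle => [q|]; last exact: aeW.
  have [tq|ntq] := pselect (test_function Omega (bumpat q)); last by apply: aeW.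
  by have := test_ae0 tq; rewrite /ae_in; apply: filterS => x H _.
apply: filterS => x Px Ox.
have /nbhs_ballP[e /= e0 xeU] : nbhs x Omega by exact: open_nbhs_nbhs.
have [k ke] : exists k : nat, k.+1%:R^-1 < e / 2.
  near \oo => k; exists k; near: k.
  have e20 : 0 < e / 2 by rewrite divr_gt0.
  have /cvgr0Pnorm_lt/(_ _ e20) := @cvg_harmonic R.
  by apply: filterS => k; rewrite ger0_norm ?harmonic_ge0.
set r : R := k.+1%:R^-1 in ke.
have r0 : 0 < r by rewrite invr_gt0.
(* With this tolerance the squared distance to the centre is at most n r^2 / (n+1)^2 < r^2, so the
   bump is positive at [x]; its support stays in the ball of radius [e] because [2 * r < e]. *)
have /choice[q qx] : forall i, exists q : rat, `|x ord0 i - ratr q| < r / n.+1%:R.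
  have d0 : 0 < r / n.+1%:R by rewrite divr_gt0.
  move=> i; move: (r / n.+1%:R) d0 (x ord0 i) => d d0 t.
  have [|q] := @rat_in_itvoo R (t - d) (t + d); first lra.
  by rewrite in_itv/= => /andP[a b]; exists q; rewrite ltr_norml; apply/andP; split; lra.
pose Q := (\row_i q i, k) : 'rV[rat]_n * nat.
have bx : 0 < bumpat Q x.
  rewrite expbump_gt0 subr_gt0 /=.
  apply: (@le_lt_trans _ _ (\sum_(i < n) (r / n.+1%:R) ^+ 2)).
    apply: ler_sum => i _; rewrite mxE -real_normK ?num_real//.
    by rewrite lerXn2r ?nnegrE ?(ltW (qx i))// divr_ge0// ltW.
  have rE : k.+1%:R^-1 = n.+1%:R * (r / n.+1%:R) by rewrite mulrC divfK.
  have s0 : 0 < r / n.+1%:R by rewrite divr_gt0.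
  rewrite {}rE; move: (r / n.+1%:R) s0 => s s0.
  rewrite sumr_const card_ord -[X in X < _]mulr_natl exprMn ltr_pM2r ?exprn_gt0//.
  by rewrite -natrX ltr_nat (leq_trans (ltnSn n))// expnS leq_pmulr.
have tQ : test_function Omega (bumpat Q).
  split=> [m|]; first exact: bumpat_Ck.
  exists [set y : V | \sum_(i < n) (y ord0 i - ratr (q i)) ^+ 2 <= r ^+ 2].
  have sub (y : V) : \sum_(i < n) (y ord0 i - ratr (q i)) ^+ 2 <= r ^+ 2 ->
      ball x e y.
    move=> Hy; apply/rV_ballE => // i.
    have H1 : (y ord0 i - ratr (q i)) ^+ 2 <= r ^+ 2.
      apply: le_trans Hy; rewrite (bigD1 i)//= lerDl.
      by apply: sumr_ge0 => j _; exact: sqr_ge0.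
    have H2 : `|y ord0 i - ratr (q i)| <= r.
      by rewrite -ler_sqr ?nnegrE ?(ltW r0)// real_normK ?num_real.
    have H3 : `|x ord0 i - ratr (q i)| < r.
      by apply: lt_le_trans (qx i) _; rewrite ler_pdivrMr// ler_peMr ?(ltW r0)// ler1n.
    have := ler_distD (ratr (q i)) (x ord0 i) (y ord0 i).
    by rewrite (distrC (ratr _)) => /le_lt_trans; apply; lra.
  have cS : continuous (fun y : V => \sum_(i < n) (y ord0 i - ratr (q i)) ^+ 2).
    apply: (@Ck_rV_continuous _ _ 0%N); apply: Ck_rV_sum => i.
    by apply: (@Ck_rVM _ _ 0%N (fun y : V => y ord0 i - ratr (q i))
         (fun y : V => y ord0 i - ratr (q i))); apply: Ck_rVB;
       [exact: Ck_rV_coord|exact: Ck_rV_cst|exact: Ck_rV_coord|exact: Ck_rV_cst].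
  have clS : closed [set y : V | \sum_(i < n) (y ord0 i - ratr (q i)) ^+ 2 <= r ^+ 2].
    rewrite (_ : [set _ | _] = (fun y : V => \sum_(i < n) (y ord0 i - ratr (q i)) ^+ 2)
       @^-1` [set t | t <= r ^+ 2]); last by [].
    by apply: preimage_closed; [move=> y _; exact: cS|exact: closed_le].
  split.
  - apply: bounded_closed_compact => //.
    have [M M0 OM] := bounded_set_rV_box bO.
    by apply: (@sub_rV_box_bounded _ _ _ M) => y /sub/xeU/OM.
  - by move=> y /sub/xeU.
  - move=> y /negP; rewrite -ltNge => Hy; apply: expbump_le0; rewrite subr_le0 ltW//=.
    by under eq_bigr do rewrite mxE.
have := Px (pickle Q); rewrite /P pickleK => /(_ tQ Ox)/eqP.
by rewrite mulf_eq0 (gt_eqF bx) orbF => /eqP.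
Unshelve. all: by end_near.
Qed.

End fundamental.

End domain.

(** * Sobolev spaces *)

Create HintDb intdb discriminated.
#[global] Hint Constants Opaque : intdb.
#[global] Hint Variables Opaque : intdb.
#[global] Hint Resolve I1D I1B I1N I1Z I1Zr I1_norm L2f_I1M L2fD L2fB L2fN L2fZ
  Bd_I1M Bd_I1Mr Bd_cst BdM BdD BdB BdN BdX BdL2f BdL2fr Bd_I1 Bd_L2f L2f_I1 : intdb.
#[global] Hint Extern 0 (measurable_fun _ (fun=> _)) => exact: measurable_cst : intdb.
Ltac integ := solve [eauto 12 with intdb nocore].

(** The Dirichlet form, locked so that it can be treated as an atom once its bilinear algebra is
    established. *)
HB.lock Definition dirichlet {R : realType} {n : nat} (Omega : set 'rV[R]_n)
    (u v : 'rV[R]_n -> R) : R :=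
  \int[lebesgue_rV R n]_(x in Omega) grad_dot Omega u v x.

Local Opaque partial wpartial Rintegral.

Section sobolev_theory.
Context {R : realType} {n : nat}.
Local Notation V := 'rV[R]_n.
Local Notation mu := (lebesgue_rV R n).
Variable Omega : set V.
Hypotheses (oO : open Omega) (bO : bounded_set Omega).
Implicit Types (u v w g h psi : V -> R) (i : 'I_n) (a b : R).
Local Notation I1 := (I1 mu Omega).
Local Notation Bd := (Bd mu Omega).
Local Notation L2f := (L2f mu Omega).
Local Notation ae_in := (ae_in Omega).
Local Notation test := (test_function Omega).
Local Notation weak := (is_weak_partial Omega).
Local Notation wp := (wpartial Omega).

Let mO : measurable Omega := measurable_domain oO.
Let Ooo : (mu Omega < +oo)%E := domain_lty oO bO.

Lemma Lp2_L2f u : Lp Omega 2%:E u <-> L2f u.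
Proof.
split=> [Lu|[mu_ Iu]].
  have mu_ : measurable_fun Omega u.
    apply/(measurable_restrictT _ mO).
    by move: Lu; rewrite /Lp inE => /andP[/[!inE]].
  split=> //; apply/(integrable_mkcond _ mO).
  have := Lfun2_integrable_sqr Lu; apply: eq_integrable => // x _ /=.
  by rewrite !patchE; case: ifP => // _; rewrite expr0n.
have mu' : measurable_fun setT (u \_ Omega) by apply/(measurable_restrictT _ mO).
rewrite /Lp inE; apply/andP; split; first by rewrite inE.
rewrite inE /= /finite_norm unlock; apply: poweR_lty.
move/(integrable_mkcond _ mO)/integrableP : Iu => [_]; apply: le_lt_trans.
rewrite le_eqVlt; apply/orP; left; apply/eqP; apply: eq_integral => x _.
rewrite /= !patchE; case: ifP => _ /=; last by rewrite normr0 powR0 ?normr0.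
by rewrite powR_mulrn// normrX.
Qed.

Lemma Lpoo_Bd u : Lp Omega +oo%E u -> Bd u.
Proof.
move=> Lu; have mu_ : measurable_fun Omega u.
  apply/(measurable_restrictT _ mO).
  by move: Lu; rewrite /Lp inE => /andP[/[!inE]].
split=> //; move: Lu; rewrite /Lp inE => /andP[_].
rewrite inE /= /finite_norm unlock; case: ifPn => [mu0|mu0 _]; last first.
  (* The infinity norm is defined by cases on whether the whole space has positive measure; if it
     has not, any bound holds almost everywhere. *)
  exists 0; have : mu [set: V] = 0%E by apply/eqP; rewrite -measure_le0 leNgt.
  by move=> muT; apply: (negligibleS (@subsetT _ _)); apply/negligibleP.
move=> /[dup] ess.
have : (0 <= ess_sup mu (abse \o (EFin \o u \_ Omega)))%E.
  by apply: ess_sup_gee => //; apply: aeW => x /=; rewrite lee_fin.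
case: (ess_sup _ _) ess (@ess_sup_ge _ _ _ mu (abse \o (EFin \o u \_ Omega))) => //= M _ HM _ _.
by exists M; apply: filterS HM => x; rewrite patchE => /[swap] Ox; rewrite mem_set// lee_fin.
Qed.

Lemma Lp_lin (q : \bar R) a b u v : (1 <= q)%E -> Lp Omega q u -> Lp Omega q v ->
  Lp Omega q (fun x => a * u x + b * v x).
Proof.
move=> q1 Lu Lv; have [L0 Llin] := @Lfun_submod_closed _ _ _ mu q q1.
have := Llin a _ _ Lu (Llin b _ _ Lv L0).
rewrite addr0 /Lp.
suff -> : (fun x => a * u x + b * v x) \_ Omega = a *: (u \_ Omega) + b *: (v \_ Omega) by [].
apply/funext => x; rewrite patchE.
transitivity (a * (u \_ Omega) x + b * (v \_ Omega) x); last by [].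
by rewrite !patchE; case: ifP => // _; rewrite !mulr0 addr0.
Qed.

Lemma weak_unique i u g h : weak i u g -> weak i u h -> ae_in (fun x => g x = h x).
Proof.
move=> [Lu Lg Hg] [_ Lh Hh].
have := fundamental_lemma oO bO (L1loc_lin 1 (-1) Lg Lh).
move=> H; apply: aeD_imp (H _) => [x _ /eqP|psi tpsi].
  by rewrite mul1r mulN1r subr_eq0 => /eqP.
rewrite (@Rint_lin2 _ _ _ _ _ mO 1 (-1) _ (fun x => g x * psi x) (fun x => h x * psi x)).
- have := Hg _ tpsi; rewrite Hh// => /oppr_inj ->; ring.
- exact: L1loc_test_I1.
- exact: L1loc_test_I1.
- by apply: aeD_W => x _; ring.
Qed.

Lemma weak_wp i u g : weak i u g -> weak i u (wp i u).
Proof. by move=> wg; exact: (@xgetPex _ (fun=> 0) [set g | weak i u g] (ex_intro _ g wg)). Qed.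

Lemma weak_wp_ae i u g : weak i u g -> ae_in (fun x => wp i u x = g x).
Proof. by move=> wg; apply: weak_unique (weak_wp wg) wg. Qed.

Lemma weak_lin a b i u v g h : weak i u g -> weak i v h ->
  weak i (fun x => a * u x + b * v x) (fun x => a * g x + b * h x).
Proof.
move=> [Lu Lg Hg] [Lv Lh Hh]; split; [exact: L1loc_lin|exact: L1loc_lin|].
move=> psi tpsi; have tp := test_function_partial i tpsi.
rewrite (@Rint_lin2 _ _ _ _ _ mO a b (fun x => (a * u x + b * v x) * partial i psi x) (fun x => u
  x * partial i psi x)
  (fun x => v x * partial i psi x)); [|exact: L1loc_test_I1|exact: L1loc_test_I1|]; last first.
  by apply: aeD_W => x _; ring.
rewrite (@Rint_lin2 _ _ _ _ _ mO a b (fun x => (a * g x + b * h x) * psi x) (fun x => g x * psi x)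
  (fun x => h x * psi x)); [|exact: L1loc_test_I1|exact: L1loc_test_I1|]; last first.
  by apply: aeD_W => x _; ring.
by rewrite Hg// Hh// !mulrN opprD.
Qed.

Lemma weak_ae i u u' g g' : L1loc Omega u' -> L1loc Omega g' ->
  ae_in (fun x => u x = u' x) -> ae_in (fun x => g x = g' x) ->
  weak i u g -> weak i u' g'.
Proof.
move=> Lu' Lg' uu gg [Lu Lg H]; split=> // psi tpsi.
rewrite -(@Rint_ae_eq _ _ _ mu Omega (fun x => u x * partial i psi x)).
  rewrite H//; congr (- _); apply: Rint_ae_eq.
  by apply: aeD_imp gg => x _ ->.
by apply: aeD_imp uu => x _ ->.
Qed.

Lemma weak_Ck i u : (forall k, Ck_rV k u) -> weak i u (partial i u).
Proof.
move=> ku; have [cu /(_ i)[du [cdu _]]] := ku 1%N.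
have Bu := continuous_Bd bO cu; have Bdu := continuous_Bd bO cdu.
split; [by apply: L1loc_L2f => //; integ|by apply: L1loc_L2f => //; integ|].
move=> psi tpsi; have [kpsi spsi] := tpsi.
have := Rint_by_parts oO bO i (kpsi 1%N) (ku 1%N) spsi.
under eq_Rintegral do rewrite mulrC.
by move=> ->; rewrite opprK; apply: eq_Rintegral => x _; rewrite mulrC.
Qed.

Lemma H1P u : H1 Omega u <-> L2f u /\ forall i, exists2 g, weak i u g & L2f g.
Proof.
split=> [[/Lp2_L2f Lu H]|[Lu H]].
  by split=> // i; have [g wg [/Lp2_L2f Lg _]] := H i; exists g.
by split=> [|i]; [exact/Lp2_L2f|have [g wg Lg] := H i; exists g => //; split=> //; exact/Lp2_L2f].
Qed.

Lemma H1_L2f u : H1 Omega u -> L2f u.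
Proof. by move=> /H1P[]. Qed.

Lemma L2f_ae_transfer g h : measurable_fun Omega h -> ae_in (fun x => g x = h x) ->
  L2f g -> L2f h.
Proof.
move=> mh gh [_ Ig]; split=> //; apply: I1_le Ig; first exact: measurable_funX.
by apply: aeD_imp gh => x _ ->; rewrite ger0_norm// sqr_ge0.
Qed.

Lemma H1_weak i u : H1 Omega u -> weak i u (wp i u).
Proof. by move=> /H1P[_ /(_ i)[g wg _]]; exact: weak_wp wg. Qed.

(** The representative selected by [wpartial] agrees almost everywhere with the one witnessing
    membership in H^1, and inherits its square integrability. *)
Lemma H1_wp i u : H1 Omega u -> L2f (wp i u).
Proof.
move=> /H1P[_ /(_ i)[g wg Lg]]; have [_ [mw _] _] := weak_wp wg.
apply: L2f_ae_transfer Lg => //.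
by apply: aeD_imp (weak_wp_ae wg) => x _ ->.
Qed.

Lemma H1_lin a b u v : H1 Omega u -> H1 Omega v ->
  H1 Omega (fun x => a * u x + b * v x).
Proof.
move=> Hu Hv; apply/H1P; split.
  by have := H1_L2f Hu; have := H1_L2f Hv; integ.
move=> i; exists (fun x => a * wp i u x + b * wp i v x).
  by apply: weak_lin; exact: H1_weak.
by have := H1_wp i Hu; have := H1_wp i Hv; integ.
Qed.

Lemma wp_lin a b i u v : H1 Omega u -> H1 Omega v ->
  ae_in (fun x => wp i (fun x => a * u x + b * v x) x = a * wp i u x + b * wp i v x).
Proof. by move=> Hu Hv; apply: weak_wp_ae; apply: weak_lin; exact: H1_weak. Qed.

Lemma wp_ae i u v : H1 Omega u -> H1 Omega v -> ae_in (fun x => u x = v x) ->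
  ae_in (fun x => wp i u x = wp i v x).
Proof.
move=> Hu Hv uv; have wu := H1_weak i Hu; have wv := H1_weak i Hv.
have [Lv Lg _] := wv; have [Lu Lh _] := wu.
apply: (weak_unique wu); apply: weak_ae wv => //; last exact: aeD_W.
by apply: aeD_imp uv => x _ ->.
Qed.

Lemma ae_forall_ord (P : 'I_n -> V -> Prop) : (forall i, ae_in (P i)) ->
  ae_in (fun x => forall i, P i x).
Proof.
move=> H; have F : Filter (nbhs (almost_everywhere mu)) by exact: _.
have := @filter_forall _ _ (fun i => [set x | Omega x -> P i x]) _ F H.
by apply: filterS => x Hx Ox i; exact: Hx.
Qed.

Local Notation E := (dirichlet Omega).

Lemma dirichletE u v : E u v = \int[mu]_(x in Omega) grad_dot Omega u v x.
Proof. by rewrite unlock. Qed.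

Lemma grad_dot_I1 u v : H1 Omega u -> H1 Omega v -> I1 (grad_dot Omega u v).
Proof.
by move=> Hu Hv; apply: I1_sum => // i; have := H1_wp i Hu; have := H1_wp i Hv; integ.
Qed.

Lemma dirichletC u v : E u v = E v u.
Proof.
by rewrite !dirichletE; apply: eq_Rintegral => x _; apply: eq_bigr => i _; rewrite mulrC.
Qed.

Lemma dirichlet_lin a b u v w : H1 Omega u -> H1 Omega v -> H1 Omega w ->
  E (fun x => a * u x + b * v x) w = a * E u w + b * E v w.
Proof.
move=> Hu Hv Hw; rewrite !dirichletE; apply: Rint_lin2 => //; [exact: grad_dot_I1|exact:
  grad_dot_I1|].
have := ae_forall_ord (fun i => wp_lin a b i Hu Hv).
apply: aeD_imp => x _ H; rewrite /grad_dot !mulr_sumr -big_split/=.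
by apply: eq_bigr => i _; rewrite H; ring.
Qed.

Lemma dirichlet_ae u u' v : H1 Omega u -> H1 Omega u' ->
  ae_in (fun x => u x = u' x) -> E u v = E u' v.
Proof.
move=> Hu Hu' uu; rewrite !dirichletE; apply: Rint_ae_eq; have := ae_forall_ord (fun i => wp_ae i
  Hu Hu' uu).
by apply: aeD_imp => x _ H; apply: eq_bigr => i _; rewrite H.
Qed.

Lemma subE u v : (fun x => u x - v x) = (fun x => 1 * u x + (-1) * v x).
Proof. by apply/funext => x; ring. Qed.

Lemma H1B u v : H1 Omega u -> H1 Omega v -> H1 Omega (fun x => u x - v x).
Proof. by rewrite subE; exact: H1_lin. Qed.

Lemma dirichletB u v w : H1 Omega u -> H1 Omega v -> H1 Omega w ->
  E (fun x => u x - v x) w = E u w - E v w.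
Proof. by move=> Hu Hv Hw; rewrite subE dirichlet_lin// mul1r mulN1r. Qed.

Lemma dirichletBr u v w : H1 Omega u -> H1 Omega v -> H1 Omega w ->
  E w (fun x => u x - v x) = E w u - E w v.
Proof. by move=> Hu Hv Hw; rewrite dirichletC dirichletB// !(dirichletC w). Qed.

Lemma dirichlet_ge0 u : 0 <= E u u.
Proof.
by rewrite dirichletE; apply: Rintegral_ge0 => x _; apply: sumr_ge0 => i _; rewrite -expr2 sqr_ge0.
Qed.

Lemma gradnormsqE u : gradnormsq Omega u = E u u.
Proof. by rewrite dirichletE. Qed.

Lemma dirichlet_sqr_lin t u v : H1 Omega u -> H1 Omega v ->
  E (fun x => 1 * u x + t * v x) (fun x => 1 * u x + t * v x) =
  E u u + 2 * t * E u v + t ^+ 2 * E v v.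
Proof.
move=> Hu Hv; have Hw := H1_lin 1 t Hu Hv.
rewrite dirichlet_lin// (dirichletC u) (dirichletC v) !dirichlet_lin//.
by rewrite (dirichletC v u); move: (E u u) (E u v) (E v v) => p q r; ring.
Qed.

Lemma dirichlet_cs u v : H1 Omega u -> H1 Omega v -> E u v ^+ 2 <= E u u * E v v.
Proof.
move=> Hu Hv; apply: discriminant_le; [exact: dirichlet_ge0|exact: dirichlet_ge0|].
by move=> t; rewrite -dirichlet_sqr_lin//; exact: dirichlet_ge0.
Qed.

Definition h1sq u : R := L2normsq Omega u + E u u.

Lemma L2normsq_ge0 u : 0 <= L2normsq Omega u.
Proof. by apply: Rintegral_ge0 => x _; exact: sqr_ge0. Qed.

Lemma h1sq_ge0 u : 0 <= h1sq u.
Proof. by rewrite addr_ge0 ?L2normsq_ge0 ?dirichlet_ge0. Qed.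

Lemma H1norm_sqr u : H1norm Omega u ^+ 2 = h1sq u.
Proof. by rewrite /H1norm gradnormsqE sqr_sqrtr//; exact: h1sq_ge0. Qed.

Lemma H1norm_lt u (e : R) : 0 < e -> (H1norm Omega u < e) = (h1sq u < e ^+ 2).
Proof.
by move=> e0; rewrite -H1norm_sqr ltr_sqr ?nnegrE ?sqrtr_ge0// ltW.
Qed.

Lemma H1norm_le u (e : R) : 0 <= e -> (H1norm Omega u <= e) = (h1sq u <= e ^+ 2).
Proof. by move=> e0; rewrite -H1norm_sqr ler_sqr ?nnegrE ?sqrtr_ge0. Qed.

Lemma L2normsq_lin a b u v : L2f u -> L2f v ->
  L2normsq Omega (fun x => a * u x + b * v x) = a ^+ 2 * L2normsq Omega u +
   2 * a * b * \int[mu]_(x in Omega) (u x * v x) + b ^+ 2 * L2normsq Omega v.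
Proof.
move=> Lu Lv; apply: Rint_lin3 => //; [by case: Lu|exact: L2f_I1M|by case: Lv|].
by apply: aeD_W => x _; ring.
Qed.

(** Parallelogram identity: adding the nonnegative energy of [a u - b v] to the left-hand side gives
    the right-hand side. *)
Lemma dirichlet_lin_le a b u v : H1 Omega u -> H1 Omega v ->
  E (fun x => a * u x + b * v x) (fun x => a * u x + b * v x) <=
  2 * a ^+ 2 * E u u + 2 * b ^+ 2 * E v v.
Proof.
move=> Hu Hv; have P := dirichlet_ge0 (fun x => a * u x + (- b) * v x).
have D c : E (fun x => a * u x + c * v x) (fun x => a * u x + c * v x) =
    a ^+ 2 * E u u + 2 * a * c * E u v + c ^+ 2 * E v v.
  rewrite dirichlet_lin//; last exact: H1_lin.
  rewrite (dirichletC u) (dirichletC v) !dirichlet_lin//.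
  by rewrite (dirichletC v u); move: (E u u) (E u v) (E v v) => p q r; ring.
by move: P; rewrite !D; move: (E u u) (E u v) (E v v) => p q r; nra.
Qed.

Lemma L2normsq_lin_le a b u v : L2f u -> L2f v ->
  L2normsq Omega (fun x => a * u x + b * v x) <=
  2 * a ^+ 2 * L2normsq Omega u + 2 * b ^+ 2 * L2normsq Omega v.
Proof.
move=> Lu Lv; have := L2normsq_ge0 (fun x => a * u x + (- b) * v x).
rewrite !L2normsq_lin//; move: (L2normsq _ u) (L2normsq _ v) (\int[_]_(x in _) _).
by move=> p q r; nra.
Qed.

Lemma h1sq_lin_le a b u v : H1 Omega u -> H1 Omega v ->
  h1sq (fun x => a * u x + b * v x) <= 2 * a ^+ 2 * h1sq u + 2 * b ^+ 2 * h1sq v.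
Proof.
move=> Hu Hv; rewrite /h1sq !mulrDr addrACA lerD ?dirichlet_lin_le//.
by rewrite L2normsq_lin_le//; exact: H1_L2f.
Qed.

Lemma H1_Ck u : (forall k, Ck_rV k u) -> H1 Omega u.
Proof.
move=> ku; apply/H1P; split.
  by have := continuous_Bd bO (Ck_rV_continuous (ku 0%N)); integ.
move=> i; exists (partial i u); first exact: weak_Ck.
have [_ /(_ i)[_ [cdu _]]] := ku 1%N.
by have := continuous_Bd bO cdu; integ.
Qed.

Lemma wp_Ck i u : (forall k, Ck_rV k u) -> ae_in (fun x => wp i u x = partial i u x).
Proof. by move=> ku; apply: weak_wp_ae; exact: weak_Ck. Qed.

Lemma H1_test psi : test psi -> H1 Omega psi.
Proof. by move=> [kpsi _]; exact: H1_Ck. Qed.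

Lemma H10_approx u (e : R) : H10 Omega u -> 0 < e ->
  exists2 psi, test psi & h1sq (fun x => u x - psi x) < e.
Proof.
move=> [Hu H] e0; have [|psi tpsi] := H (Num.sqrt e); first by rewrite sqrtr_gt0.
by rewrite H1norm_lt ?sqrtr_gt0// sqr_sqrtr ?ltW// => Hp; exists psi.
Qed.

Lemma H10P u : H1 Omega u -> (forall e : R, 0 < e ->
  exists2 psi, test psi & h1sq (fun x => u x - psi x) < e) -> H10 Omega u.
Proof.
move=> Hu H; split=> // e e0; have [|psi tpsi Hp] := H (e ^+ 2); first by rewrite exprn_gt0.
by exists psi => //; rewrite H1norm_lt.
Qed.

Lemma H10_test psi : test psi -> H10 Omega psi.
Proof.
move=> tpsi; have Hp := H1_test tpsi; apply: H10P => // e e0; exists psi => //.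
have Lp := H1_L2f Hp; rewrite /h1sq subE L2normsq_lin// dirichlet_lin//; last exact: H1_lin.
rewrite -/(L2normsq Omega psi).
rewrite (dirichletC psi) dirichlet_lin//; move: (E _ _) (L2normsq _ _) => p q; lra.
Qed.

Lemma H10_lin a b u v : H10 Omega u -> H10 Omega v ->
  H10 Omega (fun x => a * u x + b * v x).
Proof.
move=> Hu Hv; have [Hu1 _] := Hu; have [Hv1 _] := Hv.
apply: H10P; first exact: H1_lin.
(* The errors of the two approximations are multiplied by [2 * a ^+ 2] and [2 * b ^+ 2]. *)
move=> e e0; pose d := e / (2 * a ^+ 2 + 2 * b ^+ 2 + 1).
have a2 := sqr_ge0 a; have b2 := sqr_ge0 b.
have c0 : 0 < 2 * a ^+ 2 + 2 * b ^+ 2 + 1 by lra.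
have d0 : 0 < d by rewrite divr_gt0.
have [psi tpsi Hpsi] := H10_approx Hu d0; have [phi tphi Hphi] := H10_approx Hv d0.
exists (fun x => a * psi x + b * phi x).
  by apply: test_functionD; exact: test_functionZ.
rewrite (_ : (fun x => _) = (fun x => a * (u x - psi x) + b * (v x - phi x))); last first.
  by apply/funext => x; ring.
apply: le_lt_trans (h1sq_lin_le _ _ _ _) _; [exact/H1B/H1_test|exact/H1B/H1_test|].
have -> : e = d * (2 * a ^+ 2 + 2 * b ^+ 2 + 1) by rewrite divfK// gt_eqF.
have [h1 h2] := (h1sq_ge0 (fun x => u x - psi x), h1sq_ge0 (fun x => v x - phi x)).
move: Hpsi Hphi h1 h2; move: (h1sq _) (h1sq _) => s t; nra.
Qed.

Lemma H10B u v : H10 Omega u -> H10 Omega v -> H10 Omega (fun x => u x - v x).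
Proof. by rewrite subE; exact: H10_lin. Qed.

Lemma small_eq0 (t C : R) : (forall e, 0 < e -> t ^+ 2 <= C * e) -> t = 0.
Proof.
move=> H; apply/eqP; rewrite -sqrf_eq0 eq_le sqr_ge0 andbT leNgt; apply/negP => t0.
have C0 : 0 < `|C| + 1 by rewrite ltr_pwDr.
have c0 : 0 < 2 * (`|C| + 1) by rewrite mulr_gt0.
have := H (t ^+ 2 / (2 * (`|C| + 1))) (divr_gt0 t0 c0).
rewrite mulrA ler_pdivlMr//; have := ler_norm C; move: `|C| (t ^+ 2) C0 t0 {H c0} => c s; nra.
Qed.

(** Density: by Cauchy-Schwarz both sides are continuous in [v] for the H^1 norm. The squared defect
    at [v] is at most twice the sum of the squares of its two terms at [v - psi]. *)
Lemma weak_eq_H10 y g : H1 Omega y -> L2f g ->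
  (forall psi, test psi -> E y psi = \int[mu]_(x in Omega) (g x * psi x)) ->
  forall v, H10 Omega v -> E y v = \int[mu]_(x in Omega) (g x * v x).
Proof.
move=> Hy Lg H v Hv; have [Hv1 _] := Hv; have Lv := H1_L2f Hv1.
apply/eqP; rewrite -subr_eq0; apply/eqP.
apply: (@small_eq0 _ (2 * E y y + 2 * L2normsq Omega g)) => e e0.
have [psi tpsi Hpsi] := H10_approx Hv e0.
have Hp := H1_test tpsi; have Lp := H1_L2f Hp; have Hd := H1B Hv1 Hp.
have Ld := H1_L2f Hd.
have -> : E y v - \int[mu]_(x in Omega) (g x * v x) =
    E y (fun x => v x - psi x) - \int[mu]_(x in Omega) (g x * (v x - psi x)).
  rewrite dirichletBr// (H psi)//.
  rewrite (@Rint_lin2 _ _ _ mu Omega mO 1 (-1) (fun x => g x * (v x - psi x))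
    (fun x => g x * v x) (fun x => g x * psi x)); try integ.
    by rewrite mul1r mulN1r; move: (E y v) (\int[_]_(x in _) _) (\int[_]_(x in _) _) => p q r; ring.
  by apply: aeD_W => x _; ring.
have c1 := dirichlet_cs Hy Hd; have c2 := cauchy_schwarz_Rint mO Lg Ld.
move: c1 c2 Hpsi; rewrite /h1sq -!/(L2normsq _ _).
have := dirichlet_ge0 (fun x => v x - psi x); have := L2normsq_ge0 (fun x => v x - psi x).
have := dirichlet_ge0 y; have := L2normsq_ge0 g.
move: (\int[_]_(x in _) _) => G; move: (L2normsq _ g) => A.
move: (L2normsq _ _) => B; move: (E y y) => C; move: (E y _) => D; move: (E _ _) => F.
move=> A0 C0 B0 F0 DF GB BF.
have H1 : D ^+ 2 <= C * e by apply: le_trans DF _; apply: ler_wpM2l => //; lra.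
have H2 : G ^+ 2 <= A * e by apply: le_trans GB _; apply: ler_wpM2l => //; lra.
have := sqr_ge0 (D + G); rewrite sqrrD sqrrB; lra.
Qed.

End sobolev_theory.

(** * Poincare inequality and maximum principle *)

Section elliptic.
Context {R : realType} {n : nat}.
Local Notation V := 'rV[R]_n.
Local Notation mu := (lebesgue_rV R n).
Variable Omega : set V.
Hypotheses (oO : open Omega) (bO : bounded_set Omega).
Variable i0 : 'I_n.
Implicit Types (u v w g h psi : V -> R) (i : 'I_n) (a b : R).
Local Notation I1 := (I1 mu Omega).
Local Notation Bd := (Bd mu Omega).
Local Notation L2f := (L2f mu Omega).
Local Notation ae_in := (ae_in Omega).
Local Notation test := (test_function Omega).
Local Notation weak := (is_weak_partial Omega).
Local Notation wp := (wpartial Omega).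
Local Notation E := (dirichlet Omega).

Let mO : measurable Omega := measurable_domain oO.
Let Ooo : (mu Omega < +oo)%E := domain_lty oO bO.

Lemma Rint_sqr_eq0 u : L2f u -> L2normsq Omega u <= 0 -> ae_in (fun x => u x = 0).
Proof.
move=> [_ Iu] u0; have := @Rint_ge0_eq0 _ _ _ mu Omega mO (fun x => u x ^+ 2) Iu.
move=> /(_ (aeD_W _ (fun x _ => sqr_ge0 _)) u0).
by apply: aeD_imp => x _ /eqP; rewrite sqrf_eq0 => /eqP.
Qed.

Lemma L2normsq_partial_le i psi : test psi ->
  L2normsq Omega (partial i psi) <= E psi psi.
Proof.
move=> tpsi; have Hp := H1_test oO bO tpsi; have [kpsi _] := tpsi.
have tp := test_function_partial i tpsi; have Bp := test_function_Bd bO tp.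
rewrite dirichletE; apply: le_Rint_ae => //.
- by integ.
- exact: grad_dot_I1.
- have := ae_forall_ord (fun i => wp_Ck oO bO i kpsi).
  apply: aeD_imp => x _ H; rewrite /grad_dot (bigD1 i)//= H expr2 lerDl.
  by apply: sumr_ge0 => j _; rewrite -expr2 sqr_ge0.
Qed.

(** Integrating by parts against the coordinate x_{i0}, the integral of psi^2 is minus that of 2
    x_{i0} psi d_{i0} psi; half of the norm of psi is then absorbed on the left, whence the constant
    4 M^2. *)
Lemma poincare_test : exists2 C : R, 0 < C & forall psi, test psi ->
  L2normsq Omega psi <= C * E psi psi.
Proof.
have [M M0 OM] := bounded_set_rV_box bO.
exists (4 * M ^+ 2) => [|psi tpsi]; first by rewrite mulr_gt0 ?exprn_gt0.
have tpp := test_functionM tpsi (proj1 tpsi); have [kpp spp] := tpp.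
have tp := test_function_partial i0 tpsi; have Bp := test_function_Bd bO tp.
have Bpsi := test_function_Bd bO tpsi.
have Bc : Bd (fun x => x ord0 i0) by apply: continuous_Bd => //; exact: coord_continuous.
have := Rint_by_parts oO bO i0 (kpp 1%N) (Ck_rV_coord 1 i0) spp.
rewrite partial_coord eqxx; under eq_Rintegral do rewrite mulr1 -expr2.
rewrite -/(L2normsq Omega psi) => H.
have H2 : L2normsq Omega psi <=
    2^-1 * L2normsq Omega psi + 2 * M ^+ 2 * L2normsq Omega (partial i0 psi).
  rewrite {1}H -mulN1r -RintegralZl//; last first.
    have tq := test_function_partial i0 tpp; have Bq := test_function_Bd bO tq.
    by apply: Bd_I1 => //; integ.
  rewrite -(@Rint_lin2 _ _ _ mu Omega mO _ _ (fun x => 2^-1 * psi x ^+ 2 +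
    2 * M ^+ 2 * partial i0 psi x ^+ 2)); [|by integ|by integ|by apply: aeD_W].
  have [kpsi _] := tpsi; have [_ /(_ i0)[dpsi _]] := kpsi 1%N.
  rewrite partialM//; apply: le_Rint_ae => //.
  - by apply: I1Z => //; apply: Bd_I1 => //; integ.
  - by integ.
  - apply: aeD_W => x Ox; have := OM _ Ox i0; rewrite ler_norml => /andP[xM1 xM2].
    move: (psi x) (partial i0 psi x) (x ord0 i0) xM1 xM2 => p q t h1 h2.
    have t2 : t ^+ 2 <= M ^+ 2 by nra.
    (* Young's inequality -2 t p q <= p^2 / 2 + 2 t^2 q^2. *)
    have q2 := sqr_ge0 q; have := sqr_ge0 (p + 2 * t * q).
    have : t ^+ 2 * q ^+ 2 <= M ^+ 2 * q ^+ 2 by rewrite ler_wpM2r.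
    nra.
have H3 := L2normsq_partial_le i0 tpsi.
have M2 : 0 < M ^+ 2 by rewrite exprn_gt0.
move: H2 H3 M2 {H}; move: (L2normsq _ psi) (L2normsq _ (partial _ _)) (E _ _) (M ^+ 2).
move=> p q r m H2 H3 m0; have := ler_wpM2l (ltW m0) H3; lra.
Qed.

Lemma poincare : exists2 C : R, 0 < C & forall u, H10 Omega u ->
  L2normsq Omega u <= C * E u u.
Proof.
have [C C0 HC] := poincare_test; exists (4 * C) => [|u Hu]; first by rewrite mulr_gt0.
have [Hu1 _] := Hu.
rewrite leNgt; apply/negP; rewrite -subr_gt0 => d0.
(* Splitting [u] into [psi] and [u - psi], and [psi] back again, costs a factor 2 each time and
   leaves an error at most 2 + 4 C times the squared H^1 distance. *)
have c0 : 0 < 2 + 4 * C + 1 by lra.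
have e0 := divr_gt0 d0 c0.
have [psi tpsi Hpsi] := H10_approx Hu e0.
have Hp := H1_test oO bO tpsi.
have Lu := H1_L2f oO Hu1; have Lp := H1_L2f oO Hp.
have Hd := H1B oO bO Hu1 Hp; have Ld := H1_L2f oO Hd.
have h1 := L2normsq_lin_le oO 1 1 Lp Ld.
have h2 := dirichlet_lin_le oO bO 1 (-1) Hu1 Hd.
have E1 : (fun x => 1 * psi x + 1 * (u x - psi x)) = u by apply/funext => x; ring.
have E2 : (fun x => 1 * u x + (-1) * (u x - psi x)) = psi by apply/funext => x; ring.
rewrite E1 in h1; rewrite E2 in h2; have h3 := HC _ tpsi.
move: h1 h2 h3 Hpsi d0; rewrite /h1sq ltr_pdivlMr//.
have := L2normsq_ge0 Omega (fun x => u x - psi x); have := dirichlet_ge0 Omega (fun x => u x -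
  psi x).
move: (L2normsq _ (fun _ => _)) (E (fun _ => _) _) => p q.
move: (L2normsq _ psi) => s; move: (E psi _) => z; move: (L2normsq _ _) (E _ _) => r t.
move=> q0 p0 rs zt sz; have := ler_wpM2l (ltW C0) zt; nra.
Qed.

(** By density [u] may be tested with itself, so its energy is 0 and Poincare concludes. *)
Lemma weak_sol_eq0 u : H10 Omega u -> (forall psi, test psi -> E u psi = 0) ->
  ae_in (fun x => u x = 0).
Proof.
move=> Hu H; have [Hu1 _] := Hu; have [C C0 HC] := poincare.
have L0 : L2f (fun=> 0) by integ.
have z v : \int[mu]_(x in Omega) (0 * v x) = 0.
  by apply: Rint_eq0 => x _; rewrite mul0r.
have H0 : E u u = 0.
  by rewrite (weak_eq_H10 oO bO Hu1 L0 _ Hu) => [|psi tpsi]; rewrite z// H.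
apply: Rint_sqr_eq0; first exact: H1_L2f Hu1.
by have := HC _ Hu; rewrite H0 mulr0.
Qed.

Lemma dirichlet_Ck u v : (forall k, Ck_rV k u) -> (forall k, Ck_rV k v) ->
  E u v = \int[mu]_(x in Omega) (\sum_(i < n) partial i u x * partial i v x).
Proof.
move=> ku kv; rewrite dirichletE; apply: Rint_ae_eq.
have Hu := ae_forall_ord (fun i => wp_Ck oO bO i ku).
have Hv := ae_forall_ord (fun i => wp_Ck oO bO i kv).
by apply: aeD_imp2 Hu Hv => x _ Hu Hv; apply: eq_bigr => i _; rewrite Hu Hv.
Qed.

Lemma partial_Ck i u : (forall k, Ck_rV k u) -> forall k, Ck_rV k (partial i u).
Proof. by move=> ku k; have [_ /(_ i)[]] := ku k.+1. Qed.

Lemma partial_Bd i u : (forall k, Ck_rV k u) -> Bd (partial i u).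
Proof. by move=> /(partial_Ck i)/(_ 0%N)[cu _]; exact: continuous_Bd. Qed.

Lemma dirichlet_test u v : (forall k, Ck_rV k u) -> test v ->
  E u v = - \int[mu]_(x in Omega) ((\sum_(i < n) partial i (partial i u) x) * v x).
Proof.
move=> ku tv; have [kv sv] := tv; rewrite dirichlet_Ck//.
have Bv := test_function_Bd bO tv.
have Bu i := partial_Bd i ku; have Bdv i := partial_Bd i kv.
have Bdu i := partial_Bd i (partial_Ck i ku).
rewrite Rint_sum//; last by move=> i; apply: Bd_I1 => //; integ.
rewrite (@Rint_ae_eq _ _ _ mu _ (fun x => _ * v x)
   (fun x => \sum_(i < n) (partial i (partial i u) x * v x))); last first.
  by apply: aeD_W => x _; rewrite mulr_suml.
rewrite Rint_sum//; last by move=> i; apply: Bd_I1 => //; integ.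
rewrite -sumrN; apply: eq_bigr => i _.
have H := Rint_by_parts oO bO i (kv 1%N) (partial_Ck i ku 1%N) sv.
transitivity (\int[mu]_(x in Omega) (partial i v x * partial i u x)).
  by apply: eq_Rintegral => x _; exact: mulrC.
apply: oppr_inj; rewrite opprK; apply: etrans (esym H) _.
by apply: eq_Rintegral => x _; exact: mulrC.
Qed.

Lemma laplacian_horner_coord (p : {poly R}) (x : V) :
  \sum_(i < n) partial i (partial i (fun x => p.[x ord0 i0])) x =
  (p^`()^`())%R.[x ord0 i0].
Proof.
have D (q : {poly R}) i : partial i (fun x : V => q.[x ord0 i0]) =
    (fun x => (i0 == i)%:R * (q^`())%R.[x ord0 i0]).
  have [_ /(_ i)[dc _]] := @Ck_rV_coord R n 1 i0.
  rewrite (@partial_comp _ _ (horner q) i (fun x => x ord0 i0) (@smooth_fun_horner R q) dc).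
  by apply/funext => y; rewrite partial_coord -derivE mulrC.
rewrite (bigD1 i0)//= big1 => [|i ii0].
  rewrite addr0 D eqxx (_ : (fun _ => _) = (fun x : V => (p^`())%R.[x ord0 i0])).
    by rewrite D eqxx mul1r.
  by apply/funext => y; rewrite mul1r.
rewrite D eq_sym (negbTE ii0) (_ : (fun _ => _) = (fun=> 0)).
  by rewrite partial_cst.
by apply/funext => y; rewrite mul0r.
Qed.

(* The barrier is [kappa (rho - t^2)^2] in one coordinate [t]: unlike
   [kappa (rho - t^2)] it is nonnegative on the whole space, so the bump of
   [psi - barrier] vanishes wherever [psi] does and is again a test function. *)
Lemma barrier : exists2 B : R, 0 < B & forall c : R, 0 < c ->
  exists Y : V -> R, [/\ forall k, Ck_rV k Y, forall x, 0 <= Y x,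
    forall x, Omega x -> Y x <= c * B &
    forall x, Omega x -> \sum_(i < n) partial i (partial i Y) x <= - c].
Proof.
have [M M0 OM] := bounded_set_rV_box bO.
(* The second derivative of kappa (rho - t^2)^2 is kappa (12 t^2 - 4 rho), which is at most -2 kappa
   rho = -c as soon as t^2 <= rho / 6 = M^2; the maximum kappa rho^2 is c rho / 2. *)
pose rho := 6 * M ^+ 2.
have rho0 : 0 < rho by rewrite mulr_gt0 ?exprn_gt0.
exists (rho / 2) => [|c c0]; first by rewrite divr_gt0.
pose kappa := c / (2 * rho).
have kr : 2 * kappa * rho = c by rewrite /kappa; field; rewrite gt_eqF.
have k0 : 0 < kappa by rewrite divr_gt0// mulr_gt0.
pose p : {poly R} := (kappa * rho ^+ 2)%:P + (- (2 * kappa * rho)) *: 'X^2 + kappa *: 'X^4.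
have pE t : p.[t] = kappa * (rho - t ^+ 2) ^+ 2 by rewrite /p !(hornerD, hornerZ, hornerC,
  hornerXn); ring.
have ppE t : ((p^`())^`())%R.[t] = kappa * (12 * t ^+ 2 - 4 * rho).
  have dX (a : R) (k : nat) : ((a *: 'X^(k.+1))^`())%R = (a * k.+1%:R) *: 'X^k.
    by rewrite derivZ derivXn -scaler_nat scalerA.
  rewrite /p !derivD derivC raddf0 add0r !dX !(hornerD, hornerZ, hornerXn); ring.
have t6 x : Omega x -> x ord0 i0 ^+ 2 <= rho / 6.
  move=> Ox; have := OM _ Ox i0; rewrite ler_norml => /andP[h1 h2].
  rewrite (_ : rho / 6 = M ^+ 2); last by rewrite /rho; field.
  by nra.
exists (fun x => p.[x ord0 i0]); split.
- move=> k; have := @Ck_rV_comp R n k (horner p) (fun x => x ord0 i0) (@smooth_fun_horner R p).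
  by apply; exact: Ck_rV_coord.
- by move=> x; rewrite pE mulr_ge0 ?sqr_ge0 ?ltW.
- move=> x Ox; rewrite pE -kr; have := t6 _ Ox; have := sqr_ge0 (x ord0 i0).
  move: (x ord0 i0 ^+ 2) => s s0 s1.
  have : (rho - s) ^+ 2 <= rho ^+ 2 by nra.
  move=> /(ler_wpM2l (ltW k0)); nra.
- move=> x Ox; rewrite laplacian_horner_coord ppE -kr; have := t6 _ Ox.
  move: (x ord0 i0 ^+ 2) => s s1; nra.
Qed.

(* Tested with [expbump (psi - Y)] for test functions [psi] tending to [u] and
   the barrier [Y]. *)
Lemma weak_max : exists2 B : R, 0 < B & forall u g (c : R), 0 < c ->
  H10 Omega u -> L2f g ->
  (forall psi, test psi -> E u psi = \int[mu]_(x in Omega) (g x * psi x)) ->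
  ae_in (fun x => g x <= c / 2) -> ae_in (fun x => u x <= c * B).
Proof.
have [B B0 HB] := barrier; exists B => // u g c c0 Hu Lg Hug gc.
have [Y [kY Y0 Yc lapY]] := HB c c0.
have BlapY : Bd (fun x => \sum_(i < n) partial i (partial i Y) x).
  apply: continuous_Bd => //; apply: (@Ck_rV_continuous _ _ 0%N).
  by apply: Ck_rV_sum => i; do 2 apply: partial_Ck.
have HY := H1_Ck oO bO kY.
have [Hu1 _] := Hu; have Lu := H1_L2f oO Hu1.
have BY : Bd Y by apply: continuous_Bd => //; exact: (Ck_rV_continuous (kY 0%N)).
have [K K0 HK] := @derive1_expbump_bounded R.
have [L L0 HL] := @expbump_lipschitz R.
have mb : measurable_fun [set: R] (@expbump R).
  by apply: continuous_measurable_fun; exact: smooth_fun_continuous smooth_expbump.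
have Bw w : measurable_fun Omega w -> Bd (fun x => expbump (w x)).
  move=> mw; split; first by apply: (measurableT_comp mb).
  by exists 1; apply: aeD_W => x _; rewrite ger0_norm ?expbump_ge0 ?expbump_le1.
have muY : measurable_fun Omega (fun x => u x - Y x).
  by apply: measurable_funB; [case: Lu|case: BY].
pose m := fine (mu Omega).
have m0 : 0 <= m by rewrite fine_ge0.
(* [psi] lies within H^1 distance [d] of [u]. Letting [d] tend to 0, the integral of
   [expbump (u - Y)] vanishes, which means [u <= Y] almost everywhere. *)
have key d : 0 < d -> d < 1 ->
    \int[mu]_(x in Omega) expbump (u x - Y x) <= (K / (2 * c) + L * (m + 1)) * d.
  move=> d0 d1; have d20 : 0 < d ^+ 2 by rewrite exprn_gt0.
  have [psi tpsi Hpsi] := H10_approx Hu d20; have [kpsi [Kc [cK KO psi0]]] := tpsi.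
  have Hp := H1_test oO bO tpsi; have Hd := H1B oO bO Hu1 Hp.
  have Lp := H1_L2f oO Hp; have Ld := H1_L2f oO Hd.
  pose W x := psi x - Y x.
  have kW k : Ck_rV k W by exact: Ck_rVB.
  pose v x := expbump (W x).
  have kv k : Ck_rV k v by exact: (Ck_rV_comp smooth_expbump).
  have tv : test v.
    split=> //; exists Kc; split=> // x /psi0 p0; apply: expbump_le0.
    by rewrite /W p0 sub0r oppr_le0.
  have Hv := H1_test oO bO tv; have Bv := test_function_Bd bO tv.
  have pv i : partial i v = (fun x => derive1 expbump (W x) * partial i W x).
    by have [_ /(_ i)[dW _]] := kW 1%N; rewrite (partial_comp smooth_expbump dW).
  have HW : H1 Omega W by exact: H1_Ck.
  have P0 : 0 <= E W v.
    rewrite dirichlet_Ck//; apply: Rintegral_ge0 => x _; apply: sumr_ge0 => i _.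
    have /andP[b0 _] := HK (W x).
    by rewrite pv mulrCA mulr_ge0// -expr2 sqr_ge0.
  (* The gradient of [v] is that of [W] times a factor s in [0, K], and s^2 <= K s. *)
  have EvP : E v v <= K * E W v.
    rewrite !dirichlet_Ck// -RintegralZl//; last first.
      by apply: I1_sum => // i; have := partial_Bd i kW; have := partial_Bd i kv => ? ?; apply:
        Bd_I1 => //; integ.
    apply: le_Rint_ae => //.
    - by apply: I1_sum => // i; have := partial_Bd i kv => ?; apply: Bd_I1 => //; integ.
    - apply: I1Z => //; apply: I1_sum => // i; have := partial_Bd i kW; have := partial_Bd i kv
      => ? ?.
      by apply: Bd_I1 => //; integ.
    - apply: aeD_W => x _; rewrite mulr_sumr; apply: ler_sum => i _.
      have /andP[b0 b1] := HK (W x); rewrite pv.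
      move: (derive1 expbump (W x)) b0 b1 (partial i W x) => s s0 s1 q.
      have q2 := sqr_ge0 q.
      have : s ^+ 2 * q ^+ 2 <= K * s * q ^+ 2 by rewrite ler_wpM2r//; nra.
      by nra.
  (* The left-hand side is [E u v - E Y v]. In [Omega] the weight on the right is at most c/2 - c =
     -c/2, which controls the integral of [v]. *)
  have Edec : E (fun x => u x - psi x) v + E W v =
      \int[mu]_(x in Omega) ((g x + \sum_(i < n) partial i (partial i Y) x) * v x).
    rewrite dirichletB// dirichletB// (Hug _ tv) (dirichlet_test kY tv).
    rewrite (@Rint_lin2 _ _ _ mu Omega mO 1 1 (fun x => (g x + _) * v x)
      (fun x => g x * v x) (fun x => (\sum_(i < n) partial i (partial i Y) x) * v x)).
    - rewrite !mul1r; move: (E psi v) (\int[mu]_(x in _) _) (\int[mu]_(x in _) _) => s t z; ring.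
    - by integ.
    - by apply: Bd_I1 => //; integ.
    - by apply: aeD_W => x _; ring.
  have Ile : \int[mu]_(x in Omega) ((g x + \sum_(i < n) partial i (partial i Y) x) * v x) <=
      - (c / 2) * \int[mu]_(x in Omega) v x.
    rewrite -RintegralZl//; last by apply: Bd_I1.
    apply: le_Rint_ae => //.
    - have Lv : L2f v by apply: Bd_L2f.
      have LY : L2f (fun x => \sum_(i < n) partial i (partial i Y) x) by apply: Bd_L2f.
      by integ.
    - by apply: I1Z => //; apply: Bd_I1.
    - apply: aeD_imp gc => x Ox gx; rewrite ler_wpM2r ?expbump_ge0//.
      by have := lapY _ Ox; move: gx; move: (g x) (\sum_(i < n) _) => s t; lra.
  have DD := dirichlet_cs oO bO Hd Hv.
  have Eps : E (fun x => u x - psi x) (fun x => u x - psi x) <= d ^+ 2.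
    apply: le_trans (ltW Hpsi); rewrite /h1sq lerDr; exact: L2normsq_ge0.
  have Eps0 := dirichlet_ge0 Omega (fun x => u x - psi x).
  have vle : \int[mu]_(x in Omega) v x <= K / (2 * c) * d.
    have H : E (fun x => u x - psi x) v ^+ 2 <= d ^+ 2 * (K * E W v).
      apply: le_trans DD _; apply: ler_pM => //; exact: dirichlet_ge0.
    move: Ile; rewrite -Edec {Edec}; move: (\int[mu]_(x in _) v x) => I.
    move: (E (fun _ => _) v) (E W v) H P0 => D P H P0 Ile.
    (* Since D^2 <= d^2 K P, the quantity -(D + P) is at most d sqrt(K P) - P, whose maximum over P
       is K d^2 / 4. *)
    pose q := K * d ^+ 2 / 4.
    have q0 : 0 <= q by rewrite /q; nra.
    have DP : - (D + P) <= q.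
      rewrite leNgt; apply/negP => qDP.
      have : (P + q) ^+ 2 < D ^+ 2 by nra.
      have : 4 * P * q <= (P + q) ^+ 2 by have := sqr_ge0 (P - q); lra.
      have -> : 4 * P * q = d ^+ 2 * (K * P) by rewrite /q; field.
      lra.
    rewrite mulrAC ler_pdivlMr ?mulr_gt0//.
    have : K * d ^+ 2 <= K * d by rewrite ler_wpM2l ?(ltW K0)//; nra.
    rewrite /q in DP; lra.
  have : \int[mu]_(x in Omega) expbump (u x - Y x) <=
      \int[mu]_(x in Omega) (v x + L * (d + d^-1 * (u x - psi x) ^+ 2)).
    apply: le_Rint_ae => //.
    - by apply: Bd_I1 => //; exact: Bw.
    - have I3 : I1 (fun x => (u x - psi x) ^+ 2) by case: Ld.
      have I4 : I1 v by exact: Bd_I1.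
      have I5 : I1 (fun=> d) by apply: Bd_I1 => //; exact: Bd_cst.
      by integ.
    - apply: aeD_W => x _; have := HL (u x - Y x) (W x).
      rewrite (_ : u x - Y x - W x = u x - psi x); last by rewrite /W; ring.
      rewrite -/(v x); move: (expbump _) (v x) (u x - psi x) => s t z.
      move=> H; have H1 := ler_norm (s - t).
      (* The Lipschitz bound is linear in u - psi while the distance to [psi] is quadratic; this
         inequality converts one into the other, both terms contributing order [d]. *)
      have : `|z| <= d + d^-1 * z ^+ 2.
        rewrite -(ler_pM2r d0) mulrDl mulrAC mulVf ?gt_eqF// mul1r -[z ^+ 2]real_normK ?num_real//.
        have := sqr_ge0 (`|z| - d); have := normr_ge0 z; move: (`|z|) => y; nra.
      move=> /(ler_wpM2l (ltW L0)); lra.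
  have I3 : I1 (fun x => (u x - psi x) ^+ 2) by case: Ld.
  have I4 : I1 v by exact: Bd_I1.
  rewrite (@Rint_lin3 _ _ _ mu Omega mO 1 (L * d) (L * d^-1)
    (fun x => v x + L * (d + d^-1 * (u x - psi x) ^+ 2)) v (fun=> 1)
    (fun x => (u x - psi x) ^+ 2)) => [|//|//|//|]; last 2 first.
  - by apply: Bd_I1 => //; exact: Bd_cst.
  - by apply: aeD_W => x _; ring.
  rewrite Rintegral_cst// -/m -/(L2normsq Omega (fun x => u x - psi x)).
  have : L2normsq Omega (fun x => u x - psi x) <= d ^+ 2.
    by apply: le_trans (ltW Hpsi); rewrite /h1sq lerDl; exact: dirichlet_ge0.
  move: vle; move: (L2normsq _ _) => q.
  move: (\int[mu]_(x in _) v x) => I; move: (\int[mu]_(x in _) _) => I' vle qd.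
  move=> /le_trans; apply.
  have : L * d^-1 * q <= L * d^-1 * d ^+ 2.
    by rewrite ler_wpM2l// mulr_ge0// ?invr_ge0; apply: ltW.
  rewrite (_ : L * d^-1 * d ^+ 2 = L * d); last by field; rewrite gt_eqF.
  lra.
have Ieta : I1 (fun x => expbump (u x - Y x)) by apply: Bd_I1 => //; exact: Bw.
have I0 : \int[mu]_(x in Omega) expbump (u x - Y x) <= 0.
  move: key; move: (\int[mu]_(x in _) _) (K / (2 * c) + L * (m + 1)) => t C key.
  rewrite leNgt; apply/negP => t0.
  have C1 : 0 < `|C| + t + 1 by rewrite -addrA ltr_wpDl// addr_gt0.
  (* Chosen below 1 and such that [C * q < t], which contradicts [key]. *)
  pose q := t / (2 * (`|C| + t + 1)).
  have q0 : 0 < q by rewrite divr_gt0 ?mulr_gt0.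
  have qE : q * (2 * (`|C| + t + 1)) = t by rewrite divfK// gt_eqF// mulr_gt0.
  have := key _ q0; have := ler_norm C; have := normr_ge0 C.
  move: (`|C|) qE => c' qE c'0 Cc' H.
  have c'q : 0 <= c' * q by rewrite mulr_ge0// ltW.
  have tq : 0 < t * q by rewrite mulr_gt0.
  have q1 : q < 1 by rewrite -(ltr_pM2r t0); nra.
  have := H q1; have : C * q <= c' * q by rewrite ler_wpM2r// ltW.
  lra.
have := Rint_ge0_eq0 mO Ieta (aeD_W _ (fun x _ => expbump_ge0 _)) I0.
apply: aeD_imp => x Ox H; apply: le_trans (Yc _ Ox).
rewrite -subr_le0 leNgt -expbump_gt0 H ltxx//.
Qed.

End elliptic.

(** * Weak solutions *)

Section regularity.
Context {R : realType} {n : nat}.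
Local Notation V := 'rV[R]_n.
Local Notation mu := (lebesgue_rV R n).
Variable Omega : set V.
Hypotheses (oO : open Omega) (bO : bounded_set Omega).
Implicit Types (u v w y g h psi : V -> R) (i : 'I_n) (a b : R).
Local Notation I1 := (I1 mu Omega).
Local Notation Bd := (Bd mu Omega).
Local Notation L2f := (L2f mu Omega).
Local Notation ae_in := (ae_in Omega).
Local Notation test := (test_function Omega).
Local Notation weak := (is_weak_partial Omega).
Local Notation wp := (wpartial Omega).
Local Notation E := (dirichlet Omega).

Let mO : measurable Omega := measurable_domain oO.
Let Ooo : (mu Omega < +oo)%E := domain_lty oO bO.

Lemma Wkq_lin k (q : \bar R) a b u v : (1 <= q)%E -> Wkq Omega k q u -> Wkq Omega k q v ->
  Wkq Omega k q (fun x => a * u x + b * v x).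
Proof.
move=> q1; elim: k u v => [|k IH] u v [Lu Hu] [Lv Hv]; split=> //; try exact: Lp_lin.
move=> i; have [g wg Wg] := Hu i; have [h wh Wh] := Hv i.
by exists (fun x => a * g x + b * h x); [exact: weak_lin|exact: IH].
Qed.

(** Only test functions are used here, so that the boundary condition stays a separate hypothesis;
    [weak_solP] passes to all of H^1_0. *)
Definition weak_sol y g := forall psi, test psi ->
  E y psi = \int[mu]_(x in Omega) (g x * psi x).

Lemma weak_sol_lin a b u v g h : H1 Omega u -> H1 Omega v -> L2f g -> L2f h ->
  weak_sol u g -> weak_sol v h ->
  weak_sol (fun x => a * u x + b * v x) (fun x => a * g x + b * h x).
Proof.
move=> Hu Hv Lg Lh Eu Ev psi tpsi; have Hp := H1_test oO bO tpsi; have Lp := H1_L2f oO Hp.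
rewrite dirichlet_lin// Eu// Ev//; apply: esym; apply: Rint_lin2 => //; try integ.
by apply: aeD_W => x _; ring.
Qed.

Lemma weak_sol_ae y g h : ae_in (fun x => g x = h x) -> weak_sol y g -> weak_sol y h.
Proof.
move=> gh Ey psi tpsi; rewrite Ey//; apply: Rint_ae_eq.
by apply: aeD_imp gh => x _ ->.
Qed.

Lemma weak_solP y g : H1 Omega y -> L2f g -> weak_sol y g <->
  (forall v, H10 Omega v -> E y v = \int[mu]_(x in Omega) (g x * v x)).
Proof.
move=> Hy Lg; split=> [Ey v Hv|H psi tpsi]; first exact: weak_eq_H10 Hv.
by apply: H; exact: H10_test.
Qed.

Lemma H1_ae u v : measurable_fun Omega v -> ae_in (fun x => u x = v x) ->
  H1 Omega u -> H1 Omega v.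
Proof.
move=> mv uv Hu; have Lv := L2f_ae_transfer mv uv (H1_L2f oO Hu).
apply/H1P => //; split=> // i; exists (wp i u); last exact: H1_wp.
have wu := H1_weak oO i Hu; have [_ Lw _] := wu.
apply: weak_ae wu => //; [exact: L1loc_L2f|exact: aeD_W].
Qed.

Section W2.
Variable y : V -> R.
Hypothesis Wy : Wkq Omega 2 2%:E y.

Lemma W2_H1 : H1 Omega y.
Proof.
have [/(Lp2_L2f oO) Ly H] := Wy; apply/H1P => //; split=> // i.
by have [g wg Hg] := H i; exists g => //; exact: H1_L2f.
Qed.

Lemma W2_wp i : H1 Omega (wp i y).
Proof.
have [_ /(_ i)[g wg Hg]] := Wy; have [_ [mw _] _] := weak_wp wg.
by apply: H1_ae Hg => //; apply: aeD_imp (weak_wp_ae oO bO wg) => x _ ->.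
Qed.

Lemma wlaplacian_L2f : L2f (wlaplacian Omega y).
Proof.
rewrite /wlaplacian; elim: (index_enum _) => [|i s IH].
  by apply: (@L2f_ext _ _ _ _ _ mO (fun=> 0)) => [x _|]; [rewrite big_nil|integ].
apply: (@L2f_ext _ _ _ _ _ mO (fun x => wp i (wp i y) x + \sum_(j <- s) wp j (wp j y) x)).
  by move=> x _; rewrite big_cons.
have := H1_wp oO bO i (W2_wp i); integ.
Qed.

Lemma wlaplacian_weak_sol : weak_sol y (fun x => - wlaplacian Omega y x).
Proof.
move=> psi tpsi; have Hp := H1_test oO bO tpsi; have Lp := H1_L2f oO Hp.
have [kpsi _] := tpsi; have Hy := W2_H1.
have Lw i := H1_wp oO bO i Hy; have Lpp i := H1_wp oO bO i Hp.
have Lww i := H1_wp oO bO i (W2_wp i).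
rewrite dirichletE /grad_dot Rint_sum//; last by move=> i; have := Lw i; have := Lpp i; integ.
rewrite (@Rint_ae_eq _ _ _ mu Omega (fun x => - _ * psi x)
   (fun x => \sum_(i < n) (- (wp i (wp i y) x * psi x)))); last first.
  by apply: aeD_W => x _; rewrite sumrN mulNr mulr_suml.
rewrite Rint_sum//; last by move=> i; have := Lww i; integ.
apply: eq_bigr => i _; have [_ _ /(_ _ tpsi) H] := H1_weak oO i (W2_wp i).
transitivity (\int[mu]_(x in Omega) (wp i y x * partial i psi x)).
  apply: Rint_ae_eq; apply: aeD_imp (wp_Ck oO bO i kpsi) => x _ -> //.
apply: etrans H _; apply: etrans (esym (mulN1r _)) _.
rewrite -RintegralZl//; last exact: L2f_I1M.
by apply: eq_Rintegral => x _; exact: mulN1r.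
Qed.

(** In W^{2,2} a second integration by parts and the fundamental lemma exchange the weak and the
    pointwise equation; (a) and (c) are translated through this equivalence. *)
Lemma weak_sol_wlaplacian g : L2f g -> weak_sol y g <->
  ae_in (fun x => - wlaplacian Omega y x = g x).
Proof.
move=> Lg; split=> [Ey|H]; last exact: weak_sol_ae wlaplacian_weak_sol.
have Ll := wlaplacian_L2f.
have LL : L1loc Omega (fun x => 1 * - wlaplacian Omega y x + (-1) * g x).
  by apply: L1loc_L2f => //; integ.
have := fundamental_lemma oO bO LL; move=> H; apply: aeD_imp (H _) => [x _ /eqP|psi tpsi].
  by rewrite mul1r mulN1r subr_eq0 => /eqP.
have Lp := H1_L2f oO (H1_test oO bO tpsi).
rewrite (@Rint_lin2 _ _ _ _ _ mO 1 (-1) _ (fun x => - wlaplacian Omega y x * psi x) (fun x => g x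
  * psi x)).
- by rewrite -Ey// -wlaplacian_weak_sol//; move: (E y psi) => t; ring.
- by integ.
- by integ.
- by apply: aeD_W => x _; ring.
Qed.

End W2.

Section maximum.
Variable i0 : 'I_n.

(** [weak_max] asks for a positive constant, so it is applied to [- u], written as a linear
    combination, with all the constants 1/(k+1); a countable union of null sets and the Archimedean
    property conclude. *)
Lemma weak_sol_ge0 u g : H10 Omega u -> L2f g -> weak_sol u g ->
  ae_in (fun x => 0 <= g x) -> ae_in (fun x => 0 <= u x).
Proof.
move=> Hu Lg Eu g0; have [B B0 HB] := weak_max oO bO i0.
have Hu' := H10_lin oO bO (-1) 0 Hu Hu; have [Hu1 _] := Hu.
have Eu' := weak_sol_lin (-1) 0 Hu1 Hu1 Lg Lg Eu Eu.
have : {ae mu, forall x, forall k : nat, Omega x -> - u x <= k.+1%:R^-1 * B}.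
  apply: ae_foralln => k.
  have k0 : 0 < k.+1%:R^-1 :> R by rewrite invr_gt0.
  have := HB _ _ _ k0 Hu' _ Eu'.
  have L' : L2f (fun x => -1 * g x + 0 * g x) by integ.
  move=> /(_ L'); set P := ae_in _ => H.
  have : P.
    by apply: aeD_imp g0 => x _ gx; rewrite mul0r addr0 mulN1r; have := k0; move: (k.+1%:R^-1) gx
      => r; lra.
  move=> /H; apply: aeD_imp => x _; by rewrite mul0r addr0 mulN1r.
apply: filterS => x H Ox; rewrite leNgt; apply/negP => ux.
have ux' : 0 < - u x by rewrite oppr_gt0.
have := archi_boundP (ltW (divr_gt0 B0 ux')); set k := Num.bound _ => Hk.
have := H k Ox; rewrite leNgt => /negP; apply.
rewrite mulrC ltr_pdivrMr// mulrC -ltr_pdivrMr//.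
by apply: lt_le_trans Hk _; rewrite ler_nat.
Qed.

Lemma weak_sol_bounded : exists2 B : R, 0 < B & forall u g (c : R), 0 < c ->
  H10 Omega u -> L2f g -> weak_sol u g ->
  ae_in (fun x => `|g x| <= c) -> ae_in (fun x => `|u x| <= c * B).
Proof.
have [B B0 HB] := weak_max oO bO i0.
(* [weak_max] requires the right-hand side to be at most half of its constant, hence its use with
   [2 * c], for [u] and for [- u]. *)
exists (2 * B) => [|u g c c0 Hu Lg Eu gc]; first by rewrite mulr_gt0.
have Hu' := H10_lin oO bO (-1) 0 Hu Hu; have [Hu1 _] := Hu.
have Eu' := weak_sol_lin (-1) 0 Hu1 Hu1 Lg Lg Eu Eu.
have L' : L2f (fun x => -1 * g x + 0 * g x) by integ.
have c20 : 0 < 2 * c by rewrite mulr_gt0.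
have := HB _ _ _ c20 Hu' L' Eu'; have := HB _ _ _ c20 Hu Lg Eu.
set P1 := ae_in _; set P2 := ae_in _; set P3 := ae_in _; set P4 := ae_in _ => H1 H2.
have /H1 h1 : P1 by apply: aeD_imp gc => x _; rewrite ler_norml => /andP[? ?]; lra.
have /H2 h2 : P3.
  by apply: aeD_imp gc => x _; rewrite ler_norml mul0r addr0 => /andP[? ?]; lra.
apply: aeD_imp2 h1 h2 => x _; rewrite mul0r addr0 ler_norml => h1 h2.
by apply/andP; split; lra.
Qed.

End maximum.

End regularity.

(** * Superposition operators *)

Section superposition.
Context {R : realType} {n : nat}.
Local Notation V := 'rV[R]_n.
Local Notation mu := (lebesgue_rV R n).
Variable Omega : set V.
Hypothesis mO : measurable Omega.
Local Notation Bd := (Bd mu Omega).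
Local Notation ae_in := (ae_in Omega).
Local Notation lmeas := (lebesgue_measurable_fun Omega).

(** The upper limit of Borel versions of the [F k] is Borel on all of [Omega], also where the
    versions do not converge. *)
Lemma lebesgue_measurable_lim (F : nat -> V -> R) G : (forall k, lmeas (F k)) ->
  ae_in (fun x => F ^~ x @ \oo --> G x) -> lmeas G.
Proof.
move=> mF FG; have /choice[g Hg] : forall k, exists g, measurable_fun Omega g /\
    ae_in (fun x => F k x = g x) by move=> k; have [g] := mF k; exists g.
exists (fun x => fine (limn_esup (fun k => (g k x)%:E))).
  apply: (measurableT_comp (fine_measurable measurableT)).
  by apply: measurable_fun_limn_esup => k; apply/measurable_EFinP; case: (Hg k).
have Fg : ae_in (fun x => forall k, F k x = g k x).
  have : {ae mu, forall x, forall k, Omega x -> F k x = g k x}.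
    by apply: ae_foralln => k; case: (Hg k).
  by apply: filterS => x H Ox k; exact: H.
apply: aeD_imp2 FG Fg => x Ox {}FG {}Fg.
have c : (fun k => (g k x)%:E) @ \oo --> (G x)%:E.
  apply/cvg_EFin; first exact: nearW.
  rewrite (_ : _ \o _ = F ^~ x); first exact: FG.
  by apply/funext => k /=; rewrite Fg.
rewrite is_cvg_limn_esupE; last by apply/cvg_ex; exists (G x)%:E.
by have -> := cvg_lim (@ereal_hausdorff R) c.
Qed.

Lemma measurable_fun_select (T : V -> nat) (g : nat -> V -> R) :
  (forall j, measurable (Omega `&` [set x | T x = j])) ->
  (forall j, measurable_fun Omega (g j)) -> measurable_fun Omega (fun x => g (T x) x).
Proof.
move=> mT mg _ B mB.
rewrite (_ : _ `&` _ = \bigcup_j ((Omega `&` [set x | T x = j]) `&` (Omega `&` g j @^-1` B))).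
  by apply: bigcupT_measurable => j; apply: measurableI => //; exact: mg.
apply/seteqP; split=> [x [Ox Bx]|x [j _ [[Ox /= Tx] [_ Bx]]]].
  by exists (T x) => //; split.
by split=> //=; rewrite Tx.
Qed.

(** Caratheodory functions: [y] is approximated by functions with countably many values. For each
    fixed value a Borel version exists, and continuity in the second argument passes to the
    limit. *)
Lemma lebesgue_measurable_comp (phi : V -> R -> R) (y : V -> R) :
  (forall t, lmeas (phi ^~ t)) -> ae_in (fun x => continuous (phi x)) ->
  measurable_fun Omega y -> lmeas (fun x => phi x (y x)).
Proof.
move=> mphi cphi my.
(* A grid of step 1/(k+1) starting at -k. [T k x] is the index of the grid point just below [y x];
   the maximum with 0 matters only while [y x < -k]. *)
pose q (k j : nat) : R := j%:R / k.+1%:R - k%:R.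
pose z (k : nat) x : R := Num.max 0 (k.+1%:R * (y x + k%:R)).
pose T k x := Num.truncn (z k x).
have z0 k x : 0 <= z k x by rewrite le_max lexx.
have mz k : measurable_fun Omega (z k).
  apply: measurable_maxr; first exact: measurable_cst.
  apply: measurable_funM; first exact: measurable_cst.
  by apply: measurable_funD => //; exact: measurable_cst.
apply: (@lebesgue_measurable_lim (fun k x => phi x (q k (T k x)))).
  move=> k; have /choice[g Hg] : forall j, exists g, measurable_fun Omega g /\
      ae_in (fun x => phi x (q k j) = g x) by move=> j; have [g] := mphi (q k j); exists g.
  exists (fun x => g (T k x) x).
    apply: measurable_fun_select; last by move=> j; case: (Hg j).
    move=> j; rewrite (_ : [set x | _] = z k @^-1` `[j%:R, j.+1%:R[%classic).
      by apply: (mz k) => //; exact: measurable_itv.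
    by apply/seteqP; split=> x /=; rewrite in_itv/= -truncn_eq//; move/eqP.
  have : {ae mu, forall x, forall j, Omega x -> phi x (q k j) = g j x}.
    by apply: ae_foralln => j; case: (Hg j).
  by apply: filterS => x H Ox; exact: H.
apply: aeD_imp cphi => x Ox cx.
suff c : (fun k => q k (T k x)) @ \oo --> y x by apply: cvg_comp c _; exact: cx.
apply/cvgrPdist_lt => e e0; near=> k.
have kg : `|y x| <= k%:R by near: k; exact: nbhs_infty_ger.
have ke : k.+1%:R^-1 < e.
  by near: k; exact: (near_infty_natSinv_lt (PosNum e0)).
have k1 : 0 < k.+1%:R :> R by [].
have zE : z k x = k.+1%:R * (y x + k%:R).
  apply/max_idPr; rewrite mulr_ge0//; move: kg; rewrite ler_norml => /andP[]; lra.
have := truncn_itv (z0 k x); rewrite -/(T k x) zE => /andP[h1 h2].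
apply: le_lt_trans ke.
rewrite -(ler_pM2l k1) mulfV ?gt_eqF// -[X in X * _](gtr0_norm k1) -normrM.
have -> : k.+1%:R * (y x - q k (T k x)) = k.+1%:R * (y x + k%:R) - (T k x)%:R.
  by rewrite /q; field; rewrite gt_eqF.
rewrite -natr1 in h2; rewrite ger0_norm; lra.
Unshelve. all: by end_near. Qed.

Lemma lebesgue_measurable_lin (a b : R) u v : lmeas u -> lmeas v ->
  lmeas (fun x => a * u x + b * v x).
Proof.
move=> [g mg ug] [h mh vh]; exists (fun x => a * g x + b * h x).
  by apply: measurable_funD; apply: measurable_funM.
by apply: aeD_imp2 ug vh => x _ -> ->.
Qed.

Lemma lebesgue_measurable_Bd u (C : R) : lmeas u -> ae_in (fun x => `|u x| <= C) ->
  exists2 g, Bd g & ae_in (fun x => u x = g x).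
Proof.
move=> [g mg ug] uC; exists g => //; split=> //; exists C.
by apply: aeD_imp2 ug uC => x _ ->.
Qed.

Section nonlinearity.
Variable phi : V -> R -> R.
Hypothesis hphi : nonlinearity_assumptions Omega phi.

Lemma nonlinearity_regular : ae_in (fun x =>
  (forall t, derivable (phi x) t 1) /\ (forall t, derivable (derive1 (phi x)) t 1)).
Proof.
have [_ H _ _] := hphi; apply: aeD_imp H => x _ [H _]; split=> t; first exact: (H 0%N).
by have := H 1%N isT t; rewrite derive1n1.
Qed.

(** The bounds at 0 spread to the second derivative by its Lipschitz continuity and to [phi] by
    Taylor's formula. The first derivative is then estimated by the increment of [phi] from t to t +
    1, hence the radius M + 1 and the constant 2 C0 + C2. *)
Lemma nonlinearity_bound (M : R) : 0 < M -> exists2 C : R, 0 < C & ae_in (fun x =>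
  forall t, `|t| <= M -> [/\ `|phi x t| <= C, `|derive1 (phi x) t| <= C &
    `|derive1n 2 (phi x) t| <= C]).
Proof.
move=> M0; have M1 : 0 < M + 1 by rewrite ltr_wpDr.
have [_ _ [K K0 HK] HL] := hphi; have [L L0 HLM] := HL _ M1.
pose C2 := K + L * (M + 1); pose C0 := K + K * (M + 1) + C2 * (M + 1) ^+ 2.
have C20 : 0 < C2 by rewrite addr_gt0// mulr_gt0.
have C00 : 0 < C0 by rewrite addr_gt0 ?addr_gt0 ?mulr_gt0 ?exprn_gt0.
exists (2 * C0 + C2) => [|]; first by rewrite addr_gt0// mulr_gt0.
have K1 := HK 0%N isT; have K2 := HK 1%N isT; have K3 := HK 2%N isT.
apply: aeD_imp3 (aeD_imp3 (fun x _ h1 h2 h3 => conj h1 (conj h2 h3)) K1 K2 K3)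
  nonlinearity_regular HLM => x _ [k1 [k2 k3]] [d1 d2] hL.
rewrite derive1n0 in k1; rewrite derive1n1 in k2.
have b2 t : `|t| <= M + 1 -> `|derive1n 2 (phi x) t| <= C2.
  move=> tM; have := hL t 0 tM; rewrite normr0 subr0 => /(_ (ltW M1)) H.
  move: H k3; move: (derive1n 2 _ _) (derive1n 2 _ _) => p q pq q2.
  have := ler_normD (q - p) p; rewrite subrK; have := ler_wpM2l (ltW L0) tM.
  by rewrite /C2; move: (`|p|) (`|q|) (`|t|) (`|q - p|) pq q2 => p' q' t' r' *; lra.
have b0 t : `|t| <= M + 1 -> `|phi x t| <= C0.
  move=> tM; have : `|phi x (0 + t) - phi x 0 - derive1 (phi x) 0 * t| <= C2 * t ^+ 2.
    by apply: taylor2_le => // s; rewrite subr0 => st; apply: b2; exact: le_trans tM.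
  rewrite add0r; move: k1 k2; move: (phi x t) (phi x 0) (derive1 _ _) => p c e cK eK pce.
  have := ler_normD (p - c - e * t + c) (e * t); have := ler_normD (p - c - e * t) c.
  have -> : p - c - e * t + c + e * t = p by ring.
  have et : `|e * t| <= K * (M + 1) by rewrite normrM ler_pM.
  have tt : t ^+ 2 <= (M + 1) ^+ 2 by rewrite -[t ^+ 2]real_normK ?num_real// ler_sqr ?nnegrE// ltW.
  have := ler_wpM2l (ltW C20) tt; rewrite /C0.
  move: (`|p|) (`|c|) (`|e * t|) (`|p - c - e * t|) (`|_|) cK et pce => *; lra.
move=> t tM; have tM1 : `|t| <= M + 1 by lra.
have bt := b0 t tM1; split; last 1 first.
- by apply: le_trans (b2 t tM1) _; clear - C20 C00; lra.
- by apply: le_trans bt _; clear - C20 C00; lra.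

have t1M : `|t + 1| <= M + 1 by rewrite (le_trans (ler_normD _ _))// normr1 lerD2r.
have bt1 := b0 _ t1M.
have : `|phi x (t + 1) - phi x t - derive1 (phi x) t * 1| <= C2 * 1 ^+ 2.
  apply: taylor2_le => // s; rewrite normr1 => st; apply: b2.
  by rewrite -(subrK t s) (le_trans (ler_normD _ _))//; lra.
rewrite expr1n !mulr1; move: bt bt1; move: (phi x (t + 1)) => q; move: (phi x t) (derive1 _ _) =>
  p e bt bt1.
have := ler_normD (q - p - e) (p - q); rewrite (_ : q - p - e + (p - q) = - e); last by ring.
rewrite normrN; have := ler_normB p q.
move: (`|p|) (`|q|) (`|e|) (`|q - p - e|) (`|p - q|) bt bt1 => *; lra.
Qed.

Lemma nonlinearity_Bd y : Bd y -> exists2 g, Bd g & ae_in (fun x => phi x (y x) = g x).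
Proof.
move=> [my [M HM]]; have M0 : 0 < `|M| + 1 by rewrite ltr_wpDl.
have [C _ HC] := nonlinearity_bound M0; apply: (@lebesgue_measurable_Bd _ C).
  have [mphi _ _ _] := hphi; apply: lebesgue_measurable_comp => //.
  by apply: aeD_imp nonlinearity_regular => x _ [d1 _]; exact: derivable1_continuous.
apply: aeD_imp2 HM HC => x _ yM H; have [] := H (y x) _ => //.
by have := ler_norm M; lra.
Qed.

(** Measurability of the derivative comes from difference quotients with step 1/(k+1), each a
    combination of two superpositions already known to be measurable. *)
Lemma nonlinearity_derive1_Bd y : Bd y ->
  exists2 g, Bd g & ae_in (fun x => derive1 (phi x) (y x) = g x).
Proof.
move=> [my [M HM]]; have M0 : 0 < `|M| + 2 by rewrite ltr_wpDl.
have [C C0 HC] := nonlinearity_bound M0; apply: (@lebesgue_measurable_Bd _ C); last first.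
  apply: aeD_imp2 HM HC => x _ yM H; have [] := H (y x) _ => //.
  by have := ler_norm M; lra.
pose F k x := k.+1%:R * phi x (y x + k.+1%:R^-1) + - k.+1%:R * phi x (y x).
apply: (@lebesgue_measurable_lim F) => [k|].
  have [mphi _ _ _] := hphi.
  have cphi : ae_in (fun x => continuous (phi x)).
    by apply: aeD_imp nonlinearity_regular => x _ [d1 _]; exact: derivable1_continuous.
  by apply: lebesgue_measurable_lin; apply: lebesgue_measurable_comp => //; exact: measurable_funD.
apply: aeD_imp3 HM HC nonlinearity_regular => x _ yM H [d1 d2].
apply/cvgrPdist_lt => e e0; near=> k.
have k1 : 0 < k.+1%:R^-1 :> R by rewrite invr_gt0.
have kle : k.+1%:R^-1 <= 1 :> R by rewrite invf_le1// ler1n.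
have ke : k.+1%:R^-1 < e / C.
  by near: k; exact: (near_infty_natSinv_lt (PosNum (divr_gt0 e0 C0))).
have : `|phi x (y x + k.+1%:R^-1) - phi x (y x) - derive1 (phi x) (y x) * k.+1%:R^-1| <=
    C * k.+1%:R^-1 ^+ 2.
  apply: taylor2_le => // s; rewrite (gtr0_norm k1) => st.
  have [] // := H s _; rewrite -(subrK (y x) s) (le_trans (ler_normD _ _))//.
  by apply: le_trans (lerD (le_trans st kle) yM) _; rewrite addrC lerD ?ler_norm ?ler1n.
rewrite ltr_pdivlMr// in ke.
have -> : F k x = (k.+1%:R^-1)^-1 * (phi x (y x + k.+1%:R^-1) - phi x (y x)).
  by rewrite /F invrK mulrBr mulNr.
move: (k.+1%:R^-1) k1 ke => h h0 hC.
move: (phi x (y x + h)) => q; move: (phi x (y x)) (derive1 _ _) => p d pqd.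
apply: le_lt_trans hC; rewrite -(ler_pM2r h0) -mulrA mulrCA -expr2.
apply: le_trans pqd.
rewrite -[X in _ * X](gtr0_norm h0) -normrM distrC.
by rewrite mulrBl mulrAC mulVf ?gt_eqF// mul1r.
Unshelve. all: by end_near. Qed.

End nonlinearity.
End superposition.

(** * Expansions of the cost *)

Lemma linear_quadratic_ge0 (R : realFieldType) (l C r : R) : 0 < r ->
  (forall t, `|t| <= r -> 0 <= t * l + C * t ^+ 2) -> l = 0.
Proof.
move=> r0 H; apply/eqP; rewrite -sqrf_eq0 eq_le sqr_ge0 andbT leNgt; apply/negP => l0.
(* At t = -s l the hypothesis reads s l^2 (C s - 1) >= 0, while this [s] ensures both |s l| <= r and
   C s < 1. *)
pose s := r / (`|l| + `|C| * r + 1).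
have k0 : 0 < `|l| + `|C| * r + 1 by rewrite ltr_wpDl// addr_ge0// mulr_ge0// ltW.
have s0 : 0 < s by rewrite divr_gt0.
have sk : s * (`|l| + `|C| * r + 1) = r by rewrite divfK// gt_eqF.
have sl : `|- s * l| <= r.
  rewrite normrM normrN (gtr0_norm s0) -[leRHS]sk ler_wpM2l ?(ltW s0)// -addrA lerDl.
  by rewrite addr_ge0// mulr_ge0// ltW.
have := H _ sl; rewrite (_ : _ + _ = s * l ^+ 2 * (C * s - 1)); last by ring.
have sl2 : 0 < s * l ^+ 2 by rewrite mulr_gt0.
rewrite (pmulr_rge0 _ sl2) subr_ge0 leNgt => /negP; apply.
rewrite -(ltr_pM2r k0) mul1r -mulrA sk.
have := ler_norm C; have := normr_ge0 l; have := ler_wpM2r (ltW r0) (ler_norm C); lra.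
Qed.

Section cutoff.
Context {R : realType}.
Variables (eps : R) (theta : R -> R).
Hypotheses (eps0 : 0 < eps) (htheta : cutoff_function eps theta).

Lemma cutoff_derivable t : derivable theta t 1.
Proof. by have [[H _] _ _ _ _] := htheta; have := H 0%N isT t. Qed.

Lemma cutoff_derivable1 t : derivable (derive1 theta) t 1.
Proof. by have [[H _] _ _ _ _] := htheta; have := H 1%N isT t; rewrite derive1n1. Qed.

Lemma cutoff_ge0 t : 0 <= theta t.
Proof.
have [_ mono _ [_ tz] _] := htheta.
have st : Num.min t (- eps - 1) <= t by rewrite ge_min lexx.
by rewrite -(tz (Num.min t (- eps - 1))) ?mono// gt_min; apply/orP; right; lra.
Qed.

Lemma cutoff_diff_le s t : `|theta t - theta s| <= `|t - s|.
Proof.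
have [_ _ _ _ H] := htheta; have [c _ ->] := mean_value s t cutoff_derivable.
have /andP[c0 c1] := H c.
by rewrite normrM (ger0_norm c0) ler_piMl.
Qed.

Lemma cutoff_derive2_eq0 t : eps < `|t| -> derive1n 2 theta t = 0.
Proof.
have [_ _ _ [t1 t2] _] := htheta.
have D (g : R -> R) (c : R) (O : set R) : open O -> (forall s, O s -> g s = c) ->
    forall s, O s -> derive1 g s = 0.
  move=> oO gc s Os; rewrite derive1E (@near_eq_derive _ _ _ g (cst c)) ?derive_cst//.
  have : nbhs s O by exact: open_nbhs_nbhs.
  by apply: filterS => r /gc.
rewrite derive1nS derive1n1.
move=> et; have [t0|t0] := leP 0 t.
- rewrite ger0_norm// in et.
  apply: (D _ 1 [set s | eps < s]) => //.
  move=> s es; rewrite derive1E (@near_eq_derive _ _ _ theta id).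
  + by rewrite derive_id.
  + have : nbhs s [set s | eps < s] by apply: open_nbhs_nbhs; split=> //; exact: open_gt.
    by apply: filterS => r /t1.
- rewrite ltr0_norm// in et.
  apply: (D _ 0 [set s | s < - eps]) => //.
    exact: (D _ 0 [set s | s < - eps]).
  by rewrite /= ltrNr.
Qed.

(** The second derivative of [theta] is continuous and vanishes outside [-eps, eps], hence is
    bounded on the whole line; the remainder is therefore uniform in [a]. *)
Lemma cutoff_taylor : exists2 C : R, 0 < C & forall a h,
  `|theta (a + h) - theta a - derive1 theta a * h| <= C * h ^+ 2.
Proof.
have [[H _] _ _ _ _] := htheta.
have c2 : continuous (derive1n 2 theta) by apply: derivable1_continuous => t; exact: (H 2%N).
have e2 : - eps <= eps by rewrite -subr_ge0 opprK addr_ge0 ?ltW.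
have [c1 _ M1] := @EVT_max R (derive1n 2 theta) _ _ e2 (continuous_subspaceT c2).
have [c3 _ M2] := @EVT_min R (derive1n 2 theta) _ _ e2 (continuous_subspaceT c2).
pose C := `|derive1n 2 theta c1| + `|derive1n 2 theta c3| + 1.
have C0 : 0 < C by rewrite ltr_wpDl// addr_ge0.
exists C => // a h; apply: taylor2_le; [exact: cutoff_derivable|exact: cutoff_derivable1|].
move=> t _; have [te|te] := leP `|t| eps; last by rewrite cutoff_derive2_eq0// normr0 ltW.
have ti : t \in `[- eps, eps] by rewrite in_itv/= -ler_norml.
have h1 := M1 _ ti; have h2 := M2 _ ti.
rewrite /C; move: (derive1n 2 theta t) (derive1n 2 theta c1) (derive1n 2 theta c3) h1 h2.
move=> p q r pq rp; have := ler_norm q; have := ler_norm (- r); rewrite normrN.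
by have := normr_ge0 q; have := normr_ge0 r; rewrite ler_norml => *; apply/andP; split; lra.
Qed.

End cutoff.

Lemma pos_ge0 (R : realType) (a : R) : 0 <= pos a.
Proof. by rewrite /pos le_max lexx. Qed.

Lemma pos_le_norm (R : realType) (a : R) : `|pos a| <= `|a|.
Proof. by rewrite ger0_norm ?pos_ge0// /pos ge_max normr_ge0 ler_norm. Qed.

(** The right-hand side is (pos a + h)^2, and 0 <= a + h <= pos a + h whenever the left-hand side is
    not 0. *)
Lemma pos_sqr_le (R : realType) (a h : R) :
  pos (a + h) ^+ 2 <= pos a ^+ 2 + 2 * pos a * h + h ^+ 2.
Proof.
rewrite (_ : pos a ^+ 2 + 2 * pos a * h + h ^+ 2 = (pos a + h) ^+ 2); last by ring.
rewrite /pos /Num.max; case: ltP => h1; last by rewrite expr0n sqr_ge0.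
case: ltP => h2; first by [].
rewrite add0r; nra.
Qed.

Section expansions.
Context {R : realType} {n : nat}.
Local Notation V := 'rV[R]_n.
Local Notation mu := (lebesgue_rV R n).
Variable Omega : set V.
Hypotheses (oO : open Omega) (bO : bounded_set Omega).
Local Notation I1 := (I1 mu Omega).
Local Notation Bd := (Bd mu Omega).
Local Notation L2f := (L2f mu Omega).
Local Notation ae_in := (ae_in Omega).
Local Notation E := (dirichlet Omega).

Let mO : measurable Omega := measurable_domain oO.
Let Ooo : (mu Omega < +oo)%E := domain_lty oO bO.

Lemma L2f_le (f g : V -> R) : measurable_fun Omega f -> ae_in (fun x => `|f x| <= `|g x|) ->
  L2f g -> L2f f.
Proof.
move=> mf fg [_ Ig]; split=> //; apply: I1_le Ig; first exact: measurable_funX.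
apply: aeD_imp fg => x _ fg; rewrite ger0_norm ?sqr_ge0//.
by rewrite -[f x ^+ 2]real_normK ?num_real// -[g x ^+ 2]real_normK ?num_real// ler_sqr ?nnegrE.
Qed.

Lemma pos_L2f f : L2f f -> L2f (fun x => pos (f x)).
Proof.
move=> Lf; apply: L2f_le (Lf); last by apply: aeD_W => x _; exact: pos_le_norm.
by apply: measurable_maxr; [exact: measurable_cst|case: Lf].
Qed.

Section nemytskii.
Variable phi : V -> R -> R.
Hypothesis hphi : nonlinearity_assumptions Omega phi.

Lemma nonlinear_cost_expansion (M : R) : 0 < M -> exists2 C : R, 0 < C &
  forall y y' g, Bd y -> Bd y' -> Bd g -> ae_in (fun x => `|y x| <= M) ->
  ae_in (fun x => `|y' x| <= M) -> ae_in (fun x => derive1 (phi x) (y x) = g x) ->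
  \int[mu]_(x in Omega) phi x (y' x) <= \int[mu]_(x in Omega) phi x (y x) +
    \int[mu]_(x in Omega) (g x * (y' x - y x)) + C * L2normsq Omega (fun x => y' x - y x).
Proof.
(* A point at distance at most |y' - y| <= 2 M from [y] has modulus at most 3 M. *)
move=> M0; have M3 : 0 < 3 * M by rewrite mulr_gt0.
have [C C0 HC] := nonlinearity_bound hphi M3; exists C => // y y' g By By' Bg yM yM' phig.
have [G BG HG] := nonlinearity_Bd mO hphi By; have [G' BG' HG'] := nonlinearity_Bd mO hphi By'.
rewrite (Rint_ae_eq HG) (Rint_ae_eq HG').
have Id : I1 (fun x => (y' x - y x) ^+ 2) by apply: Bd_I1 => //; integ.
rewrite -[X in X + _ + _]mul1r -[X in _ + X + _]mul1r -(@Rint_lin3 _ _ _ mu Omega mO 1 1 C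
  (fun x => G x + g x * (y' x - y x) + C * (y' x - y x) ^+ 2) G
  (fun x => g x * (y' x - y x))) => [|//||//|]; last 3 first.
- exact: Bd_I1.
- by apply: Bd_I1 => //; integ.
- by apply: aeD_W => x _; rewrite !mul1r.
apply: le_Rint_ae => //.
- exact: Bd_I1.
- have I2 : I1 G by exact: Bd_I1.
  have I3 : I1 (fun x => g x * (y' x - y x)) by apply: Bd_I1 => //; integ.
  integ.
have reg := nonlinearity_regular hphi.
apply: aeD_imp3 (aeD_imp3 (fun x _ h1 h2 h3 => conj h1 (conj h2 h3)) HG HG' phig)
  (aeD_imp2 (fun x _ h1 h2 => conj h1 h2) yM yM')
  (aeD_imp2 (fun x _ h1 h2 => conj h1 h2) HC reg).
move=> x _ [<- [<- <-]] [h1 h2] [h3 [d1 d2]].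
have : `|phi x (y x + (y' x - y x)) - phi x (y x) - derive1 (phi x) (y x) * (y' x - y x)| <=
    C * (y' x - y x) ^+ 2.
  apply: taylor2_le => // s st; have [] // := h3 s _.
  rewrite -(subrK (y x) s) (le_trans (ler_normD _ _))//.
  have := ler_normB (y' x) (y x); move: (`|y x|) (`|y' x|) h1 h2 (`|y' x - y x|) (`|s - y x|) st.
  by move=> *; lra.
rewrite subrKC ler_norml => /andP[_]; move: (phi x (y' x)) => q.
by move: (phi x (y x)) (derive1 _ _) => p d; lra.
Qed.

End nemytskii.

Lemma H1norm_sqr_lin u v t : H1 Omega u -> H1 Omega v ->
  H1norm Omega (fun x => 1 * u x + t * v x) ^+ 2 = H1norm Omega u ^+ 2 +
    2 * t * (E u v + \int[mu]_(x in Omega) (u x * v x)) + t ^+ 2 * H1norm Omega v ^+ 2.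
Proof.
move=> Hu Hv; have Lu := H1_L2f oO Hu; have Lv := H1_L2f oO Hv.
have e1 := L2normsq_lin oO 1 t Lu Lv; have e2 := dirichlet_sqr_lin oO bO t Hu Hv.
apply: etrans (H1norm_sqr Omega _) _; rewrite /h1sq e1 e2.
have := H1norm_sqr Omega u; have := H1norm_sqr Omega v; rewrite /h1sq.
move: (H1norm Omega u) (H1norm Omega v) => nu nv -> ->.
move: (L2normsq Omega u) (L2normsq Omega v) (E u u) (E v v) => a1 a2 a3 a4.
move: (E u v) (\int[mu]_(x in Omega) (u x * v x)) => a5 a6; ring.
Qed.

Definition penalty (ua ub u : V -> R) : R :=
  \int[mu]_(x in Omega) (pos (ua x - u x) ^+ 2 + pos (u x - ub x) ^+ 2).

Lemma penalty_lin_le ua ub u v t : L2f ua -> L2f ub -> L2f u -> L2f v ->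
  penalty ua ub (fun x => 1 * u x + t * v x) <= penalty ua ub u -
    2 * t * \int[mu]_(x in Omega) ((pos (ua x - u x) - pos (u x - ub x)) * v x) +
    2 * t ^+ 2 * L2normsq Omega v.
Proof.
move=> Lua Lub Lu Lv.
have La : L2f (fun x => pos (ua x - u x)) by apply: pos_L2f; integ.
have Lb : L2f (fun x => pos (u x - ub x)) by apply: pos_L2f; integ.
have Lat : L2f (fun x => pos (ua x - (1 * u x + t * v x))) by apply: pos_L2f; integ.
have Lbt : L2f (fun x => pos (1 * u x + t * v x - ub x)) by apply: pos_L2f; integ.
have Ia : I1 (fun x => pos (ua x - u x) ^+ 2) by case: La.
have Ib : I1 (fun x => pos (u x - ub x) ^+ 2) by case: Lb.
have Iat : I1 (fun x => pos (ua x - (1 * u x + t * v x)) ^+ 2) by case: Lat.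
have Ibt : I1 (fun x => pos (1 * u x + t * v x - ub x) ^+ 2) by case: Lbt.
have Iv : I1 (fun x => v x ^+ 2) by case: Lv.
have e := @Rint_lin3 _ _ _ mu Omega mO 1 (- (2 * t)) (2 * t ^+ 2)
    (fun x => 1 * (pos (ua x - u x) ^+ 2 + pos (u x - ub x) ^+ 2) +
      (- (2 * t)) * ((pos (ua x - u x) - pos (u x - ub x)) * v x) + 2 * t ^+ 2 * v x ^+ 2)
    (fun x => pos (ua x - u x) ^+ 2 + pos (u x - ub x) ^+ 2)
    (fun x => (pos (ua x - u x) - pos (u x - ub x)) * v x) (fun x => v x ^+ 2).
rewrite mul1r in e; rewrite -mulNr -[L2normsq _ _]/(\int[mu]_(x in Omega) v x ^+ 2).
rewrite -[penalty ua ub u]/(\int[mu]_(x in Omega) (pos (ua x - u x) ^+ 2 + pos (u x - ub x) ^+ 2)).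
rewrite -{}e; try integ; last exact: aeD_W.
apply: le_Rint_ae; try integ => //.
apply: aeD_W => x _.
have := pos_sqr_le (ua x - u x) (- (t * v x)); have := pos_sqr_le (u x - ub x) (t * v x).
rewrite (_ : ua x - u x + - (t * v x) = ua x - (1 * u x + t * v x)); last by ring.
rewrite (_ : u x - ub x + t * v x = 1 * u x + t * v x - ub x); last by ring.
move: (pos (ua x - u x)) (pos (u x - ub x)) => p q.
move: (pos (ua x - _)) => r; move: (pos (_ - ub x)) => s; move: (v x) => z; lra.
Qed.

End expansions.

(** * The Kirchhoff equation *)

Section kirchhoff.
Context {R : realType} {n : nat}.
Local Notation V := 'rV[R]_n.
Local Notation mu := (lebesgue_rV R n).
Variable Omega : set V.
Hypotheses (oO : open Omega) (bO : bounded_set Omega).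
Variable i0 : 'I_n.
Local Notation I1 := (I1 mu Omega).
Local Notation Bd := (Bd mu Omega).
Local Notation L2f := (L2f mu Omega).
Local Notation ae_in := (ae_in Omega).
Local Notation test := (test_function Omega).
Local Notation E := (dirichlet Omega).
Local Notation weak_sol := (weak_sol Omega).

Let mO : measurable Omega := measurable_domain oO.
Let Ooo : (mu Omega < +oo)%E := domain_lty oO bO.

Variables (f b ua : V -> R) (f0 u0 b0 : R) (S : (V -> R) -> (V -> R)).
Hypotheses (Bf : Bd f) (f00 : 0 < f0) (ff0 : ae_in (fun x => f0 <= f x)).
Hypotheses (Bb : Bd b) (b00 : 0 < b0) (bb0 : ae_in (fun x => b0 <= b x)).
Hypotheses (Bua : Bd ua) (u00 : 0 < u0) (uu0 : ae_in (fun x => u0 <= ua x)).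
Hypothesis hS : control_to_state_map Omega f b ua S.

Implicit Types (w y v : V -> R) (m t s : R).

(** The controls about which the hypothesis on [S] says something. *)
Definition admissible w := L2f w /\ ae_in (fun x => ua x <= w x).

Definition denom w m : V -> R := fun x => w x + b x * m.

Definition state_rhs w m : V -> R := fun x => f x / denom w m x.

Lemma denom_ge w m : admissible w -> 0 <= m -> ae_in (fun x => u0 <= denom w m x).
Proof.
move=> [_ uw] m0; apply: aeD_imp3 uw uu0 bb0 => x _ h1 h2 h3; rewrite /denom.
have : 0 <= b x * m by rewrite mulr_ge0// (le_trans (ltW b00)).
lra.
Qed.

Lemma denomV_Bd w m : admissible w -> 0 <= m -> Bd (fun x => (denom w m x)^-1).
Proof.
move=> aw m0; apply: (BdV u00 _ (denom_ge aw m0)).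
apply: measurable_funD; first by case: aw => -[].
by apply: measurable_funM => //; case: Bb.
Qed.

Lemma state_rhs_Bd w m : admissible w -> 0 <= m -> Bd (state_rhs w m).
Proof. by move=> aw m0; apply: BdM => //; exact: denomV_Bd. Qed.

Lemma f_bound : exists2 F : R, 0 < F & ae_in (fun x => f x <= F).
Proof.
have [_ [F HF]] := Bf; exists (`|F| + 1) => //.
apply: aeD_imp HF => x _ HF; have := ler_norm (f x); have := ler_norm F; lra.
Qed.

(** The bound depends neither on the control nor on the energy; this makes the bounds on states and
    energies uniform. *)
Lemma state_rhs_bound : exists2 G : R, 0 < G & forall w m, admissible w -> 0 <= m ->
  ae_in (fun x => 0 <= state_rhs w m x <= G).
Proof.
have [F F0 HF] := f_bound; exists (F / u0) => [|w m aw m0]; first by rewrite divr_gt0.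
apply: aeD_imp3 HF ff0 (denom_ge aw m0) => x _ h1 h2 h3; rewrite /state_rhs.
have f1 := lt_le_trans f00 h2; have d0 := lt_le_trans u00 h3.
apply/andP; split; first by rewrite divr_ge0// ltW.
by apply: ler_pM => //; rewrite ?invr_ge0 ?lef_pV2 ?posrE// ltW.
Qed.

(** With the energy frozen, the Kirchhoff equation is a linear Poisson equation with bounded
    right-hand side. *)
Lemma kirchhoffP w y : admissible w ->
  kirchhoff_state Omega f b w y <-> H10 Omega y /\ weak_sol y (state_rhs w (E y y)).
Proof.
move=> aw; have e0 := dirichlet_ge0 Omega y.
have rE v : \int[mu]_(x in Omega) (state_rhs w (E y y) x * v x) =
    \int[mu]_(x in Omega) (f x * v x / (w x + b x * gradnormsq Omega y)).
  by rewrite gradnormsqE; apply: eq_Rintegral => x _; exact: mulrAC.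
have Lr := Bd_L2f mO Ooo (state_rhs_Bd aw e0).
split=> -[Hy Ey]; have [Hy1 _] := Hy.
  split=> //; apply/(weak_solP oO bO Hy1 Lr) => v Hv.
  by rewrite rE dirichletE; exact: Ey.
split=> // v Hv; move/(weak_solP oO bO Hy1 Lr)/(_ _ Hv): Ey.
by rewrite rE dirichletE.
Qed.

(** * Sign and uniform bounds of the states *)

Section state.
Variables (w y : V -> R).
Hypotheses (aw : admissible w) (Ky : kirchhoff_state Omega f b w y).

Lemma state_H10 : H10 Omega y. Proof. by case: Ky. Qed.

Lemma state_H1 : H1 Omega y. Proof. by case: state_H10. Qed.

Lemma state_weak_sol : weak_sol y (state_rhs w (E y y)).
Proof. by have /(kirchhoffP _ aw)[] := Ky. Qed.

Lemma state_eq v : H10 Omega v ->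
  E y v = \int[mu]_(x in Omega) (state_rhs w (E y y) x * v x).
Proof.
move=> Hv; move: v Hv; apply/(weak_solP oO bO state_H1); last exact: state_weak_sol.
by apply: Bd_L2f => //; apply: state_rhs_Bd => //; exact: dirichlet_ge0.
Qed.

Lemma state_ge0 : ae_in (fun x => 0 <= y x).
Proof.
have [G _ HG] := state_rhs_bound.
apply: (weak_sol_ge0 oO bO i0 state_H10) state_weak_sol _.
  by apply: Bd_L2f => //; apply: state_rhs_Bd => //; exact: dirichlet_ge0.
by apply: aeD_imp (HG _ _ aw (dirichlet_ge0 Omega y)) => x _ /andP[].
Qed.

End state.

Lemma state_bound : exists2 M : R, 0 < M & forall w y, admissible w ->
  kirchhoff_state Omega f b w y -> ae_in (fun x => `|y x| <= M).
Proof.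
have [G G0 HG] := state_rhs_bound; have [B B0 HB] := weak_sol_bounded oO bO i0.
exists (G * B) => [|w y aw Ky]; first by rewrite mulr_gt0.
apply: (HB _ _ _ G0 (state_H10 Ky)) (state_weak_sol aw Ky) _.
  by apply: Bd_L2f => //; apply: state_rhs_Bd => //; exact: dirichlet_ge0.
by apply: aeD_imp (HG _ _ aw (dirichlet_ge0 Omega y)) => x _ /andP[h1 h2]; rewrite ger0_norm.
Qed.

Lemma state_Bd w y : admissible w -> kirchhoff_state Omega f b w y -> Bd y.
Proof.
move=> aw Ky; have [M _ HM] := state_bound; split; last by exists M; exact: HM Ky.
by case: (H1_L2f oO (state_H1 Ky)).
Qed.

Lemma state_energy_bound : exists2 T : R, 0 < T & forall w y, admissible w ->
  kirchhoff_state Omega f b w y -> E y y <= T.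
Proof.
have [G G0 HG] := state_rhs_bound; have [M M0 HM] := state_bound.
exists (G * M * fine (mu Omega) + 1) => [|w y aw Ky].
  apply: ltr_wpDl => //; apply: mulr_ge0; last exact: fine_ge0.
  by rewrite mulr_ge0// ltW.
rewrite (state_eq aw Ky (state_H10 Ky)) -(@Rintegral_cst _ _ _ mu _ mO (G * M)).
apply: ler_wpDr => //; apply: le_Rint_ae => //.
- apply: Bd_I1 => //; apply: BdM => //; last exact: state_Bd Ky.
  by apply: state_rhs_Bd => //; exact: dirichlet_ge0.
- by apply: Bd_I1 => //; exact: Bd_cst.
- apply: aeD_imp3 (HG _ _ aw (dirichlet_ge0 Omega y)) (HM _ _ aw Ky) (state_ge0 aw Ky).
  by move=> x _ /andP[h1 h2] h3 h4; rewrite ler_pM// -[y x]ger0_norm.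
Qed.

(** The factor of D2 - D1 in (f / D1 - f / D2) (y1 + y2), where D1 and D2 are the two
    denominators. *)
Definition secant_weight w1 y1 w2 y2 : V -> R := fun x => f x * (y1 x + y2 x) *
  ((denom w1 (E y1 y1) x)^-1 * (denom w2 (E y2 y2) x)^-1).

(* Test the equation of each state with [y1 + y2] and subtract. *)
Lemma two_states w1 w2 y1 y2 : admissible w1 -> admissible w2 ->
  kirchhoff_state Omega f b w1 y1 -> kirchhoff_state Omega f b w2 y2 ->
  let k := secant_weight w1 y1 w2 y2 in
  [/\ Bd k, ae_in (fun x => 0 <= k x) &
  (E y1 y1 - E y2 y2) * (1 + \int[mu]_(x in Omega) (k x * b x)) =
  - \int[mu]_(x in Omega) (k x * (w1 x - w2 x))].
Proof.
move=> aw1 aw2 K1 K2 k.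
have Hy1 := state_H10 K1; have Hy2 := state_H10 K2.
have B1 := state_Bd aw1 K1; have B2 := state_Bd aw2 K2.
have D1 := denomV_Bd aw1 (dirichlet_ge0 Omega y1).
have D2 := denomV_Bd aw2 (dirichlet_ge0 Omega y2).
have d1 := denom_ge aw1 (dirichlet_ge0 Omega y1).
have d2 := denom_ge aw2 (dirichlet_ge0 Omega y2).
have Bk : Bd k by rewrite /k /secant_weight; integ.
have [[Lw1 _] [Lw2 _]] := (aw1, aw2).
split=> //.
  have y1_0 := state_ge0 aw1 K1; have y2_0 := state_ge0 aw2 K2.
  apply: aeD_imp3 y1_0 y2_0 (aeD_imp3 (fun x _ h1 h2 h3 => conj h1 (conj h2 h3)) ff0 d1 d2).
  move=> x _ h1 h2 [h3 [h4 h5]]; rewrite /k /secant_weight.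
  have f1 := lt_le_trans f00 h3; have e1 := lt_le_trans u00 h4; have e2 := lt_le_trans u00 h5.
  apply: mulr_ge0; first by rewrite mulr_ge0 ?addr_ge0// ltW.
  by rewrite mulr_ge0// invr_ge0 ltW.
have Hs : H10 Omega (fun x => 1 * y1 x + 1 * y2 x) by exact: H10_lin.
have [H11 _] := Hy1; have [H21 _] := Hy2; have [Hs1 _] := Hs.
(* The mixed terms cancel by symmetry; this is what the sum as common test function is for. *)
have Em : E y1 y1 - E y2 y2 = E y1 (fun x => 1 * y1 x + 1 * y2 x) -
    E y2 (fun x => 1 * y1 x + 1 * y2 x).
  have D z : H1 Omega z -> E z (fun x => 1 * y1 x + 1 * y2 x) = E z y1 + E z y2.
    by move=> Hz; rewrite dirichletC dirichlet_lin// !mul1r !(dirichletC _ z).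
  rewrite !D// (dirichletC _ y2 y1); move: (E y1 y1) (E y2 y2) (E y1 y2) => p q r; ring.
(* The denominators differ by w1 - w2 plus [b] times the energy difference, which thus occurs on
   both sides; collecting it produces the factor 1 plus the integral of [k b]. *)
have Eq : E y1 y1 - E y2 y2 = (-1) * \int[mu]_(x in Omega) (k x * (w1 x - w2 x)) +
    (- (E y1 y1 - E y2 y2)) * \int[mu]_(x in Omega) (k x * b x).
  rewrite -(@Rint_lin2 _ _ _ mu Omega mO _ _ (fun x =>
    1 * (state_rhs w1 (E y1 y1) x * (1 * y1 x + 1 * y2 x)) +
    (-1) * (state_rhs w2 (E y2 y2) x * (1 * y1 x + 1 * y2 x)))); last 3 first.
  - by integ.
  - by apply: Bd_I1 => //; integ.
  - apply: aeD_imp2 d1 d2 => x _ h1 h2; rewrite /state_rhs /k /secant_weight.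
    have := lt_le_trans u00 h1; have := lt_le_trans u00 h2; rewrite /denom.
    move: (E y1 y1) (E y2 y2) => m1 m2 e2 e1.
    by field; rewrite !gt_eqF.
  rewrite {1}Em (state_eq aw1 K1 Hs) (state_eq aw2 K2 Hs).
  rewrite (@Rint_lin2 _ _ _ mu Omega mO 1 (-1) (fun x => 1 * (_ * _) + (-1) * _)
    (fun x => state_rhs w1 (E y1 y1) x * (1 * y1 x + 1 * y2 x))
    (fun x => state_rhs w2 (E y2 y2) x * (1 * y1 x + 1 * y2 x))).
  - by rewrite mul1r mulN1r.
  - have := state_rhs_Bd aw1 (dirichlet_ge0 Omega y1) => ?; apply: Bd_I1 => //; integ.
  - have := state_rhs_Bd aw2 (dirichlet_ge0 Omega y2) => ?; apply: Bd_I1 => //; integ.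
  - exact: aeD_W.
move: Eq; move: (\int[mu]_(x in _) (k x * b x)) => t.
move: (\int[mu]_(x in _) _) => t'; move: (E y1 y1 - _) => z; lra.
Qed.

(** Here the controls differ by b (s - t), so the energy difference is (t - s) B / (1 + B) with B >=
    0 the integral of [k b]. *)
Lemma energy_lipschitz w0 t s yt ys :
  admissible (fun x => w0 x - b x * t) -> admissible (fun x => w0 x - b x * s) ->
  kirchhoff_state Omega f b (fun x => w0 x - b x * t) yt ->
  kirchhoff_state Omega f b (fun x => w0 x - b x * s) ys ->
  `|E yt yt - E ys ys| <= `|t - s|.
Proof.
move=> at_ as_ Kt Ks; have [Bk k0 H] := two_states at_ as_ Kt Ks.
set k := secant_weight _ _ _ _ in Bk k0 H.
have e : \int[mu]_(x in Omega) (k x * (w0 x - b x * t - (w0 x - b x * s))) =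
    (s - t) * \int[mu]_(x in Omega) (k x * b x).
  rewrite -RintegralZl//; last by apply: Bd_I1 => //; exact: BdM.
  by apply: eq_Rintegral => x _; ring.
have I0 : 0 <= \int[mu]_(x in Omega) (k x * b x).
  apply: Rint_ge0_ae => //; apply: aeD_imp2 k0 bb0 => x _ h1 h2.
  by rewrite mulr_ge0// (le_trans (ltW b00)).
move: H; rewrite {}e; move: (\int[mu]_(x in _) _) I0 (E yt yt - E ys ys) => B B0 m mB.
have B1 : 0 < 1 + B by lra.
rewrite -(ler_pM2r B1) -{1}[1 + B]gtr0_norm// -normrM mB -mulNr opprB normrM (ger0_norm B0).
by rewrite ler_wpM2l//; lra.
Qed.

(* With [w_t = h^-1 f - b t], the energies of the states [S w_t] form a
   nonexpansive map of [t] into a bounded interval, so that [t] can be chosen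
   equal to the energy; then [f / (w_t + b t) = h]. *)
Lemma poisson_near_constant : exists2 d : R, 0 < d & forall h, measurable_fun Omega h ->
  ae_in (fun x => d / 2 <= h x <= 3 * d / 2) ->
  exists y, [/\ H10 Omega y, forall q : R, 1 <= q -> Wkq Omega 2 q%:E y & weak_sol y h].
Proof.
have [T T0 HT] := state_energy_bound.
have [_ [Mb HMb]] := Bb; have [_ [Ma HMa]] := Bua.
(* [C] exceeds [ua + b t] for every t in [0, T], and h <= 2 d = f0 / C yields f / h >= C; hence f /
   h - b t is admissible for all these t. *)
pose C := `|Mb| * T + `|Ma| + 1.
have C0 : 0 < C by rewrite ltr_wpDl// addr_ge0// mulr_ge0// ltW.
pose d := f0 / (2 * C).
have d0 : 0 < d by rewrite divr_gt0// mulr_gt0.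
exists d => // h mh hd.
have hge : ae_in (fun x => d / 2 <= h x) by apply: aeD_imp hd => x _ /andP[].
have d20 : 0 < d / 2 by rewrite divr_gt0.
have Bh := BdV d20 mh hge.
pose w0 x := f x * (h x)^-1.
have Bw0 : Bd w0 by exact: BdM.
pose w t x := w0 x - b x * t.
have aw t : 0 <= t <= T -> admissible (w t).
  move=> /andP[t0 tT]; split; first by apply: Bd_L2f => //; rewrite /w; integ.
  apply: aeD_imp3 HMb HMa (aeD_imp2 (fun x _ h1 h2 => conj h1 h2) ff0 hd).
  move=> x _ h1 h2 [h3 /andP[h4 h5]]; rewrite /w /w0.
  have h0 := lt_le_trans d20 h4.
  have : C <= f x / h x.
    rewrite ler_pdivlMr//; apply: le_trans h3.
    have -> : f0 = C * (2 * d) by rewrite /d; field; rewrite gt_eqF.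
    by rewrite ler_pM2l//; lra.
  have : b x * t <= `|Mb| * T.
    by rewrite (le_trans (ler_wpM2r t0 (ler_norm _)))// ler_pM//; apply: le_trans h1 (ler_norm _).
  by have := ler_norm (ua x); have := ler_norm Ma; rewrite /C; lra.
have SP t : 0 <= t <= T -> kirchhoff_state Omega f b (w t) (S (w t)).
  by move=> /aw [Lw uw]; have [] := hS ((Lp2_L2f oO _).2 Lw) uw.
pose m t := E (S (w t)) (S (w t)).
(* Energies lie in [0, T], so t - m t is nonpositive at 0 and nonnegative at T. *)
have [t t0T mt] : exists2 t, 0 <= t <= T & t - m t = 0.
  have [|||t] := @IVT R (fun t => t - m t) 0 T 0.
  - exact: ltW.
  - apply/subspace_continuousP => t; rewrite /= in_itv/= => tT.
    apply: cvgB; first exact: cvg_within.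
    apply/cvgrPdist_lt => e e0; near=> s.
    have sT : 0 <= s <= T by have : `[0, T]%classic s by near: s; exact: withinT.
    apply: le_lt_trans (energy_lipschitz (aw _ tT) (aw _ sT) (SP _ tT) (SP _ sT)) _.
    by near: s; apply: cvg_within; apply: nbhsx_ballx.
  - have TT : 0 <= T <= T by rewrite lexx ltW.
    have h1 := HT _ _ (aw _ TT) (SP _ TT).
    have h2 := dirichlet_ge0 Omega (S (w 0)).
    rewrite ge_min le_max; apply/andP; split; apply/orP; [left|right]; rewrite /m; lra.
  - by rewrite in_itv/=; exists t.
have [H0 HW] : H10 Omega (S (w t)) /\ forall q : R, 1 <= q -> Wkq Omega 2 q%:E (S (w t)).
  have [Lw uw] := aw _ t0T; have [_ _ HW] := hS ((Lp2_L2f oO _).2 Lw) uw.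
  by split=> //; exact: state_H10 (SP _ t0T).
exists (S (w t)); split=> //.
apply: weak_sol_ae (state_weak_sol (aw _ t0T) (SP _ t0T)).
have mE : m t = t by lra.
rewrite -/(m t) mE.
apply: aeD_imp2 ff0 hge => x _ h1 h2; rewrite /state_rhs /denom /w /w0 subrK.
by field; rewrite !gt_eqF ?(lt_le_trans _ h1) ?(lt_le_trans _ h2).
Unshelve. all: by end_near. Qed.

(** The function c h + d takes its values in [d/2, 3d/2] for this small [c]; subtracting the
    solution for the constant [d] and dividing by [c] leaves the solution for [h]. *)
Lemma poisson h : Bd h -> exists y, [/\ H10 Omega y,
  forall q : R, 1 <= q -> Wkq Omega 2 q%:E y & weak_sol y h].
Proof.
move=> [mh [M HM]]; have [d d0 Hd] := poisson_near_constant.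
pose c := d / (2 * (`|M| + 1)).
have M0 : 0 < `|M| + 1 by rewrite ltr_wpDl.
have c0 : 0 < c by rewrite divr_gt0// mulr_gt0.
have cM : c * (`|M| + 1) = d / 2 by rewrite /c; field; rewrite gt_eqF.
have [||y1 [Hy1 Wy1 E1]] := Hd (fun x => c * h x + d).
- by apply: measurable_funD => //; exact: measurable_funM.
- apply: aeD_imp HM => x _; rewrite ler_norml => /andP[h1 h2].
  by have := ler_norm M; move: (`|M|) M0 cM => M'; nra.
have [||y2 [Hy2 Wy2 E2]] := Hd (fun=> d); first exact: measurable_cst.
  by apply: aeD_W => x _; lra.
exists (fun x => c^-1 * y1 x + (- c^-1) * y2 x); split; first exact: H10_lin.
  by move=> q q1; apply: Wkq_lin => //; [exact: Wy1|exact: Wy2].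
have [H11 _] := Hy1; have [H21 _] := Hy2.
have Bh : Bd h by split=> //; exists M.
apply: weak_sol_ae (weak_sol_lin oO bO _ _ H11 H21 _ _ E1 E2); try by apply: Bd_L2f => //; integ.
by apply: aeD_W => x _; field; rewrite gt_eqF.
Qed.

(** * The adjoint equation: nonlocal coefficient, existence and uniqueness *)

Lemma denomV2_Bd w m : admissible w -> 0 <= m -> Bd (fun x => (denom w m x ^+ 2)^-1).
Proof.
move=> aw m0; apply: Bd_ext (BdX 2 (denomV_Bd aw m0)) => x _; exact: exprVn.
Qed.

Definition coupling w m p : R :=
  \int[mu]_(x in Omega) (2 * b x * f x * p x / denom w m x ^+ 2).

Lemma coupling_lin w m a c p q : admissible w -> 0 <= m -> L2f p -> L2f q ->
  coupling w m (fun x => a * p x + c * q x) = a * coupling w m p + c * coupling w m q.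
Proof.
move=> aw m0 Lp Lq; have B2 := denomV2_Bd aw m0; apply: Rint_lin2 => //.
- by apply: L2f_I1 => //; integ.
- by apply: L2f_I1 => //; integ.
- by apply: aeD_W => x _; move: ((denom _ _ _ ^+ 2)^-1) => r; ring.
Qed.

Lemma coupling_ae w m p q : ae_in (fun x => p x = q x) -> coupling w m p = coupling w m q.
Proof. by move=> pq; apply: Rint_ae_eq; apply: aeD_imp pq => x _ ->. Qed.

Lemma coupling_state_ge0 w y : admissible w -> kirchhoff_state Omega f b w y ->
  0 <= coupling w (E y y) y.
Proof.
move=> aw Ky; apply: Rint_ge0_ae => //.
apply: aeD_imp3 ff0 bb0 (state_ge0 aw Ky) => x _ h1 h2 h3.
by rewrite divr_ge0 ?sqr_ge0// !mulr_ge0// ?(le_trans (ltW f00) h1) ?(le_trans (ltW b00) h2).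
Qed.

Section adjoint.
Variables (w y h : V -> R).
Hypotheses (aw : admissible w) (Ky : kirchhoff_state Omega f b w y).

Let m := E y y.
Let m0 : 0 <= m := dirichlet_ge0 Omega y.
Let g := state_rhs w m.
Let Bg : Bd g := state_rhs_Bd aw m0.
Let P := coupling w m.

(** Equation (a) in weak form, after - Delta y has been replaced by the right-hand side [g] of the
    state equation; [h] stands for the derivative of [phi] along [y]. *)
Definition weak_adjoint p := weak_sol p (fun x => - P p * g x + - 1 * h x).

Lemma adjoint_exists : Bd h -> (forall q : R, 1 <= q -> Wkq Omega 2 q%:E y) ->
  exists p, [/\ H10 Omega p, Bd p, forall q : R, 1 <= q -> Wkq Omega 2 q%:E p & weak_adjoint p].
Proof.
move=> Bh Wy; have [q [Hq Wq Eq]] := poisson Bh; have [Hq1 _] := Hq.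
have Lq := H1_L2f oO Hq1; have Lh := Bd_L2f mO Ooo Bh.
have Bq : Bd q.
  split; first by case: Lq.
  have [_ [M HM]] := Bh; have [B B0 HB] := weak_sol_bounded oO bO i0.
  have M0 : 0 < `|M| + 1 by rewrite ltr_wpDl.
  exists ((`|M| + 1) * B); apply: HB M0 Hq Lh Eq _.
  by apply: aeD_imp HM => x _ /le_trans; apply; have := ler_norm M; lra.
have Hy := state_H10 Ky; have [Hy1 _] := Hy; have Ly := H1_L2f oO Hy1.
have Py0 : 0 <= P y := coupling_state_ge0 aw Ky.
(* The value for which the coupling of - c y - q, namely - c P(y) - P(q), is again [c]. *)
pose c := - P q / (1 + P y).
exists (fun x => - c * y x + - 1 * q x); split.
- exact: H10_lin.
- by have := state_Bd aw Ky; integ.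
- by move=> r r1; apply: Wkq_lin => //; [exact: Wy|exact: Wq].
rewrite /weak_adjoint.
have -> : P (fun x => - c * y x + - 1 * q x) = c.
  rewrite /P coupling_lin// -/(P y) -/(P q) /c; move: (P y) (P q) Py0 => s t s0.
  by field; rewrite gt_eqF// ltr_wpDr.
by apply: weak_sol_lin => //; [integ|exact: state_weak_sol].
Qed.

(** The difference r satisfies - Delta (r + P(r) y) = 0, so r = - P(r) y; applying P gives P(r) (1 +
    P(y)) = 0 and then r = 0. *)
Lemma adjoint_unique p p' : L2f h -> H10 Omega p -> H10 Omega p' ->
  weak_adjoint p -> weak_adjoint p' -> ae_in (fun x => p' x = p x).
Proof.
move=> Lh Hp Hp' Ep Ep'; have [Hp1 _] := Hp; have [Hp1' _] := Hp'.
have Lp := H1_L2f oO Hp1; have Lp' := H1_L2f oO Hp1'.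
have Hy := state_H10 Ky; have [Hy1 _] := Hy; have Ly := H1_L2f oO Hy1.
have Lg := Bd_L2f mO Ooo Bg; have Ey : weak_sol y g := state_weak_sol aw Ky.
pose r x := 1 * p' x + -1 * p x; pose z x := 1 * r x + P r * y x.
have Hr : H10 Omega r by exact: H10_lin.
have [Hr1 _] := Hr; have Lr := H1_L2f oO Hr1.
have Pr : P r = P p' - P p by rewrite /r /P coupling_lin// mul1r mulN1r.
have Er := weak_sol_lin oO bO 1 (-1) Hp1' Hp1 (_ : L2f _) (_ : L2f _) Ep' Ep.
have Ez : weak_sol z (fun=> 0).
  apply: weak_sol_ae (weak_sol_lin oO bO 1 (P r) Hr1 Hy1 _ Lg (Er _ _) Ey); try integ.
  by apply: aeD_W => x _; rewrite Pr; move: (P p) (P p') => s t; ring.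
have z0 : ae_in (fun x => z x = 0).
  apply: (weak_sol_eq0 oO bO i0); first exact: H10_lin.
  by move=> psi tpsi; rewrite Ez//; apply: Rint_eq0 => x _; rewrite mul0r.
have ry : P r = P (fun x => - P r * y x + 0 * y x).
  by apply: coupling_ae; apply: aeD_imp z0 => x _; rewrite /z; lra.
have r0 : P r = 0.
  have Py0 : 0 <= P y := coupling_state_ge0 aw Ky.
  move: ry; rewrite {2}/P coupling_lin// -/(P y) mul0r addr0.
  move: (P r) (P y) Py0 => s t t0 /eqP; rewrite -subr_eq0 mulNr opprK => /eqP e.
  have /eqP : s * (1 + t) = 0 by rewrite -e; ring.
  by rewrite mulf_eq0 => /orP[/eqP //|]; rewrite gt_eqF// ltr_wpDr.
by apply: aeD_imp z0 => x _; rewrite /z r0 /r; lra.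
Qed.

End adjoint.

(** The denominators differ by w' - w plus [b] times the energy increment, and [two_states] with
    Cauchy-Schwarz bounds this increment by the L^2 norm of w' - w. The constant [kap] is a uniform
    bound for the secant weight. *)
Lemma denom_diff : exists2 C : R, 0 < C & forall w y w' y',
  admissible w -> admissible w' ->
  kirchhoff_state Omega f b w y -> kirchhoff_state Omega f b w' y' ->
  L2normsq Omega (fun x => denom w' (E y' y') x - denom w (E y y) x) <=
  C * L2normsq Omega (fun x => w' x - w x).
Proof.
have [M M0 HM] := state_bound; have [F F0 HF] := f_bound.
pose kap := F * (M + M) * (u0^-1 * u0^-1).
have Nb := L2normsq_ge0 Omega b; have O0 : 0 <= fine (mu Omega) by exact: fine_ge0.
exists (2 + 2 * (kap ^+ 2 * fine (mu Omega)) * L2normsq Omega b).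
  by rewrite ltr_pwDl// mulr_ge0// mulr_ge0// mulr_ge0// sqr_ge0.
move=> w y w' y' aw aw' Ky Ky'.
have [Bk k0 H] := two_states aw' aw Ky' Ky; set k := secant_weight _ _ _ _ in Bk k0 H.
have [[Lw _] [Lw' _]] := (aw, aw').
have Lo : L2f (fun x => w' x - w x) by integ.
have Lb := Bd_L2f mO Ooo Bb.
have kkap : ae_in (fun x => k x ^+ 2 <= kap ^+ 2).
  have d1 := denom_ge aw' (dirichlet_ge0 Omega y').
  have d2 := denom_ge aw (dirichlet_ge0 Omega y).
  apply: aeD_imp3 (aeD_imp3 (fun x _ h1 h2 h3 => conj h1 (conj h2 h3)) d1 d2 k0)
    (aeD_imp2 (fun x _ h1 h2 => conj h1 h2) HF ff0)
    (aeD_imp2 (fun x _ h1 h2 => conj h1 h2) (HM _ _ aw' Ky') (HM _ _ aw Ky)).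
  move=> x _ [h1 [h2 h3]] [h4 h5] [h6 h7].
  have e1 := lt_le_trans u00 h1; have e2 := lt_le_trans u00 h2; have f1 := lt_le_trans f00 h5.
  rewrite ler_sqr ?nnegrE//; last first.
    by rewrite /kap !mulr_ge0 ?addr_ge0 ?invr_ge0// ltW.
  rewrite (le_trans (ler_norm _))// /k /secant_weight /kap !normrM.
  rewrite ler_pM// ?mulr_ge0//.
    rewrite ler_pM//; first by rewrite gtr0_norm.
    by rewrite (le_trans (ler_normD _ _))// lerD.
  by rewrite !gtr0_norm ?invr_gt0// ler_pM ?invr_ge0 ?lef_pV2 ?posrE// ltW.
have B0 : 0 <= \int[mu]_(x in Omega) (k x * b x).
  apply: Rint_ge0_ae => //; apply: aeD_imp2 k0 bb0 => x _ h1 h2.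
  by rewrite mulr_ge0// (le_trans (ltW b00)).
have kN : L2normsq Omega k <= kap ^+ 2 * fine (mu Omega).
  rewrite -Rintegral_cst//; apply: le_Rint_ae => //.
  - by apply: Bd_I1 => //; integ.
  - by apply: Bd_I1 => //; integ.
have cs := cauchy_schwarz_Rint mO (Bd_L2f mO Ooo Bk) Lo.
rewrite -!/(L2normsq Omega _) in cs.
have No := L2normsq_ge0 Omega (fun x => w' x - w x).
have := L2normsq_lin_le oO 1 (E y' y' - E y y) Lo Lb.
rewrite (_ : (fun x => 1 * (w' x - w x) + (E y' y' - E y y) * b x) =
  (fun x => denom w' (E y' y') x - denom w (E y y) x)); last first.
  by apply/funext => x; rewrite /denom; move: (E y' y') (E y y) => s t; ring.
move=> /le_trans; apply.
move: H cs B0 kN Nb No; move: (L2normsq _ b) => N1.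
move: (L2normsq _ k) => N2; move: (L2normsq _ _) => N3.
move: (\int[mu]_(x in _) (k x * b x)) => B; move: (\int[mu]_(x in _) _) => I.
move: (E y' y' - E y y) => d; move: (kap ^+ 2 * _) => K H cs B0 kN N10 N30.
(* Since d (1 + B) = - I with B >= 0. *)
have dI : d ^+ 2 <= I ^+ 2.
  rewrite -(sqrrN I) -H exprMn ler_peMr ?sqr_ge0//; nra.
have dK : d ^+ 2 <= K * N3 by apply: le_trans dI (le_trans cs _); rewrite ler_wpM2r.
have := ler_wpM2r N10 dK; lra.
Qed.

Section perturbation.
Variables (w y w' y' : V -> R).
Hypotheses (aw : admissible w) (aw' : admissible w').
Hypotheses (Ky : kirchhoff_state Omega f b w y) (Ky' : kirchhoff_state Omega f b w' y').

Let D := denom w (E y y).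
Let D' := denom w' (E y' y').
Let l x := f x * ((D' x)^-1 * (D x)^-1).

Lemma state_diff_eq v : H10 Omega v ->
  E (fun x => y' x - y x) v = - \int[mu]_(x in Omega) (l x * (D' x - D x) * v x).
Proof.
move=> Hv; have [Hv1 _] := Hv; have Lv := H1_L2f oO Hv1.
have [Hy1 Hy1'] := (state_H1 Ky, state_H1 Ky').
have Bg := state_rhs_Bd aw (dirichlet_ge0 Omega y).
have Bg' := state_rhs_Bd aw' (dirichlet_ge0 Omega y').
rewrite dirichletB// (state_eq aw Ky Hv) (state_eq aw' Ky' Hv).
apply: oppr_inj; rewrite opprK opprB.
rewrite (@Rint_lin2 _ _ _ mu Omega mO 1 (-1) (fun x => l x * (D' x - D x) * v x)
  (fun x => state_rhs w (E y y) x * v x) (fun x => state_rhs w' (E y' y') x * v x)); try integ.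
  by rewrite mul1r mulN1r.
have d1 := denom_ge aw' (dirichlet_ge0 Omega y').
have d2 := denom_ge aw (dirichlet_ge0 Omega y).
apply: aeD_imp2 d1 d2 => x _ h1 h2; rewrite /l /state_rhs -/(D x) -/(D' x).
by field; rewrite !gt_eqF ?(lt_le_trans u00 h1) ?(lt_le_trans u00 h2).
Qed.

End perturbation.

Lemma denomV_le w m : admissible w -> 0 <= m ->
  ae_in (fun x => 0 <= (denom w m x)^-1 <= u0^-1).
Proof.
move=> aw m0; apply: aeD_imp (denom_ge aw m0) => x _ h.
have d0 := lt_le_trans u00 h.
by rewrite invr_ge0 ltW//= lef_pV2 ?posrE.
Qed.

(** The equation of y' - y is tested with y' - y itself. Its right-hand side is a bounded multiple
    of the denominator increment, and Poincare returns from the energy to the L^2 norm. *)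
Lemma state_diff : exists2 C : R, 0 < C & forall w y w' y',
  admissible w -> admissible w' ->
  kirchhoff_state Omega f b w y -> kirchhoff_state Omega f b w' y' ->
  E (fun x => y' x - y x) (fun x => y' x - y x) <= C * L2normsq Omega (fun x => w' x - w x) /\
  L2normsq Omega (fun x => y' x - y x) <= C * L2normsq Omega (fun x => w' x - w x).
Proof.
have [Cp Cp0 HCp] := poincare oO bO i0; have [Cd Cd0 HCd] := denom_diff.
have [F F0 HF] := f_bound.
pose k := F * (u0^-1 * u0^-1).
have k0 : 0 < k by rewrite !mulr_gt0 ?invr_gt0.
pose C := k ^+ 2 * Cp * Cd.
have C0 : 0 < C by do 2 apply: mulr_gt0 => //; exact: exprn_gt0.
exists (C + Cp * C); first by rewrite addr_gt0// mulr_gt0.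
move=> w y w' y' aw aw' Ky Ky'.
have Hd := H10B oO bO (state_H10 Ky') (state_H10 Ky); have [Hd1 _] := Hd.
have Ld := H1_L2f oO Hd1; have := state_diff_eq aw aw' Ky Ky' Hd.
have Iq := HCd _ _ _ _ aw aw' Ky Ky'; have Id := HCp _ Hd.
have [B1 B2] := (denomV_Bd aw (dirichlet_ge0 Omega y), denomV_Bd aw' (dirichlet_ge0 Omega y')).
have l1 := denomV_le aw (dirichlet_ge0 Omega y).
have l2 := denomV_le aw' (dirichlet_ge0 Omega y').
have Lq : L2f (fun x => denom w' (E y' y') x - denom w (E y y) x).
  by have [[Lw _] [Lw' _]] := (aw, aw'); rewrite /denom; integ.
pose l x := f x * ((denom w' (E y' y') x)^-1 * (denom w (E y y) x)^-1).
have Bl : Bd l by rewrite /l; integ.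
have lk : ae_in (fun x => l x ^+ 2 <= k ^+ 2).
  apply: aeD_imp3 l1 l2 (aeD_imp2 (fun x _ h1 h2 => conj h1 h2) HF ff0).
  move=> x _ /andP[h1 h2] /andP[h3 h4] [h5 h6].
  have fx := lt_le_trans f00 h6.
  have l0 : 0 <= l x by rewrite !mulr_ge0// ltW.
  rewrite ler_sqr ?nnegrE ?(ltW k0)// /l /k.
  by apply: ler_pM; rewrite ?mulr_ge0 ?ler_pM// ltW.
have Llq := BdL2f mO Bl Lq.
have cs := cauchy_schwarz_Rint mO Llq Ld.
have Nlq : L2normsq Omega (fun x => l x * (denom w' (E y' y') x - denom w (E y y) x)) <=
    k ^+ 2 * L2normsq Omega (fun x => denom w' (E y' y') x - denom w (E y y) x).
  have [_ Iq'] := Lq; have [_ Ilq] := Llq.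
  rewrite -RintegralZl//; apply: le_Rint_ae => //; first exact: I1Z.
  apply: aeD_imp lk => x _ lx; rewrite exprMn ler_wpM2r ?sqr_ge0//.
move: cs; rewrite -!/(L2normsq Omega _) => cs Ed.
have Nd0 := L2normsq_ge0 Omega (fun x => y' x - y x).
have Nq0 := L2normsq_ge0 Omega (fun x => denom w' (E y' y') x - denom w (E y y) x).
have Ed0 := dirichlet_ge0 Omega (fun x => y' x - y x).
have N0 := L2normsq_ge0 Omega (fun x => w' x - w x).
have Nl0 := L2normsq_ge0 Omega (fun x => l x * (denom w' (E y' y') x - denom w (E y y) x)).
move: cs Nlq Ed Iq Id Nd0 Nq0 Ed0 N0 Nl0.
move: (L2normsq _ (fun x => w' x - w x)) => N.
move: (L2normsq _ (fun x => y' x - y x)) => Nd.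
move: (L2normsq _ (fun x => l x * _)) => Nl.
move: (L2normsq _ _) => Nq; move: (\int[mu]_(x in _) _) => I.
move: (E (fun x => y' x - y x) _) => e cs Nlq eI Iq Id Nd0 Nq0 e0 N0 Nl0.
have eC : e <= C * N.
  rewrite leNgt; apply/negP => Ce.
  have e1 : 0 < e by apply: le_lt_trans Ce; rewrite mulr_ge0// ltW.
  (* Cauchy-Schwarz bounds the square of the energy by a multiple of itself; one factor [e] is then
     cancelled. *)
  have : e ^+ 2 <= C * N * e.
    rewrite {1}eI sqrrN; apply: le_trans cs _.
    have -> : C * N * e = (k ^+ 2 * (Cd * N)) * (Cp * e) by rewrite /C; ring.
    by apply: ler_pM => //; apply: le_trans Nlq _; rewrite ler_wpM2l ?sqr_ge0.
  by rewrite expr2 ler_pM2r// leNgt Ce.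
have := ler_wpM2l (ltW Cp0) eC; have : 0 <= C * N by rewrite mulr_ge0// ltW.
have := mulr_ge0 (ltW Cp0) (mulr_ge0 (ltW C0) N0).
by move=> *; split; lra.
Qed.

(* With [q = denom w' _ - denom w _ = (w' - w) + b m], [m] the increment of the
   energy, the adjoint equation tested with [y' - y] and the state equations
   tested with [p] leave the quadratic remainder
   [P / 2 * E (y' - y) (y' - y) - int f p q^2 / (D' D^2)]. *)
Lemma adjoint_expansion w y h p : admissible w -> kirchhoff_state Omega f b w y ->
  Bd h -> H10 Omega p -> Bd p -> weak_adjoint w y h p ->
  exists2 C : R, 0 < C & forall w' y', admissible w' -> kirchhoff_state Omega f b w' y' ->
  `|\int[mu]_(x in Omega) (h x * (y' x - y x)) -
    \int[mu]_(x in Omega) (f x * p x / denom w (E y y) x ^+ 2 * (w' x - w x))| <=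
  C * L2normsq Omega (fun x => w' x - w x).
Proof.
move=> aw Ky Bh Hp Bp Ep.
have [Cd Cd0 HCd] := denom_diff; have [Ce Ce0 HCe] := state_diff.
have [F F0 HF] := f_bound; have [_ [M HM]] := Bp.
pose D := denom w (E y y); pose P := coupling w (E y y) p.
pose k := F * (`|M| + 1) * (u0^-1 * (u0^-1 * u0^-1)).
have M0 : 0 < `|M| + 1 by rewrite ltr_wpDl.
have k0 : 0 < k by rewrite !mulr_gt0 ?invr_gt0.
exists (k * Cd + `|P| * Ce); first exact: ltr_wpDr (mulr_ge0 (normr_ge0 P) (ltW Ce0)) (mulr_gt0
  k0 Cd0).
move=> w' y' aw' Ky'.
pose D' := denom w' (E y' y'); pose q x := D' x - D x.
pose d x := y' x - y x.
have Hd : H10 Omega d := H10B oO bO (state_H10 Ky') (state_H10 Ky).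
have [Hd1 _] := Hd; have [Hp1 _] := Hp; have Ld := H1_L2f oO Hd1; have Lp := H1_L2f oO Hp1.
have [B1 B2] := (denomV_Bd aw (dirichlet_ge0 Omega y), denomV_Bd aw' (dirichlet_ge0 Omega y')).
have B3 := denomV2_Bd aw (dirichlet_ge0 Omega y).
have l1 := denomV_le aw (dirichlet_ge0 Omega y).
have l2 := denomV_le aw' (dirichlet_ge0 Omega y').
rewrite -/D -/D' in B1 B2 B3 l1 l2.
have Bg := state_rhs_Bd aw (dirichlet_ge0 Omega y).
have [[Lw _] [Lw' _]] := (aw, aw').
have Lq : L2f q by rewrite /q /D' /D /denom; integ.
have Iq : I1 (fun x => q x ^+ 2) by case: Lq.
pose l x := f x * ((D' x)^-1 * (D x)^-1).
pose r x := f x * p x * ((D' x)^-1 * ((D x)^-1 * (D x)^-1)).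
have Br : Bd r by rewrite /r; integ.
have Bl : Bd l by rewrite /l; integ.
have Epd : E p d = - P * E y d + -1 * \int[mu]_(x in Omega) (h x * d x).
  have /(weak_solP oO bO Hp1 _)/(_ _ Hd) -> := Ep; last by apply: Bd_L2f => //; integ.
  rewrite (state_eq aw Ky Hd); apply: Rint_lin2 => //; try integ.
  by apply: aeD_W => x _; rewrite -/P; move: (state_rhs _ _ _) => g; ring.
have Edp : E p d = - \int[mu]_(x in Omega) (l x * q x * p x).
  by rewrite dirichletC; exact: (state_diff_eq aw aw' Ky Ky' Hp).
have Em : E y' y' - E y y = 2 * E y d + E d d.
  have {1 2}-> : y' = (fun x => 1 * y x + 1 * d x) by apply/funext => x; rewrite /d; ring.
  have Hy1 := state_H1 Ky.
  by rewrite dirichlet_sqr_lin//; move: (E y y) (E y d) (E d d) => s t z; ring.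
(* With w' - w = q - b m, the part in q splits as l q p + r q^2 because 1/D^2 - 1/(D D') = q / (D^2
   D'). The part in m is -m P / 2, the coupling carrying a factor 2. *)
have Ew : \int[mu]_(x in Omega) (f x * p x / D x ^+ 2 * (w' x - w x)) =
    1 * \int[mu]_(x in Omega) (l x * q x * p x) +
    1 * \int[mu]_(x in Omega) (r x * q x ^+ 2) + (- (E y' y' - E y y) / 2) * P.
  apply: Rint_lin3 => //; try integ.
  apply: aeD_imp2 (denom_ge aw (dirichlet_ge0 Omega y)) (denom_ge aw' (dirichlet_ge0 Omega y')).
    move=> x _ h1 h2; have := lt_le_trans u00 h1; have := lt_le_trans u00 h2.
    rewrite -/(D x) -/(D' x) /l /r /q => e2 e1.
    have -> : w' x - w x = D' x - D x - b x * (E y' y' - E y y).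
      by rewrite /D' /D /denom; move: (E y' y') (E y y) => s t; ring.
    by move: (E y' y' - E y y) => m; field; rewrite !gt_eqF.
have rk : `|\int[mu]_(x in Omega) (r x * q x ^+ 2)| <= k * L2normsq Omega q.
  have Irq : I1 (fun x => r x * q x ^+ 2) by integ.
  apply: le_trans (norm_Rint_le mO Irq) _; rewrite -RintegralZl//.
  apply: le_Rint_ae => //; [exact: I1_norm|exact: I1Z|].
  apply: aeD_imp3 HM (aeD_imp2 (fun x _ h1 h2 => conj h1 h2) HF ff0)
    (aeD_imp2 (fun x _ h1 h2 => conj h1 h2) l1 l2).
  move=> x _ h1 [h2 h3] [/andP[h4 h5] /andP[h6 h7]].
  have fx := lt_le_trans f00 h3.
  rewrite normrM (ger0_norm (sqr_ge0 _)) ler_wpM2r ?sqr_ge0// /r /k !normrM.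
  rewrite (gtr0_norm fx) (ger0_norm h4) (ger0_norm h6).
  have h8 : `|p x| <= `|M| + 1 by have := ler_norm M; lra.
  by apply: ler_pM; rewrite ?mulr_ge0 ?ler_pM ?mulr_ge0 ?ler_pM// ltW.
have [Cd' _] := HCe _ _ _ _ aw aw' Ky Ky'; have Cq := HCd _ _ _ _ aw aw' Ky Ky'.
rewrite -/D -/D' -/q in Cq; rewrite -/d in Cd'.
have E0 := dirichlet_ge0 Omega d.
rewrite Ew; move: Epd Edp Em rk Cd' Cq E0.
move: (L2normsq _ (fun x => w' x - w x)) => N; move: (L2normsq _ q) => Nq.
move: (E p d) (E y d) => e1 e2; move: (E d d) => e3.
move: (E y' y' - E y y) => m; move: (\int[mu]_(x in _) (h x * d x)) => Ih.
move: (\int[mu]_(x in _) (r x * _)) => Ir; move: (\int[mu]_(x in _) _) => Il.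
move=> Epd Edp Em rk Cd' Cq E0.
have -> : Ih - (1 * Il + 1 * Ir + - m / 2 * P) = P * e3 / 2 - Ir.
  have -> : Ih = - e1 - P * e2 by rewrite Epd; ring.
  by rewrite Edp Em; field.
apply: le_trans (ler_normB _ _) _; rewrite !normrM (ger0_norm E0) (@ger0_norm _ 2^-1)//.
have := ler_wpM2l (normr_ge0 P) Cd'; have := ler_wpM2l (ltW k0) Cq.
have : 0 <= `|P| * e3 by rewrite mulr_ge0.
move: (`|P|) (`|Ir|) rk => P' I' *; lra.
Qed.

(** * The optimality system *)

Section optimality.
Variables (ub u y : V -> R) (phi : V -> R -> R) (lambda eps : R) (theta : R -> R).
Hypotheses (Bub : Bd ub) (hphi : nonlinearity_assumptions Omega phi).
Hypotheses (eps0 : 0 < eps) (htheta : cutoff_function eps theta).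
Hypotheses (Hu : H1 Omega u) (Hy : H10 Omega y).
Hypothesis hopt : locally_optimal Omega ua ub S phi theta lambda eps y u.

Local Notation control := (cutoff_control ua theta).

Lemma control_admissible v : L2f v -> admissible (control v).
Proof.
move=> Lv; have Lua := Bd_L2f mO Ooo Bua.
split; last first.
  by apply: aeD_W => x _; rewrite /cutoff_control lerDl (cutoff_ge0 htheta).
have mt : measurable_fun [set: R] theta.
  by apply: continuous_measurable_fun; exact: derivable1_continuous (cutoff_derivable htheta).
(* [theta] vanishes at -(eps + 1) and is 1-Lipschitz, so this function dominates
   [theta (v - ua)]. *)
have Le : L2f (fun x => v x - ua x + (eps + 1)).
  have Lc : L2f (fun=> eps + 1) by apply: Bd_L2f => //; exact: Bd_cst.
  by integ.
rewrite /cutoff_control; apply: L2fD => //; apply: L2f_le (Le).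
  by apply: (measurableT_comp mt); apply: measurable_funB; [case: Lv|case: Lua].
apply: aeD_W => x _; have := cutoff_diff_le htheta (- (eps + 1)) (v x - ua x).
have [_ _ _ [_ tz] _] := htheta.
by rewrite (tz (- (eps + 1))) ?subr0 ?opprK// ltrN2 ltrDl.
Qed.

Lemma control_diff v v' x : `|control v' x - control v x| <= `|v' x - v x|.
Proof.
rewrite /cutoff_control opprD addrACA subrr add0r; apply: le_trans (cutoff_diff_le htheta _ _) _.
by rewrite opprB addrA subrK.
Qed.

Lemma state_S w : admissible w -> kirchhoff_state Omega f b w (S w).
Proof. by move=> [Lw uw]; have [] := hS ((Lp2_L2f oO _).2 Lw) uw. Qed.

(** Optimality identifies [y] with a value of [S] only almost everywhere; energies and weak
    equations depend only on the class of [y]. *)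
Lemma optimal_state : kirchhoff_state Omega f b (control u) y.
Proof.
have [_ yS _] := hopt; have aw := control_admissible (H1_L2f oO Hu).
have [HS ES] := state_S aw; set z := S _ in yS HS ES.
have [Hz1 _] := HS; have [Hy1 _] := Hy.
have yz v : E y v = E z v by exact: dirichlet_ae.
have yy : gradnormsq Omega y = gradnormsq Omega z.
  by rewrite (gradnormsqE Omega y) (gradnormsqE Omega z) yz dirichletC yz.
split; first exact: Hy.
move=> v Hv.
rewrite yy.
apply: etrans (ES v Hv).
exact: etrans (esym (dirichletE Omega y v)) (etrans (yz v) (dirichletE Omega z v)).
Qed.

Lemma state_denomE : state_denom Omega b ua theta y u = denom (control u) (E y y).
Proof. by apply/funext => x; rewrite /state_denom gradnormsqE. Qed.

Lemma cutoff_derive1_Bd : Bd (fun x => derive1 theta (u x - ua x)).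
Proof.
have mt : measurable_fun [set: R] (derive1 theta).
  by apply: continuous_measurable_fun; exact: derivable1_continuous (cutoff_derivable1 htheta).
split.
  apply: (measurableT_comp mt); apply: measurable_funB; last by case: Bua.
  by case: (H1_L2f oO Hu).
have [_ _ _ _ H] := htheta; exists 1; apply: aeD_W => x _.
by have /andP[h0 h1] := H (u x - ua x); rewrite ger0_norm.
Qed.

(** * Variation of the cost in a direction [v] *)

Section gradient.
Variables (g p v : V -> R).
Hypotheses (Bg : Bd g) (phig : ae_in (fun x => derive1 (phi x) (y x) = g x)).
Hypotheses (Hp : H10 Omega p) (Bp : Bd p) (Ep : weak_adjoint (control u) y g p).
Hypothesis Hv : H1 Omega v.

Let D := denom (control u) (E y y).
Let kap x := f x * p x / D x ^+ 2.
Let ut t x := 1 * u x + t * v x.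

Let Lu : L2f u := H1_L2f oO Hu.
Let Lv : L2f v := H1_L2f oO Hv.
Let aw : admissible (control u) := control_admissible Lu.

Let Lut t : L2f (ut t).
Proof. by rewrite /ut; integ. Qed.

Let awt t : admissible (control (ut t)) := control_admissible (Lut t).

Let Bkap : Bd kap.
Proof. by have B2 := denomV2_Bd aw (dirichlet_ge0 Omega y); rewrite /kap; integ. Qed.

Let Lw t : L2f (fun x => control (ut t) x - control u x).
Proof. by have [Lw _] := aw; have [Lwt _] := awt t; integ. Qed.

Lemma control_diff_L2 t :
  L2normsq Omega (fun x => control (ut t) x - control u x) <= t ^+ 2 * L2normsq Omega v.
Proof.
have [_ Iv] := Lv; have [_ Iw] := Lw t.
rewrite -[L2normsq Omega v]/(\int[mu]_(x in Omega) v x ^+ 2) -RintegralZl//.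
apply: le_Rint_ae => //; first exact: I1Z.
apply: aeD_W => x _; have := control_diff u (ut t) x; rewrite -exprMn.
rewrite (_ : ut t x - u x = t * v x); last by rewrite /ut; ring.
move: (control _ _ - control _ _) (t * v x) => c d cd.
by rewrite -[leLHS]real_normK ?num_real// -[leRHS]real_normK ?num_real// ler_sqr ?nnegrE.
Qed.

(** Boundedness of [kap], and so of [p], matters here: the Taylor remainder of [theta] is a multiple
    of [v^2], which is merely integrable. *)
Lemma control_expansion : exists C : R, forall t,
  \int[mu]_(x in Omega) (kap x * (control (ut t) x - control u x)) <=
  t * \int[mu]_(x in Omega) (kap x * derive1 theta (u x - ua x) * v x) + C * t ^+ 2.
Proof.
have [C C0 HC] := cutoff_taylor eps0 htheta; have [_ [K HK]] := Bkap.
exists (`|K| * C * L2normsq Omega v) => t.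
have [_ Iv] := Lv; have Bt := cutoff_derive1_Bd.
rewrite [X in _ + X]mulrAC -[L2normsq Omega v]/(\int[mu]_(x in Omega) v x ^+ 2).
have Lw' := Lw t.
rewrite -(@Rint_lin2 _ _ _ mu Omega mO t (`|K| * C * t ^+ 2) (fun x =>
  t * (kap x * derive1 theta (u x - ua x) * v x) + `|K| * C * t ^+ 2 * v x ^+ 2)).
- apply: le_Rint_ae; try integ => //.
  apply: aeD_imp HK => x _ kK.
  have := HC (u x - ua x) (t * v x); rewrite /cutoff_control.
  rewrite (_ : u x - ua x + t * v x = ut t x - ua x); last by rewrite /ut; ring.
  move: (theta _) (theta _) (derive1 theta _) kK => z s d.
  move: (kap x) (v x) (ua x) => k v' a kK sz.
  have := ler_norm (k * (s - z - d * (t * v'))); rewrite normrM.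
  have : `|k| * `|s - z - d * (t * v')| <= `|K| * (C * (t * v') ^+ 2).
    by rewrite ler_pM// (le_trans kK)// ler_norm.
  move: (`|k| * _) => m; lra.
- by integ.
- by [].
- exact: aeD_W.
Qed.

Lemma optimality_gradient :
  \int[mu]_(x in Omega) (kap x * derive1 theta (u x - ua x) * v x) +
  lambda * (E u v + \int[mu]_(x in Omega) (u x * v x)) -
  1 / eps * \int[mu]_(x in Omega) ((pos (ua x - u x) - pos (u x - ub x)) * v x) = 0.
Proof.
have [_ _ [r r0 Hr]] := hopt.
have Ky := optimal_state; have By := state_Bd aw Ky.
have [M M0 HM] := state_bound.
have [C1 C10 HC1] := nonlinear_cost_expansion oO bO hphi M0.
have [C2 C20 HC2] := adjoint_expansion aw Ky Bg Hp Bp Ep.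
have [C3 C30 HC3] := state_diff.
have [C4 HC4] := control_expansion.
have Lua := Bd_L2f mO Ooo Bua; have Lub := Bd_L2f mO Ooo Bub.
pose h := h1sq Omega v; have h0 : 0 <= h := h1sq_ge0 Omega v.
(* The squared H^1 distance from [ut t] to [u] is bounded by 2 t^2 h, which is at most r^2 for |t|
   <= r'. *)
pose r' := r / (2 * h + 1).
have hh : 0 < 2 * h + 1 by rewrite ltr_wpDl// mulr_ge0.
have r'0 : 0 < r' by rewrite divr_gt0.
(* The quadratic terms come, in order, from the Taylor remainder of [phi], the adjoint expansion,
   the cutoff, the H^1 norm and the penalty. *)
pose C5 := (C1 * C3 + C2) * L2normsq Omega v + C4 + lambda / 2 * h + eps^-1 * L2normsq Omega v.
apply: (@linear_quadratic_ge0 _ _ C5 _ r'0) => t tr.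
have Hut : H1 Omega (ut t) by exact: H1_lin.
have small : H1norm Omega (ut t \- u) <= r.
  rewrite (_ : ut t \- u = (fun x => 0 * u x + t * v x)); last first.
    by apply/funext => x; rewrite /ut /=; ring.
  rewrite (H1norm_le _ _ (ltW r0)); have := h1sq_lin_le oO bO 0 t Hu Hv.
  move=> /le_trans; apply.
  rewrite expr0n mulr0 mul0r add0r -/h.
  have tr2 : t ^+ 2 <= r' ^+ 2 by rewrite -[t ^+ 2]real_normK ?num_real// ler_sqr ?nnegrE// ltW.
  have rE : r' * (2 * h + 1) = r by rewrite divfK// gt_eqF.
  rewrite -rE exprMn; have := ler_wpM2l h0 tr2; have := sqr_ge0 r'.
  move: (r' ^+ 2) (t ^+ 2) => a c a0 hca.
  apply: le_trans (_ : 2 * h * a <= _); first lra.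
  rewrite mulrC ler_wpM2l//; nra.
have Kt := state_S (awt t); have Byt := state_Bd (awt t) Kt.
set yt := S _ in Kt Byt.
have hJ : \int[mu]_(x in Omega) phi x (y x) + lambda / 2 * H1norm Omega u ^+ 2 +
    1 / (2 * eps) * penalty Omega ua ub u <=
  \int[mu]_(x in Omega) phi x (yt x) + lambda / 2 * H1norm Omega (ut t) ^+ 2 +
    1 / (2 * eps) * penalty Omega ua ub (ut t) := Hr _ Hut small.
have e1 : H1norm Omega (ut t) ^+ 2 = _ := H1norm_sqr_lin oO bO t Hu Hv.
have e2 : penalty Omega ua ub (ut t) <= _ := penalty_lin_le oO t Lua Lub Lu Lv.
have e3 := HC1 _ _ _ By Byt Bg (HM _ _ aw Ky) (HM _ _ (awt t) Kt) phig.
have e4 : `|\int[mu]_(x in Omega) (g x * (yt x - y x)) -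
    \int[mu]_(x in Omega) (kap x * (control (ut t) x - control u x))| <= _ := HC2 _ _ (awt t) Kt.
have [_ e5] := HC3 _ _ _ _ aw (awt t) Ky Kt.
have e6 := HC4 t; have e7 := control_diff_L2 t.
have N0 := L2normsq_ge0 Omega (fun x => control (ut t) x - control u x).
have hE : H1norm Omega v ^+ 2 = h := H1norm_sqr Omega v.
(* Once the norms and integrals are replaced by variables, the conclusion is a linear combination of
   the expansions, with the products by nonnegative constants prepared beforehand. *)
move: (H1norm Omega v) hE e1 => nv -> e1.
move: (H1norm Omega (ut t)) (H1norm Omega u) e1 hJ => n1 n0 e1 hJ.
move: (penalty Omega ua ub (ut t)) (penalty Omega ua ub u) e2 hJ => p1 p0 e2 hJ.
move: (\int[mu]_(x in Omega) phi x (y x)) (\int[mu]_(x in Omega) phi x (yt x)) e3 hJ => j0 j1 e3 hJ.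
move: (\int[mu]_(x in Omega) (g x * (yt x - y x))) e3 e4 => G e3 e4.
move: (\int[mu]_(x in Omega) (kap x * (control (ut t) x - control u x))) e4 e6 => W e4 e6.
move: (\int[mu]_(x in Omega) (kap x * derive1 theta (u x - ua x) * v x)) e6 => A e6.
move: (\int[mu]_(x in Omega) (u x * v x)) e1 => X e1.
move: (\int[mu]_(x in Omega) ((pos (ua x - u x) - pos (u x - ub x)) * v x)) e2 => Ip e2.
move: (L2normsq Omega (fun x => yt x - y x)) e3 e5 => Nd e3 e5.
move: (L2normsq Omega (fun x => control (ut t) x - control u x)) N0 e4 e5 e7 => Nw N0 e4 e5 e7.
rewrite /C5; move: (L2normsq Omega v) e2 e7 => Nv e2 e7.
move: (E u v) e1 => D1 e1.
move: hJ; have -> : 1 / (2 * eps) = 2^-1 * eps^-1 by field; rewrite gt_eqF.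
have ie0 : 0 < eps^-1 by rewrite invr_gt0.
rewrite e1 div1r; move: (eps^-1) ie0 => i ie0 hJ.
have e8 := ler_wpM2l (ltW C10) e5.
have e9 : (C1 * C3 + C2) * Nw <= (C1 * C3 + C2) * (t ^+ 2 * Nv).
  by rewrite ler_wpM2l// addr_ge0 ?mulr_ge0// ltW.
have e10 := ler_wpM2l (ltW ie0) e2.
have e11 : G - W <= C2 * Nw by apply: le_trans (ler_norm _) e4.
move: (t ^+ 2) e9 e10 e6 hJ => t2 e9 e10 e6 hJ.
move: hJ e3 e6 e8 e9 e10 e11; lra.
Qed.

End gradient.

Lemma gradient_of_adjoint g p : Bd g -> ae_in (fun x => derive1 (phi x) (y x) = g x) ->
  H10 Omega p -> Bd p -> weak_adjoint (control u) y g p ->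
  gradient_equation Omega f b ua ub theta lambda eps y u p.
Proof.
move=> Bg phig Hp Bp Ep v Hv.
have H := optimality_gradient Bg phig Hp Bp Ep Hv.
have Lu := H1_L2f oO Hu; have Lv := H1_L2f oO Hv.
have aw := control_admissible Lu; have B2 := denomV2_Bd aw (dirichlet_ge0 Omega y).
have Bt := cutoff_derive1_Bd.
rewrite state_denomE -dirichletE.
rewrite (@Rint_lin2 _ _ _ mu Omega mO 1 lambda
  (fun x => (f x * p x * derive1 theta (u x - ua x) / denom (control u) (E y y) x ^+ 2 +
    lambda * u x) * v x)
  (fun x => f x * p x / denom (control u) (E y y) x ^+ 2 * derive1 theta (u x - ua x) * v x)
  (fun x => u x * v x)); try integ; last first.
  by apply: aeD_W => x _; move: (_^-1) => d; ring.
move: H; move: (E u v) (\int[mu]_(x in Omega) (u x * v x)) => X Y.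
move: (\int[mu]_(x in Omega) ((pos _ - pos _) * v x)) => Z.
by move: (\int[mu]_(x in _) _) => A <-; ring.
Qed.

(** The state equation replaces [- wlaplacian Omega y] in (a) by [state_rhs]; what remains is a
    Poisson equation for [p], read weakly or pointwise as [p] lies in W^{2,2}. *)
Lemma adjoint_equationP g p : L2f g -> ae_in (fun x => derive1 (phi x) (y x) = g x) ->
  (forall q : R, 1 <= q -> Wkq Omega 2 q%:E y) ->
  H10 Omega p -> (forall q : R, 1 <= q -> Wkq Omega 2 q%:E p) ->
  adjoint_equation Omega f b ua phi theta y u p <-> weak_adjoint (control u) y g p.
Proof.
move=> Lg phig Wy Hp Wp; have Ky := optimal_state.
have aw := control_admissible (H1_L2f oO Hu).
have Lr := Bd_L2f mO Ooo (state_rhs_Bd aw (dirichlet_ge0 Omega y)).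
have ty : 1 <= 2 :> R by rewrite ler1n.
have /(weak_sol_wlaplacian oO bO (Wy _ ty) Lr) Dy := state_weak_sol aw Ky.
rewrite /adjoint_equation state_denomE -/(coupling (control u) (E y y) p).
have LP : L2f (fun x => - coupling (control u) (E y y) p *
  state_rhs (control u) (E y y) x + - 1 * g x) by integ.
have W := weak_sol_wlaplacian oO bO (Wp _ ty) LP.
split=> [[_ H]|/W H].
- apply/W; apply: aeD_imp3 H Dy phig => x _.
  move: (wlaplacian _ y x) (wlaplacian _ p x) (coupling _ _ _) => a c d.
  by move: (derive1 _ _) (state_rhs _ _ x) (g x) => e s k h1 <- <-; lra.
- split=> //; apply: aeD_imp3 H Dy phig => x _.
  move: (wlaplacian _ y x) (wlaplacian _ p x) (coupling _ _ _) => a c d.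
  by move: (derive1 _ _) (state_rhs _ _ x) (g x) => e s k -> <- <-; ring.
Qed.

Lemma state_equation_of : (forall q : R, 1 <= q -> Wkq Omega 2 q%:E y) ->
  state_equation Omega f b ua theta y u.
Proof.
move=> Wy; have Ky := optimal_state; have aw := control_admissible (H1_L2f oO Hu).
have Lr := Bd_L2f mO Ooo (state_rhs_Bd aw (dirichlet_ge0 Omega y)).
have ty : 1 <= 2 :> R by rewrite ler1n.
have /(weak_sol_wlaplacian oO bO (Wy _ ty) Lr) Dy := state_weak_sol aw Ky.
by split=> //; rewrite state_denomE.
Qed.

Lemma optimality_system : (forall q : R, 1 <= q -> Wkq Omega 2 q%:E y) ->
  let system p := [/\ adjoint_equation Omega f b ua phi theta y u p,
    gradient_equation Omega f b ua ub theta lambda eps y u p &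
    state_equation Omega f b ua theta y u] in
  exists p, [/\ H10 Omega p, forall q : R, 1 <= q -> Wkq Omega 2 q%:E p, system p &
    forall p', H10 Omega p' -> (forall q : R, 1 <= q -> Wkq Omega 2 q%:E p') ->
      system p' -> ae_in (fun x => p' x = p x)].
Proof.
move=> Wy system; have Ky := optimal_state.
have aw := control_admissible (H1_L2f oO Hu).
have [g Bg phig] := nonlinearity_derive1_Bd mO hphi (state_Bd aw Ky).
have Lg := Bd_L2f mO Ooo Bg.
have [p [Hp Bp Wp Ep]] := adjoint_exists aw Ky Bg Wy.
exists p; split=> //.
- split; [exact/(adjoint_equationP Lg phig Wy Hp Wp)| |exact: state_equation_of].
  exact: gradient_of_adjoint phig Hp Bp Ep.
- move=> p' Hp' Wp' [/(adjoint_equationP Lg phig Wy Hp' Wp') Ep' _ _].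
  exact: adjoint_unique Lg Hp Hp' Ep Ep'.
Qed.

End optimality.
End kirchhoff.

Theorem theorem3p5 (R : realType) (N : nat) (hN : (1 <= N <= 3)%N)
  (Omega : set 'rV[R]_N) (hOmega : bounded_C11_domain Omega)
  (f b ua ub : 'rV[R]_N -> R) (f0 u0 b0 : R)
  (hf0 : 0 < f0) (hf : Lp Omega +oo%E f) (hff0 : ae_in Omega (fun x => f0 <= f x))
  (hua : {within closure Omega, continuous ua})
  (hub : {within closure Omega, continuous ub})
  (hu0 : 0 < u0)
  (hu0ab : forall x, closure Omega x -> u0 <= ua x /\ ua x <= ub x)
  (hb0 : 0 < b0) (hb : Wkq Omega 1 +oo%E b)
  (hbb0 : ae_in Omega (fun x => b0 <= b x))
  (phi : 'rV[R]_N -> R -> R) (hphi : nonlinearity_assumptions Omega phi)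
  (lambda eps : R) (hlambda : 0 < lambda) (heps : 0 < eps)
  (theta : R -> R) (htheta : cutoff_function eps theta)
  (S : ('rV[R]_N -> R) -> ('rV[R]_N -> R))
  (hS : control_to_state_map Omega f b ua S)
  (y u : 'rV[R]_N -> R) (hu : H1 Omega u) (hy : H10 Omega y)
  (hyW : forall q : R, 1 <= q -> Wkq Omega 2 q%:E y)
  (hopt : locally_optimal Omega ua ub S phi theta lambda eps y u) :
  let optimality_system p :=
    [/\ adjoint_equation Omega f b ua phi theta y u p,
        gradient_equation Omega f b ua ub theta lambda eps y u p &
        state_equation Omega f b ua theta y u] in
  exists p,
    [/\ H10 Omega p,
        forall q : R, 1 <= q -> Wkq Omega 2 q%:E p,
        optimality_system p &
        forall p', H10 Omega p' ->
          (forall q : R, 1 <= q -> Wkq Omega 2 q%:E p') ->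
          optimality_system p' -> ae_in Omega (fun x => p' x = p x)].
Proof.
(* A positive dimension supplies the coordinate direction used by the Poincare inequality and the
   barrier. *)
have [oO _ _ bO _] := hOmega; have i0 : 'I_N by case/andP: hN => N0 _; exact: Ordinal N0.
have inO x : Omega x -> u0 <= ua x by move=> /subset_closure /hu0ab[].
have [hb_ _] := hb.
exact: (optimality_system oO bO i0 (Lpoo_Bd oO hf) hf0 hff0 (Lpoo_Bd oO hb_) hb0 hbb0
  (within_continuous_Bd bO hua) hu0 (aeD_W _ inO) hS (within_continuous_Bd bO hub)
  hphi heps htheta hu hy hopt hyW).
Qed.
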